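(* There exist constants $A>0$ and $t_0>0$ such that for all $s=\sigma+it$ with $t>t_0$ and $1-\sigma\ge A\,t^{2/5}\log t$, $$\mathcal{R}(s)=-\chi(s)\eta^{s-1}e^{-\pi i\eta^2}\frac{\sqrt2\,e^{3\pi i/8}\sin\pi\eta}{2\cos 2\pi\eta}(1+U)\quad\text{with } |U|<1.$$
   Context: $\mathcal{R}(s)=\int_{0\swarrow 1}\frac{x^{-s}e^{\pi i x^2}}{e^{\pi i x}-e^{-\pi i x}}\,dx$ (Riemann's auxiliary function), where $0\swarrow1$ is a straight line of direction $e^{-3\pi i/4}$ crossing the real axis in $(0,1)$ and $x^{-s}$ is the principal branch. $\chi(s)=\pi^{s-1/2}\Gamma(\frac{1-s}{2})/\Gamma(\frac s2)$. $\eta:=\sqrt{(s-1)/(2\pi i)}$ with $-\pi/4<\arg\eta<3\pi/4$; $\eta^{s-1}$ is the principal power. *)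

(* Defs.v *)
From Stdlib Require Export Reals.
From Coquelicot Require Export Coquelicot.

Local Open Scope R_scope.

(* Principal argument of a complex number, with values in (-PI, PI];
   Arg 0 = 0 (never used at 0). *)
Definition Arg (z : C) : R :=
  let x := Re z in let y := Im z in
  if Rlt_dec 0 x then atan (y / x)
  else if Rlt_dec x 0 then
         (if Rle_dec 0 y then atan (y / x) + PI else atan (y / x) - PI)
  else if Rlt_dec 0 y then PI / 2
  else if Rlt_dec y 0 then - (PI / 2)
  else 0.

Definition Cexp (z : C) : C :=
  (RtoC (exp (Re z)) * (RtoC (cos (Im z)) + Ci * RtoC (sin (Im z))))%C.

Definition CLog (z : C) : C := (RtoC (ln (Cmod z)) + Ci * RtoC (Arg z))%C.

Definition Cpowc (a b : C) : C := Cexp (b * CLog a)%C.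

Definition Csin (z : C) : C := ((Cexp (Ci * z) - Cexp (- (Ci * z))) / (2 * Ci))%C.
Definition Ccos (z : C) : C := ((Cexp (Ci * z) + Cexp (- (Ci * z))) / 2)%C.

(* Euler's Gamma function on C, via Gauss' product formula
   Gamma z = lim_n n! n^z / (z (z+1) ... (z+n))  (z not in {0,-1,-2,...}). *)
Fixpoint Cprod_shift (z : C) (n : nat) : C :=
  match n with
  | O => z
  | S m => (Cprod_shift z m * (z + RtoC (INR (S m))))%C
  end.

Definition Gamma_seq (z : C) (n : nat) : C :=
  (RtoC (INR (Factorial.fact n)) * Cexp (z * RtoC (ln (INR n))) / Cprod_shift z n)%C.

Definition CGamma (z : C) : C :=
  (real (Lim_seq (fun n => Re (Gamma_seq z n))),
   real (Lim_seq (fun n => Im (Gamma_seq z n)))).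

Definition chi (s : C) : C :=
  (Cexp ((s - RtoC (1/2)) * RtoC (ln PI))
   * CGamma ((1 - s) / 2) / CGamma (s / 2))%C.

Definition eta (s : C) : C :=
  let w := Cpowc ((s - 1) / (2 * RtoC PI * Ci))%C (RtoC (1/2)) in
  if Rlt_dec (- (PI / 4)) (Arg w) then
    (if Rlt_dec (Arg w) (3 * PI / 4) then w else (- w)%C)
  else (- w)%C.

(* direction e^{-3 pi i/4} of the integration line 0 \swarrow 1 *)
Definition omega : C := Cexp (Ci * RtoC (- (3 * PI / 4)))%C.

(* integrand of Riemann's auxiliary function R(s), on the line
   x = c + u * omega (u from -oo to +oo), including dx = omega du *)
Definition Rintegrand (s : C) (c : R) (u : R) : C :=
  let x := (RtoC c + RtoC u * omega)%C in
  (Cpowc x (- s) * Cexp (RtoC PI * Ci * x * x)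
   / (Cexp (RtoC PI * Ci * x) - Cexp (- (RtoC PI * Ci * x))) * omega)%C.

(* "R(s) = v": the (improper) contour integral over 0 \swarrow 1, crossing the
   real axis at c, converges to v *)
Definition RiemannAux_is (s : C) (c : R) (v : C) : Prop :=
  is_RInt_gen (Rintegrand s c) (Rbar_locally m_infty) (Rbar_locally p_infty) v.

Definition main_term (s : C) : C :=
  let e := eta s in
  (- chi s * Cpowc e (s - 1) * Cexp (- (RtoC PI * Ci * e * e))
   * (RtoC (sqrt 2) * Cexp (Ci * RtoC (3 * PI / 8)) * Csin (RtoC PI * e))
   / (2 * Ccos (2 * RtoC PI * e)))%C.

(* Main.v *)
Require Import Defs.
From Stdlib Require Import Lra Lia Psatz.
Local Open Scope R_scope.

(** Since [Re s < 0], the contour of R(s) may be pushed to the origin. Its lower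
    half is then [exp (i pi s)] times its upper half, and the upper half may be
    rotated onto the ray through the saddle point [eta] of [x^(1-s) exp (i pi x^2)],
    along which the modulus of the integrand is maximal at [eta]. In the upper half
    plane [1 / (exp (i pi x) - exp (- i pi x))] is minus the sum over odd [m] of
    [exp (i pi m x)]. Keep about [t^(1/10)] terms: the geometric remainder is
    negligible on the ray because [Im eta] is at least of the order of
    [t^(-1/10) log t]. Each term has its saddle point near [eta - m / 4] and
    contributes, up to a relative error [O (m^3 / |eta|)], a multiple of
    [exp (i pi m eta) exp (- i pi m^2 / 8)]. As [m^2 = 1] modulo 8, these phases have
    period four and the sum over [m] is a constant times
    [sin (pi eta) / cos (2 pi eta)]. The accumulated error [t^(4/10) / |eta|] is
    small against [1 - exp (- 2 pi Im eta)] when [1 - Re s] is large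
    compared with [t^(2/5)]. Finally Stirling's formula, applied to Gauss' product
    away from the real axis, gives
    [chi s = exp (i pi / 4) eta^(1-2s) exp (2 i pi eta^2) (1 + O (1/t))]. *)

(** The exponent 2/5 is the outcome of a balance. Put n = 1 - Re s = 4 pi Re eta Im eta, so that Im
    eta has the order of n / t^(1/2) unless s lies far to the left. With K terms kept, the geometric
    remainder requires K Im eta to be at least of the order of log t, while the errors m^3 / |eta|
    add up to K^4 / |eta|. Near the real axis the main term itself degenerates like Im eta, so K^4
    must be small against Re eta Im eta, that is, against n. Both demands are compatible only if n^5
    exceeds t^2 up to logarithms. No contour is deformed as such. Every integrand receives a
    primitive on a star-shaped domain, an integral from 0 to infinity is the difference of the
    limits of that primitive, and every estimate of an integral is a mean value inequality. The
    integrand of R(s) has poles at the integers, which confines its primitive to [cut_dom]; the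
    separate terms have none, so their contours may dip below the real axis inside [slit]. All
    numerical constants are generous and are paid for by a huge [t0]. *)

(** * Complex exponential, argument and logarithm *)

Lemma C_ext (a b : C) : Re a = Re b -> Im a = Im b -> a = b.
Proof. destruct a, b; simpl; intros; subst; reflexivity. Qed.

Lemma re_minus (a b : C) : Re (a - b)%C = Re a - Re b.
Proof. reflexivity. Qed.

Lemma im_minus (a b : C) : Im (a - b)%C = Im a - Im b.
Proof. reflexivity. Qed.

Lemma Re_Cexp z : Re (Cexp z) = exp (Re z) * cos (Im z).
Proof. unfold Cexp; simpl; ring. Qed.

Lemma Im_Cexp z : Im (Cexp z) = exp (Re z) * sin (Im z).
Proof. unfold Cexp; simpl; ring. Qed.

Lemma Cexp_plus a b : Cexp (a + b)%C = (Cexp a * Cexp b)%C.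
Proof.
  apply C_ext; rewrite ?re_mult, ?im_mult, ?Re_Cexp, ?Im_Cexp, re_plus, im_plus,
    exp_plus, ?cos_plus, ?sin_plus; ring.
Qed.

Lemma Cexp_0 : Cexp 0 = 1%C.
Proof. apply C_ext; rewrite ?Re_Cexp, ?Im_Cexp; simpl; rewrite exp_0, ?cos_0, ?sin_0; ring. Qed.

Lemma Cmod_Cexp z : Cmod (Cexp z) = exp (Re z).
Proof.
  unfold Cmod. change (fst (Cexp z)) with (Re (Cexp z)); change (snd (Cexp z)) with (Im (Cexp z)).
  rewrite Re_Cexp, Im_Cexp.
  replace ((exp (Re z) * cos (Im z)) ^ 2 + (exp (Re z) * sin (Im z)) ^ 2)
    with (Rsqr (exp (Re z))).
  - apply sqrt_Rsqr, Rlt_le, exp_pos.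
  - pose proof (sin2_cos2 (Im z)) as H. unfold Rsqr in *. nra.
Qed.

Lemma Cexp_neq0 z : Cexp z <> 0%C.
Proof. apply Cmod_gt_0. rewrite Cmod_Cexp. apply exp_pos. Qed.

Lemma Cexp_opp z : Cexp (- z)%C = (/ Cexp z)%C.
Proof.
  assert (H : (Cexp (- z) * Cexp z = 1)%C).
  { rewrite <- Cexp_plus, <- Cexp_0. f_equal. ring. }
  rewrite <- (Cmult_1_l (/ Cexp z)%C), <- H. field. apply Cexp_neq0.
Qed.

Lemma Cexp_minus a b : Cexp (a - b)%C = (Cexp a / Cexp b)%C.
Proof. unfold Cminus. rewrite Cexp_plus, Cexp_opp. reflexivity. Qed.

Lemma Cexp_mult_nat z n : Cexp (RtoC (INR n) * z)%C = (Cexp z ^ n)%C.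
Proof.
  induction n as [|n IH].
  - simpl. rewrite Cmult_0_l. apply Cexp_0.
  - rewrite S_INR, RtoC_plus, Cmult_plus_distr_r, Cmult_1_l, Cexp_plus, IH. simpl. ring.
Qed.

Lemma Cexp_RtoC x : Cexp (RtoC x) = RtoC (exp x).
Proof. apply C_ext; rewrite ?Re_Cexp, ?Im_Cexp; simpl; rewrite ?cos_0, ?sin_0; ring. Qed.

(** The plane cut along the nonpositive real axis; the alternatives are the regions on which [Arg]
    has a smooth formula. *)
Definition slit (z : C) : Prop := 0 < Re z \/ Im z <> 0.

Lemma slit_neq0 z : slit z -> z <> 0%C.
Proof. intros [H|H] E; subst z; simpl in H; lra. Qed.

Lemma Arg_right z : 0 < Re z -> Arg z = atan (Im z / Re z).
Proof. intros H. unfold Arg. destruct (Rlt_dec 0 (Re z)); lra. Qed.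

Lemma atan_inv_neg x : x < 0 -> atan (/ x) = - (PI / 2) - atan x.
Proof.
  intros H. replace (/ x) with (- / - x) by (field; lra).
  rewrite atan_opp, atan_inv, atan_opp by lra. ring.
Qed.

(** Unlike the case distinction on the sign of [Re z], this formula is smooth across the imaginary
    axis, so [Arg] can be differentiated there. *)
Lemma Arg_up z : 0 < Im z -> Arg z = PI / 2 - atan (Re z / Im z).
Proof.
  intros H. unfold Arg.
  destruct (Rlt_dec 0 (Re z)) as [h|h].
  { replace (Im z / Re z) with (/ (Re z / Im z)) by (field; lra).
    apply atan_inv. apply Rdiv_lt_0_compat; lra. }
  destruct (Rlt_dec (Re z) 0) as [h'|h'].
  { destruct (Rle_dec 0 (Im z)); [|lra].
    replace (Im z / Re z) with (/ (Re z / Im z)) by (field; lra).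
    rewrite atan_inv_neg. lra. apply Rdiv_neg_pos; lra. }
  destruct (Rlt_dec 0 (Im z)); [|lra].
  replace (Re z / Im z) with 0 by (replace (Re z) with 0 by lra; field; lra).
  rewrite atan_0. lra.
Qed.

Lemma Arg_down z : Im z < 0 -> Arg z = - (PI / 2) - atan (Re z / Im z).
Proof.
  intros H. unfold Arg.
  destruct (Rlt_dec 0 (Re z)) as [h|h].
  { replace (Im z / Re z) with (/ (Re z / Im z)) by (field; lra).
    apply atan_inv_neg. apply Rdiv_pos_neg; lra. }
  destruct (Rlt_dec (Re z) 0) as [h'|h'].
  { destruct (Rle_dec 0 (Im z)); [lra|].
    replace (Im z / Re z) with (/ (Re z / Im z)) by (field; lra).
    rewrite atan_inv. lra. 
    replace (Re z / Im z) with ((- Re z) / (- Im z)) by (field; lra).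
    apply Rdiv_lt_0_compat; lra. }
  destruct (Rlt_dec 0 (Im z)); [lra|].
  destruct (Rlt_dec (Im z) 0); [|lra].
  replace (Re z / Im z) with 0 by (replace (Re z) with 0 by lra; field; lra).
  rewrite atan_0. lra.
Qed.

Lemma Arg_bound z : slit z -> - PI < Arg z < PI.
Proof.
  intros H. pose proof PI_RGT_0.
  destruct H as [H|H].
  - rewrite Arg_right by easy. pose proof (atan_bound (Im z / Re z)). lra.
  - pose proof (atan_bound (Re z / Im z)).
    destruct (Rdichotomy _ _ H); [rewrite Arg_down by easy|rewrite Arg_up by easy]; lra.
Qed.

Lemma Arg_right_bound z : 0 < Re z -> - (PI / 2) < Arg z < PI / 2.
Proof. intros H. rewrite Arg_right by easy. pose proof (atan_bound (Im z / Re z)). lra. Qed.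

Lemma Arg_up_bound z : 0 < Im z -> 0 < Arg z < PI.
Proof. intros H. rewrite Arg_up by easy. pose proof (atan_bound (Re z / Im z)). lra. Qed.

Lemma Arg_down_bound z : Im z < 0 -> - PI < Arg z < 0.
Proof. intros H. rewrite Arg_down by easy. pose proof (atan_bound (Re z / Im z)). lra. Qed.

Lemma Cmod_sqrt z : Cmod z = sqrt (Re z ^ 2 + Im z ^ 2).
Proof. reflexivity. Qed.

Lemma polar_aux x y : 0 < x -> sqrt (x ^ 2 + y ^ 2) = x * sqrt (1 + (y / x)²).
Proof.
  intros H.
  replace (x ^ 2 + y ^ 2) with (x ^ 2 * (1 + (y / x)²)) by (unfold Rsqr; field; lra).
  rewrite sqrt_mult_alt by nra. f_equal. rewrite sqrt_pow2; lra.
Qed.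

Lemma sqrt_1_sqr_pos u : 0 < sqrt (1 + u²).
Proof. apply sqrt_lt_R0. pose proof (Rle_0_sqr u). lra. Qed.

Lemma polar z : slit z ->
  Re z = Cmod z * cos (Arg z) /\ Im z = Cmod z * sin (Arg z).
Proof.
  intros H. rewrite Cmod_sqrt.
  destruct H as [H|H].
  - rewrite Arg_right by easy. rewrite polar_aux by easy.
    rewrite cos_atan, sin_atan. pose proof (sqrt_1_sqr_pos (Im z / Re z)).
    split; field; lra.
  - pose proof (sqrt_1_sqr_pos (Re z / Im z)) as P.
    destruct (Rdichotomy _ _ H) as [h|h].
    + rewrite Arg_down by easy.
      replace (Re z ^ 2 + Im z ^ 2) with ((- Im z) ^ 2 + (Re z) ^ 2) by ring.
      rewrite polar_aux by lra.
      replace (Re z / - Im z) with (- (Re z / Im z)) by (field; lra).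
      rewrite <- Rsqr_neg.
      replace (- (PI / 2) - atan (Re z / Im z)) with (- (PI / 2 + atan (Re z / Im z))) by ring.
      rewrite cos_neg, sin_neg, cos_plus, sin_plus, cos_PI2, sin_PI2, cos_atan, sin_atan.
      split; field; lra.
    + rewrite Arg_up by easy.
      replace (Re z ^ 2 + Im z ^ 2) with ((Im z) ^ 2 + (Re z) ^ 2) by ring.
      rewrite polar_aux by lra.
      rewrite cos_minus, sin_minus, cos_PI2, sin_PI2, cos_atan, sin_atan.
      split; field; lra.
Qed.

Lemma Re_CLog z : Re (CLog z) = ln (Cmod z).
Proof. unfold CLog; simpl; ring. Qed.

Lemma Im_CLog z : Im (CLog z) = Arg z.
Proof. unfold CLog; simpl; ring. Qed.

Lemma Cexp_CLog z : slit z -> Cexp (CLog z) = z.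
Proof.
  intros H. pose proof (polar z H) as [H1 H2].
  assert (0 < Cmod z) by (apply Cmod_gt_0, slit_neq0, H).
  apply C_ext; rewrite ?Re_Cexp, ?Im_Cexp, Re_CLog, Im_CLog, exp_ln by easy; lra.
Qed.

(** The cosine of x - y is 1, so the sine of half the difference vanishes, and half the difference
    lies strictly between - PI and PI. *)
Lemma angle_unique x y : cos x = cos y -> sin x = sin y -> - (2 * PI) < x - y < 2 * PI -> x = y.
Proof.
  intros Hc Hs Hb.
  assert (E : cos (x - y) = 1).
  { rewrite cos_minus, Hc, Hs. pose proof (sin2_cos2 y). unfold Rsqr in *. lra. }
  replace (x - y) with (2 * ((x - y) / 2)) in E by field.
  rewrite cos_2a_sin in E.
  assert (S0 : sin ((x - y) / 2) = 0) by nra.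
  destruct (Rtotal_order x y) as [h|[h|h]]; [|easy|].
  - assert (0 < sin (- ((x - y) / 2))) by (apply sin_gt_0; lra).
    rewrite sin_neg in *. lra.
  - assert (0 < sin ((x - y) / 2)) by (apply sin_gt_0; lra). lra.
Qed.

Lemma slit_Cexp z : - PI < Im z < PI -> slit (Cexp z).
Proof.
  intros H. unfold slit. rewrite Re_Cexp, Im_Cexp. pose proof (exp_pos (Re z)).
  destruct (Req_dec (Im z) 0) as [E|E].
  - left. rewrite E, cos_0. lra.
  - right. apply Rmult_integral_contrapositive. split; [lra|].
    destruct (Rdichotomy _ _ E).
    + assert (0 < sin (- Im z)) by (apply sin_gt_0; lra). rewrite sin_neg in *. lra.
    + assert (0 < sin (Im z)) by (apply sin_gt_0; lra). lra.
Qed.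

Lemma CLog_Cexp z : - PI < Im z < PI -> CLog (Cexp z) = z.
Proof.
  intros H. pose proof (slit_Cexp z H) as Hs.
  apply C_ext; rewrite ?Re_CLog, ?Im_CLog.
  - rewrite Cmod_Cexp. apply ln_exp.
  - destruct (polar _ Hs) as [H1 H2]. rewrite Cmod_Cexp, ?Re_Cexp, ?Im_Cexp in *.
    pose proof (exp_pos (Re z)). pose proof (Arg_bound _ Hs).
    apply angle_unique; [| |lra].
    + apply Rmult_eq_reg_l with (exp (Re z)); lra.
    + apply Rmult_eq_reg_l with (exp (Re z)); lra.
Qed.

Lemma CLog_mult a b : slit a -> slit b -> - PI < Arg a + Arg b < PI ->
  CLog (a * b)%C = (CLog a + CLog b)%C.
Proof.
  intros Ha Hb H.
  rewrite <- (Cexp_CLog a Ha) at 1. rewrite <- (Cexp_CLog b Hb) at 1.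
  rewrite <- Cexp_plus. apply CLog_Cexp. rewrite im_plus, !Im_CLog. exact H.
Qed.

Lemma CLog_RtoC x : 0 < x -> CLog (RtoC x) = RtoC (ln x).
Proof.
  intros H. apply C_ext; rewrite ?Re_CLog, ?Im_CLog.
  - rewrite Cmod_R, Rabs_pos_eq by lra. reflexivity.
  - rewrite Arg_right by (simpl; lra). simpl. unfold Rdiv. rewrite Rmult_0_l. apply atan_0.
Qed.

Lemma CLog_scal x z : 0 < x -> slit z -> CLog (RtoC x * z)%C = (RtoC (ln x) + CLog z)%C.
Proof.
  intros H Hz. rewrite CLog_mult, CLog_RtoC; auto.
  - left. exact H.
  - assert (E : Arg (RtoC x) = 0).
    { rewrite <- Im_CLog, CLog_RtoC by easy. reflexivity. }
    rewrite E, Rplus_0_l. apply Arg_bound, Hz.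
Qed.

(** * Derivatives of complex-valued functions of a real variable *)

Lemma isd_plus (f g : R -> R) u a b : is_derive f u a -> is_derive g u b ->
  is_derive (fun v => f v + g v) u (a + b).
Proof. exact (@is_derive_plus R_AbsRing R_NormedModule f g u a b). Qed.

Lemma isd_opp (f : R -> R) u a : is_derive f u a -> is_derive (fun v => - f v) u (- a).
Proof. exact (@is_derive_opp R_AbsRing R_NormedModule f u a). Qed.

Lemma isd_minus (f g : R -> R) u a b : is_derive f u a -> is_derive g u b ->
  is_derive (fun v => f v - g v) u (a - b).
Proof. exact (@is_derive_minus R_AbsRing R_NormedModule f g u a b). Qed.

Lemma isd_comp (f g : R -> R) u a b : is_derive f (g u) a -> is_derive g u b ->
  is_derive (fun v => f (g v)) u (b * a).
Proof. exact (@is_derive_comp R_AbsRing R_NormedModule f g u a b). Qed.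

Lemma is_derive_continuous_R (f : R -> R) u l : is_derive f u l -> continuous f u.
Proof. intros H. apply (ex_derive_continuous (K := R_AbsRing) (V := R_NormedModule)). eexists; exact H. Qed.

Lemma locally_pos (f : R -> R) u : continuous f u -> 0 < f u -> locally u (fun v => 0 < f v).
Proof.
  intros H P. apply (H (fun y => 0 < y)). now apply (open_gt 0).
Qed.

(** Componentwise, so that the real differentiation rules and the real mean value theorem apply
    directly. *)
Definition cder (g : R -> C) (u : R) (l : C) : Prop :=
  is_derive (fun v => Re (g v)) u (Re l) /\ is_derive (fun v => Im (g v)) u (Im l).

Lemma cder_eq g u l l' : cder g u l -> l = l' -> cder g u l'.
Proof. intros H <-. exact H. Qed.

Lemma cder_ext g h u l : (forall v, g v = h v) -> cder g u l -> cder h u l.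
Proof.
  intros E [H1 H2]. split; [eapply is_derive_ext; [|exact H1]|eapply is_derive_ext; [|exact H2]];
  intros v; simpl; now rewrite E.
Qed.

Lemma cder_const c u : cder (fun _ => c) u 0%C.
Proof. split; simpl; auto_derive; easy. Qed.

Lemma cder_RtoC (g : R -> R) u l : is_derive g u l -> cder (fun v => RtoC (g v)) u (RtoC l).
Proof. intros H. split; simpl; [exact H|auto_derive; easy]. Qed.

Lemma cder_id u : cder RtoC u 1%C.
Proof. apply (cder_RtoC (fun v => v)). auto_derive; easy. Qed.

Lemma cder_plus g h u lg lh : cder g u lg -> cder h u lh ->
  cder (fun v => (g v + h v)%C) u (lg + lh)%C.
Proof.
  intros [G1 G2] [H1 H2]; split.
  - eapply is_derive_ext; [intros v; symmetry; apply re_plus|]. rewrite re_plus.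
    now apply isd_plus.
  - eapply is_derive_ext; [intros v; symmetry; apply im_plus|]. rewrite im_plus.
    now apply isd_plus.
Qed.

Lemma cder_opp g u lg : cder g u lg -> cder (fun v => (- g v)%C) u (- lg)%C.
Proof.
  intros [G1 G2]; split; simpl; now apply isd_opp.
Qed.

Lemma cder_minus g h u lg lh : cder g u lg -> cder h u lh ->
  cder (fun v => (g v - h v)%C) u (lg - lh)%C.
Proof. intros. apply cder_plus; [easy|now apply cder_opp]. Qed.

Lemma cder_mult g h u lg lh : cder g u lg -> cder h u lh ->
  cder (fun v => (g v * h v)%C) u (lg * h u + g u * lh)%C.
Proof.
  intros [G1 G2] [H1 H2]; split.
  - eapply is_derive_ext; [intros v; symmetry; apply re_mult|]. rewrite re_plus, !re_mult.
    replace (_ + _) with ((Re lg * Re (h u) + Re (g u) * Re lh)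
       - (Im lg * Im (h u) + Im (g u) * Im lh)) by ring.
    apply isd_minus; now apply Derive.is_derive_mult.
  - eapply is_derive_ext; [intros v; symmetry; apply im_mult|]. rewrite im_plus, !im_mult.
    replace (_ + _) with ((Re lg * Im (h u) + Re (g u) * Im lh)
       + (Im lg * Re (h u) + Im (g u) * Re lh)) by ring.
    apply isd_plus; now apply Derive.is_derive_mult.
Qed.

Lemma cder_scal c g u lg : cder g u lg -> cder (fun v => (c * g v)%C) u (c * lg)%C.
Proof.
  intros H. eapply cder_eq. apply cder_mult. apply cder_const. exact H. cbv beta. ring.
Qed.

Lemma cder_scal_r c g u lg : cder g u lg -> cder (fun v => (g v * c)%C) u (lg * c)%C.
Proof.
  intros H. eapply cder_eq. apply cder_mult. exact H. apply cder_const. cbv beta. ring.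
Qed.

Lemma cder_affine a b u : cder (fun v => (a + RtoC v * b)%C) u b.
Proof.
  eapply cder_eq. apply cder_plus. apply cder_const. apply cder_scal_r. apply cder_id. cbv beta. ring.
Qed.

Lemma cder_comp_R g (k : R -> R) u l m : cder g (k u) l -> is_derive k u m ->
  cder (fun v => g (k v)) u (RtoC m * l)%C.
Proof.
  intros [G1 G2] Hk. split.
  - rewrite re_scal_l. apply (isd_comp (fun v => Re (g v)) k); assumption.
  - rewrite im_scal_l. apply (isd_comp (fun v => Im (g v)) k); assumption.
Qed.

Section RealDerivatives.
Variables (x y : R -> R) (u a b : R).
Hypothesis (X : is_derive x u a) (Y : is_derive y u b).

Lemma isd_exp_cos : is_derive (fun v => exp (x v) * cos (y v)) u
  (exp (x u) * cos (y u) * a - exp (x u) * sin (y u) * b).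
Proof.
  auto_derive; [repeat split; eexists; eassumption|].
  change (fun v : R => x v) with x; change (fun v : R => y v) with y;
  rewrite ?(is_derive_unique x u a X), ?(is_derive_unique y u b Y). ring.
Qed.

Lemma isd_exp_sin : is_derive (fun v => exp (x v) * sin (y v)) u
  (exp (x u) * cos (y u) * b + exp (x u) * sin (y u) * a).
Proof.
  auto_derive; [repeat split; eexists; eassumption|].
  change (fun v : R => x v) with x; change (fun v : R => y v) with y;
  rewrite ?(is_derive_unique x u a X), ?(is_derive_unique y u b Y). ring.
Qed.

Lemma isd_inv_re : 0 < x u ^ 2 + y u ^ 2 ->
  is_derive (fun v => x v / (x v ^ 2 + y v ^ 2)) u
  ((a * (x u ^ 2 + y u ^ 2) - x u * (2 * x u * a + 2 * y u * b)) / (x u ^ 2 + y u ^ 2) ^ 2).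
Proof.
  intros P. auto_derive; [repeat split; try (eexists; eassumption); nra|].
  change (fun v : R => x v) with x; change (fun v : R => y v) with y;
  rewrite ?(is_derive_unique x u a X), ?(is_derive_unique y u b Y). field. nra.
Qed.

Lemma isd_inv_im : 0 < x u ^ 2 + y u ^ 2 ->
  is_derive (fun v => - y v / (x v ^ 2 + y v ^ 2)) u
  ((- b * (x u ^ 2 + y u ^ 2) + y u * (2 * x u * a + 2 * y u * b)) / (x u ^ 2 + y u ^ 2) ^ 2).
Proof.
  intros P. auto_derive; [repeat split; try (eexists; eassumption); nra|].
  change (fun v : R => x v) with x; change (fun v : R => y v) with y;
  rewrite ?(is_derive_unique x u a X), ?(is_derive_unique y u b Y). field. nra.
Qed.

Lemma isd_ln_mod : 0 < x u ^ 2 + y u ^ 2 ->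
  is_derive (fun v => ln (sqrt (x v ^ 2 + y v ^ 2))) u
  ((x u * a + y u * b) / (x u ^ 2 + y u ^ 2)).
Proof.
  intros P. assert (Q := sqrt_lt_R0 _ P).
  auto_derive.
  - replace (x u * (x u * 1) + y u * (y u * 1)) with (x u ^ 2 + y u ^ 2) by ring.
    repeat split; try (eexists; eassumption); lra.
  - change (fun v : R => x v) with x; change (fun v : R => y v) with y;
  rewrite ?(is_derive_unique x u a X), ?(is_derive_unique y u b Y).
    replace (x u * (x u * 1) + y u * (y u * 1)) with (x u ^ 2 + y u ^ 2) by ring.
    assert (W : sqrt (x u ^ 2 + y u ^ 2) * sqrt (x u ^ 2 + y u ^ 2) = x u ^2+y u^2) by (apply sqrt_def; nra).
    set (w := sqrt (x u ^ 2 + y u ^ 2)) in *. rewrite <- W. field. lra.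
Qed.

Lemma isd_atan_quot : x u <> 0 ->
  is_derive (fun v => atan (y v / x v)) u
  ((b * x u - y u * a) / (x u ^ 2 + y u ^ 2)).
Proof.
  intros P. auto_derive; [repeat split; try (eexists; eassumption); lra|].
  change (fun v : R => x v) with x; change (fun v : R => y v) with y;
  rewrite ?(is_derive_unique x u a X), ?(is_derive_unique y u b Y).
  unfold Rsqr. field. repeat split; nra.
Qed.
End RealDerivatives.

Lemma is_derive_eq (f : R -> R) u a b : is_derive f u a -> a = b -> is_derive f u b.
Proof. intros H <-. exact H. Qed.

Lemma cder_exp g u l : cder g u l -> cder (fun v => Cexp (g v)) u (Cexp (g u) * l)%C.
Proof.
  intros [G1 G2]; split.
  - eapply is_derive_ext; [intros v; symmetry; apply Re_Cexp|]. rewrite re_mult, Re_Cexp, Im_Cexp.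
    exact (isd_exp_cos _ _ _ _ _ G1 G2).
  - eapply is_derive_ext; [intros v; symmetry; apply Im_Cexp|]. rewrite im_mult, Re_Cexp, Im_Cexp.
    exact (isd_exp_sin _ _ _ _ _ G1 G2).
Qed.

(** Retypes an equality whose carrier is only convertible to [R], so that [ring] and [field]
    recognise it. *)
Ltac Req := match goal with |- @eq _ ?a ?b => change (@eq R a b) end.

Lemma sqr_sum_pos (z : C) : z <> 0%C -> 0 < Re z ^ 2 + Im z ^ 2.
Proof.
  intros H. destruct (Req_dec (Re z) 0) as [E|E]; [|nra].
  destruct (Req_dec (Im z) 0) as [E'|E']; [|nra].
  elim H. apply C_ext; easy.
Qed.

Lemma re_inv (z : C) : Re (/ z)%C = Re z / (Re z ^ 2 + Im z ^ 2).
Proof. reflexivity. Qed.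
Lemma im_inv (z : C) : Im (/ z)%C = - Im z / (Re z ^ 2 + Im z ^ 2).
Proof. reflexivity. Qed.

Lemma cder_inv g u l : cder g u l -> g u <> 0%C ->
  cder (fun v => (/ g v)%C) u (- l / (g u * g u))%C.
Proof.
  intros [G1 G2] H. apply sqr_sum_pos in H as H'.
  split.
  - eapply is_derive_ext; [intros v; symmetry; apply re_inv|].
    eapply is_derive_eq; [exact (isd_inv_re _ _ _ _ _ G1 G2 H')|].
    unfold Cdiv. rewrite re_mult, re_inv, im_inv, ?re_mult, ?im_mult, re_opp, im_opp.
    set (x := Re (g u)) in *. set (y := Im (g u)) in *.
    replace ((x * x - y * y) ^ 2 + (x * y + y * x) ^ 2) with ((x ^ 2 + y ^ 2) ^ 2) by ring.
    Req. field. lra.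
  - eapply is_derive_ext; [intros v; symmetry; apply im_inv|].
    eapply is_derive_eq; [exact (isd_inv_im _ _ _ _ _ G1 G2 H')|].
    unfold Cdiv. rewrite im_mult, re_inv, im_inv, ?re_mult, ?im_mult, re_opp, im_opp.
    set (x := Re (g u)) in *. set (y := Im (g u)) in *.
    replace ((x * x - y * y) ^ 2 + (x * y + y * x) ^ 2) with ((x ^ 2 + y ^ 2) ^ 2) by ring.
    Req. field. lra.
Qed.

Lemma cder_log g u l : cder g u l -> slit (g u) -> cder (fun v => CLog (g v)) u (l / g u)%C.
Proof.
  intros [G1 G2] H. pose proof (slit_neq0 _ H) as H0. apply sqr_sum_pos in H0.
  pose proof (is_derive_continuous_R _ _ _ G1) as K1.
  pose proof (is_derive_continuous_R _ _ _ G2) as K2.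
  split.
  - eapply is_derive_ext; [intros v; symmetry; rewrite Re_CLog, Cmod_sqrt; reflexivity|].
    eapply is_derive_eq; [exact (isd_ln_mod _ _ _ _ _ G1 G2 H0)|].
    unfold Cdiv. rewrite re_mult, re_inv, im_inv. Req. field. lra.
  - assert (D : forall f d, locally u (fun v => f v = Arg (g v)) -> is_derive f u d ->
       d = Im (l / g u)%C -> is_derive (fun v => Im (CLog (g v))) u (Im (l / g u)%C)).
    { intros f d L D <-. eapply is_derive_ext_loc; [|exact D].
      revert L. apply filter_imp. intros v E. rewrite E, Im_CLog. reflexivity. }
    assert (V : Im (l / g u)%C =
       (Im l * Re (g u) - Im (g u) * Re l) / (Re (g u) ^ 2 + Im (g u) ^ 2)).
    { unfold Cdiv. rewrite im_mult, re_inv, im_inv. field. lra. }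
    rewrite V in D |- *.
    destruct H as [H|H]; [|destruct (Rdichotomy _ _ H) as [h|h]].
    + eapply D; [|apply (isd_atan_quot _ _ _ _ _ G1 G2); lra|reflexivity].
      generalize (locally_pos _ _ K1 H). apply filter_imp. intros v P. now rewrite Arg_right.
    + eapply D; [|apply (isd_minus (fun _ => - (PI / 2))); [|apply (isd_atan_quot _ _ _ _ _ G2 G1); lra]|].
      * assert (K2' : continuous (fun v => - Im (g v)) u) by (now apply (continuous_opp (V := R_NormedModule))).
        assert (h' : 0 < - Im (g u)) by lra.
        generalize (locally_pos _ _ K2' h'). apply filter_imp. intros v P.
        rewrite Arg_down; lra.
      * auto_derive; [easy|reflexivity].
      * Req. field. lra.
    + eapply D; [|apply (isd_minus (fun _ => PI / 2)); [|apply (isd_atan_quot _ _ _ _ _ G2 G1); lra]|].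
      * generalize (locally_pos _ _ K2 h). apply filter_imp. intros v P. now rewrite Arg_up.
      * auto_derive; [easy|reflexivity].
      * Req. field. lra.
Qed.

(** * The mean value inequality *)

Lemma derive_nonpos_le (f df : R -> R) a b : a <= b ->
  (forall u, a <= u <= b -> is_derive f u (df u)) ->
  (forall u, a <= u <= b -> df u <= 0) -> f b <= f a.
Proof.
  intros Hab D N.
  destruct (MVT_gen f a b df) as [c [Hc E]].
  - intros x Hx. rewrite Rmin_left, Rmax_right in Hx by lra. apply D. lra.
  - intros x Hx. rewrite Rmin_left, Rmax_right in Hx by lra.
    apply continuity_pt_filterlim. apply (is_derive_continuous_R f x (df x)). now apply D.
  - rewrite Rmin_left, Rmax_right in Hc by lra. specialize (N c Hc). nra.
Qed.

(** Projecting on the direction w = F b - F a makes the problem real: the inner product of w with F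
    u, minus |w| B u, is nonincreasing. With B a primitive of a majorant, this takes the place of
    every bound on an integral below. *)
Lemma cder_Cmod_le (F dF : R -> C) (B dB : R -> R) a b : a <= b ->
  (forall u, a <= u <= b -> cder F u (dF u)) ->
  (forall u, a <= u <= b -> is_derive B u (dB u)) ->
  (forall u, a <= u <= b -> Cmod (dF u) <= dB u) ->
  Cmod (F b - F a)%C <= B b - B a.
Proof.
  intros Hab DF DB Le.
  set (w := (F b - F a)%C).
  destruct (Req_dec (Cmod w) 0) as [E|E].
  { rewrite E.
    enough (- B b <= - B a) by lra.
    apply (derive_nonpos_le (fun u => - B u) (fun u => - dB u)); [easy| |].
    - intros u Hu. apply isd_opp. now apply DB.
    - intros u Hu. specialize (Le u Hu). pose proof (Cmod_ge_0 (dF u)). lra. }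
  assert (P : 0 < Cmod w) by (pose proof (Cmod_ge_0 w); lra).
  pose (phi := fun u => Re w * Re (F u) + Im w * Im (F u) - Cmod w * B u).
  assert (H : phi b <= phi a).
  { apply (derive_nonpos_le phi
      (fun u => Re w * Re (dF u) + Im w * Im (dF u) - Cmod w * dB u)); [easy| |].
    - intros u Hu. destruct (DF u Hu) as [D1 D2]. specialize (DB u Hu).
      apply isd_minus; [apply isd_plus|]; now apply is_derive_scal.
    - intros u Hu. specialize (Le u Hu).
      assert (Re w * Re (dF u) + Im w * Im (dF u) <= Cmod w * Cmod (dF u)).
      { rewrite <- (Cmod_conj w), <- Cmod_mult.
        replace (Re w * Re (dF u) + Im w * Im (dF u)) with (Re (Cconj w * dF u)).
        - eapply Rle_trans; [apply Rle_abs|apply re_le_Cmod].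
        - rewrite re_mult. unfold Cconj; simpl. unfold Re, Im. ring. }
      nra. }
  unfold phi in H.
  assert (Q : Cmod w ^ 2 = Re w * (Re (F b) - Re (F a)) + Im w * (Im (F b) - Im (F a))).
  { rewrite Cmod2_alt. unfold w. rewrite re_minus, im_minus. ring. }
  apply Rmult_le_reg_l with (Cmod w); nra.
Qed.

Lemma cder_0_const (F : R -> C) a b : a <= b ->
  (forall u, a <= u <= b -> cder F u 0%C) -> F b = F a.
Proof.
  intros Hab H.
  assert (Cmod (F b - F a)%C <= 0).
  { replace 0 with ((fun _ : R => 0) b - (fun _ : R => 0) a) by ring.
    apply (cder_Cmod_le F (fun _ => 0%C) (fun _ => 0) (fun _ => 0)); auto.
    - intros. auto_derive; easy.
    - intros. rewrite Cmod_0. lra. }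
  assert (E : (F b - F a)%C = 0%C) by (apply Cmod_eq_0; pose proof (Cmod_ge_0 (F b - F a)%C); lra).
  replace (F b) with ((F b - F a) + F a)%C by ring. rewrite E. ring.
Qed.

(** * Continuity of complex-valued functions *)

(** The source is a general uniform space because the same rules serve curves, functions on [C], and
    the two-variable functions that arise under a parametric integral. *)
Definition ccont {U : UniformSpace} (g : U -> C) (x : U) : Prop :=
  continuous (fun y => Re (g y)) x /\ continuous (fun y => Im (g y)) x.

Section Ccont.
Context {U : UniformSpace}.
Implicit Types (g h : U -> C) (x : U).

Lemma continuous_Rplus (f1 f2 : U -> R) x :
  continuous f1 x -> continuous f2 x -> continuous (fun y => f1 y + f2 y) x.
Proof. exact (@continuous_plus U R_AbsRing R_NormedModule f1 f2 x). Qed.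

Lemma continuous_Ropp (f1 : U -> R) x :
  continuous f1 x -> continuous (fun y => - f1 y) x.
Proof. exact (@continuous_opp U R_AbsRing R_NormedModule f1 x). Qed.

Lemma continuous_Rminus (f1 f2 : U -> R) x :
  continuous f1 x -> continuous f2 x -> continuous (fun y => f1 y - f2 y) x.
Proof. intros. apply continuous_Rplus; [easy|now apply continuous_Ropp]. Qed.

Lemma continuous_Rmult (f1 f2 : U -> R) x :
  continuous f1 x -> continuous f2 x -> continuous (fun y => f1 y * f2 y) x.
Proof. exact (@continuous_mult U R_AbsRing f1 f2 x). Qed.

Lemma continuous_Rcomp (k : R -> R) (f1 : U -> R) x :
  continuous f1 x -> continuity_pt k (f1 x) -> continuous (fun y => k (f1 y)) x.
Proof.
  intros H K. apply (continuous_comp f1 k); [easy|]. now apply continuity_pt_filterlim.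
Qed.

Lemma continuous_Rdiv (f1 f2 : U -> R) x :
  continuous f1 x -> continuous f2 x -> f2 x <> 0 -> continuous (fun y => f1 y / f2 y) x.
Proof.
  intros. apply continuous_Rmult; [easy|]. apply (continuous_Rcomp Rinv); [easy|].
  apply (continuity_pt_inv (fun y => y)); [|easy]. apply derivable_continuous_pt, derivable_pt_id.
Qed.

Lemma ccont_const (c : C) x : ccont (fun _ => c) x.
Proof. split; apply continuous_const. Qed.

Lemma ccont_plus g h x : ccont g x -> ccont h x -> ccont (fun y => (g y + h y)%C) x.
Proof.
  intros [G1 G2] [H1 H2]; split.
  - apply (continuous_Rplus _ _ _ G1 H1).
  - apply (continuous_Rplus _ _ _ G2 H2).
Qed.

Lemma ccont_opp g x : ccont g x -> ccont (fun y => (- g y)%C) x.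
Proof.
  intros [G1 G2]; split.
  - apply (continuous_Ropp _ _ G1).
  - apply (continuous_Ropp _ _ G2).
Qed.

Lemma ccont_minus g h x : ccont g x -> ccont h x -> ccont (fun y => (g y - h y)%C) x.
Proof. intros. apply ccont_plus; [easy|now apply ccont_opp]. Qed.

Lemma ccont_mult g h x : ccont g x -> ccont h x -> ccont (fun y => (g y * h y)%C) x.
Proof.
  intros [G1 G2] [H1 H2]; split.
  - apply (continuous_Rminus (fun y => Re (g y) * Re (h y)) (fun y => Im (g y) * Im (h y)));
      now apply continuous_Rmult.
  - apply (continuous_Rplus (fun y => Re (g y) * Im (h y)) (fun y => Im (g y) * Re (h y)));
      now apply continuous_Rmult.
Qed.

Lemma continuous_pow2 (f1 : U -> R) x : continuous f1 x -> continuous (fun y => f1 y ^ 2) x.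
Proof.
  intros H. apply (continuous_ext (fun y => f1 y * f1 y)); [intros; simpl; ring|].
  now apply continuous_Rmult.
Qed.

Lemma ccont_inv g x : ccont g x -> g x <> 0%C -> ccont (fun y => (/ g y)%C) x.
Proof.
  intros [G1 G2] H. apply sqr_sum_pos in H.
  assert (N : continuous (fun y => Re (g y) ^ 2 + Im (g y) ^ 2) x)
    by (apply continuous_Rplus; now apply continuous_pow2).
  split.
  - apply (continuous_Rdiv (fun y => Re (g y)) _ x G1 N). lra.
  - apply (continuous_Rdiv (fun y => - Im (g y)) _ x (continuous_Ropp _ _ G2) N). lra.
Qed.

Lemma ccont_exp g x : ccont g x -> ccont (fun y => Cexp (g y)) x.
Proof.
  intros [G1 G2].
  assert (continuous (fun y => exp (Re (g y))) x)
    by (apply (continuous_Rcomp exp); [easy|apply derivable_continuous_pt, derivable_pt_exp]).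
  split.
  - eapply continuous_ext; [intros y; symmetry; apply Re_Cexp|].
    apply continuous_Rmult; [easy|].
    apply (continuous_Rcomp cos); [easy|apply derivable_continuous_pt, derivable_pt_cos].
  - eapply continuous_ext; [intros y; symmetry; apply Im_Cexp|].
    apply continuous_Rmult; [easy|].
    apply (continuous_Rcomp sin); [easy|apply derivable_continuous_pt, derivable_pt_sin].
Qed.

Lemma locally_lt_continuous (f : U -> R) x : continuous f x -> 0 < f x ->
  locally x (fun y => 0 < f y).
Proof. intros H P. apply (H (fun y => 0 < y)). now apply (open_gt 0). Qed.

Lemma ccont_log g x : ccont g x -> slit (g x) -> ccont (fun y => CLog (g y)) x.
Proof.
  intros [G1 G2] H. pose proof (slit_neq0 _ H) as H0. apply sqr_sum_pos in H0.
  assert (N : continuous (fun y => Re (g y) ^ 2 + Im (g y) ^ 2) x)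
    by (apply continuous_Rplus; now apply continuous_pow2).
  assert (A : forall u, continuity_pt atan u)
    by (intros; apply derivable_continuous_pt, derivable_pt_atan).
  split.
  - eapply continuous_ext; [intros y; symmetry; rewrite Re_CLog, Cmod_sqrt; reflexivity|].
    apply (continuous_Rcomp ln).
    + apply (continuous_Rcomp sqrt); [easy|]. apply continuity_pt_sqrt. lra.
    + apply derivable_continuous_pt. eexists. apply derivable_pt_lim_ln, sqrt_lt_R0, H0.
  - assert (D : forall f, locally x (fun y => f y = Arg (g y)) -> continuous f x ->
       continuous (fun y => Im (CLog (g y))) x).
    { intros f L D. eapply continuous_ext_loc; [|exact D].
      revert L. apply filter_imp. intros v E. rewrite E, Im_CLog. reflexivity. }
    destruct H as [H|H]; [|destruct (Rdichotomy _ _ H) as [h|h]].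
    + apply (D (fun y => atan (Im (g y) / Re (g y)))).
      * generalize (locally_lt_continuous _ _ G1 H). apply filter_imp. intros y P.
        now rewrite Arg_right.
      * apply (continuous_Rcomp atan); [|apply A]. apply continuous_Rdiv; auto. lra.
    + apply (D (fun y => - (PI / 2) - atan (Re (g y) / Im (g y)))).
      * assert (h' : 0 < - Im (g x)) by lra.
        generalize (locally_lt_continuous _ _ (continuous_Ropp _ _ G2) h').
        apply filter_imp. intros y P. rewrite Arg_down; lra.
      * apply continuous_Rminus; [apply continuous_const|].
        apply (continuous_Rcomp atan); [|apply A]. now apply continuous_Rdiv.
    + apply (D (fun y => PI / 2 - atan (Re (g y) / Im (g y)))).
      * generalize (locally_lt_continuous _ _ G2 h).
        apply filter_imp. intros y P. now rewrite Arg_up.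
      * apply continuous_Rminus; [apply continuous_const|].
        apply (continuous_Rcomp atan); [|apply A]. now apply continuous_Rdiv.
Qed.

Lemma ccont_continuous g x : ccont g x -> continuous (g : U -> C_UniformSpace) x.
Proof.
  intros [G1 G2].
  apply (continuous_ext (fun y => (Re (g y), Im (g y)))).
  { intros y. now destruct (g y). }
  apply (continuous_comp_2 (fun y => Re (g y)) (fun y => Im (g y)) (fun a b : R => (a, b)) x G1 G2).
  apply (continuous_ext (fun z => z)); [now intros []|]. apply continuous_id.
Qed.

Lemma ccont_comp (f : C -> C) g x : ccont g x -> @ccont C_UniformSpace f (g x) ->
  ccont (fun y => f (g y)) x.
Proof.
  intros G [F1 F2]. apply ccont_continuous in G. split.
  - exact (continuous_comp g (fun z => Re (f z)) x G F1).
  - exact (continuous_comp g (fun z => Im (f z)) x G F2).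
Qed.

End Ccont.

Lemma ccont_id (z : C) : @ccont C_UniformSpace (fun w => w) z.
Proof.
  destruct z as [a b]. split.
  - apply (continuous_fst (U := R_UniformSpace) (V := R_UniformSpace)).
  - apply (continuous_snd (U := R_UniformSpace) (V := R_UniformSpace)).
Qed.

(** * Primitives of holomorphic functions *)

(* [f] has derivative [f'] along every line through a point of [D]; the contour
   arguments need no more than this from holomorphy. *)
Definition hol (D : C -> Prop) (f f' : C -> C) : Prop :=
  forall z d, D z -> cder (fun v => f (z + RtoC v * d)%C) 0 (f' z * d)%C.

Definition copen (D : C -> Prop) : Prop :=
  forall z : C_UniformSpace, D z -> locally z D.

(** [hol] speaks of parameter 0 only; translating the parameter by u reaches every other point of
    the line. *)
Lemma hol_line D f f' a b u : hol D f f' -> D (a + RtoC u * b)%C ->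
  cder (fun v => f (a + RtoC v * b)%C) u (f' (a + RtoC u * b) * b)%C.
Proof.
  intros H Hu.
  assert (K : cder (fun v => f ((a + RtoC u * b) + RtoC (v - u) * b)%C) u
     (RtoC 1 * (f' (a + RtoC u * b)%C * b))%C).
  { apply (cder_comp_R (fun w => f ((a + RtoC u * b) + RtoC w * b)%C) (fun v => v - u)).
    - replace (u - u) with 0 by ring. now apply H.
    - auto_derive; [easy|ring]. }
  eapply cder_ext; [|eapply cder_eq; [exact K|ring]].
  intros v. cbv beta. f_equal. rewrite RtoC_minus. ring.
Qed.

Lemma copen_pre {U : UniformSpace} D (g : U -> C) x : copen D -> ccont g x -> D (g x) ->
  locally x (fun y => D (g y)).
Proof. intros HD G H. exact (ccont_continuous g x G D (HD _ H)). Qed.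

Lemma ccont_R2 (x : R * R) : ccont (fun p : R * R => RtoC (fst p)) x /\
  ccont (fun p : R * R => RtoC (snd p)) x.
Proof.
  destruct x as [a b].
  split; split; simpl; try apply continuous_const.
  - apply (continuous_fst (U := R_UniformSpace) (V := R_UniformSpace)).
  - apply (continuous_snd (U := R_UniformSpace) (V := R_UniformSpace)).
Qed.

Lemma cder_ccont g u l : cder g u l -> ccont g u.
Proof. intros [H1 H2]. split; eapply is_derive_continuous_R; eassumption. Qed.

Lemma cder_is_RInt (g dg : R -> C) a b :
  (forall u, Rmin a b <= u <= Rmax a b -> cder g u (dg u)) ->
  (forall u, Rmin a b <= u <= Rmax a b -> ccont dg u) ->
  is_RInt (fun u => Re (dg u)) a b (Re (g b) - Re (g a)) /\
  is_RInt (fun u => Im (dg u)) a b (Im (g b) - Im (g a)).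
Proof.
  intros H K. split.
  - apply (is_RInt_derive (fun u => Re (g u)) (fun u => Re (dg u))); intros; now (apply H || apply K).
  - apply (is_RInt_derive (fun u => Im (g u)) (fun u => Im (dg u))); intros; now (apply H || apply K).
Qed.

Section Primitive.
Variables (D : C -> Prop) (c : C) (f f' : C -> C).
Hypothesis D_open : copen D.
Hypothesis D_star : forall z t, D z -> 0 <= t <= 1 -> D (c + RtoC t * (z - c))%C.
Hypothesis f_hol : hol D f f'.
Hypothesis f_cont : forall z : C_UniformSpace, D z -> ccont f z.
Hypothesis f'_cont : forall z : C_UniformSpace, D z -> ccont f' z.

Let phi (z d : C) (h t : R) : C :=
  (f (c + RtoC t * (z + RtoC h * d - c)) * (z + RtoC h * d - c))%C.

Let psi (z d : C) (h t : R) : C :=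
  (f' (c + RtoC t * (z + RtoC h * d - c)) * (RtoC t * d) * (z + RtoC h * d - c)
   + f (c + RtoC t * (z + RtoC h * d - c)) * d)%C.

Let w_cont z d (p : R * R) :
  ccont (fun p : R * R => (c + RtoC (snd p) * (z + RtoC (fst p) * d - c))%C) p.
Proof.
  destruct (ccont_R2 p). apply ccont_plus; [apply ccont_const|].
  apply ccont_mult; [easy|]. apply ccont_minus; [|apply ccont_const].
  apply ccont_plus; [apply ccont_const|]. apply ccont_mult; [easy|apply ccont_const].
Qed.

Let phi_der z d h t : D (c + RtoC t * (z + RtoC h * d - c))%C ->
  cder (fun h => phi z d h t) h (psi z d h t).
Proof.
  intros H. unfold phi, psi.
  apply (cder_mult (fun v => f (c + RtoC t * (z + RtoC v * d - c))%C)).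
  - apply (cder_ext (fun v => f ((c + RtoC t * (z - c)) + RtoC v * (RtoC t * d))%C)).
    { intros v. f_equal. ring. }
    replace (c + RtoC t * (z + RtoC h * d - c))%C
      with ((c + RtoC t * (z - c)) + RtoC h * (RtoC t * d))%C in * by ring.
    now apply (hol_line D f f').
  - apply (cder_ext (fun v => (z - c) + RtoC v * d)%C); [intros; ring|]. apply cder_affine.
Qed.

Let psi_cont z d (p : R * R) : D (c + RtoC (snd p) * (z + RtoC (fst p) * d - c))%C ->
  ccont (fun p : R * R => psi z d (fst p) (snd p)) p.
Proof.
  intros H. destruct (ccont_R2 p) as [R1 R2].
  pose proof (w_cont z d p) as W.
  assert (V : ccont (fun p : R * R => (z + RtoC (fst p) * d - c)%C) p).
  { apply ccont_minus; [|apply ccont_const]. apply ccont_plus; [apply ccont_const|].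
    apply ccont_mult; [easy|apply ccont_const]. }
  apply ccont_plus; [|apply ccont_mult; [|apply ccont_const]].
  - apply ccont_mult; [|exact V]. apply ccont_mult; [|apply ccont_mult; [easy|apply ccont_const]].
    apply (ccont_comp f' _ _ W). now apply f'_cont.
  - apply (ccont_comp f _ _ W). now apply f_cont.
Qed.

Lemma near_line z d : D z -> locally 0 (fun h => D (z + RtoC h * d)%C).
Proof.
  intros H. apply (copen_pre D (fun h : R => (z + RtoC h * d)%C)); [easy| |].
  - eapply cder_ccont. apply cder_affine.
  - now replace (z + RtoC 0 * d)%C with z by ring.
Qed.

Let near_2d z d t : D z -> 0 <= t <= 1 ->
  locally (0, t) (fun p : R * R => D (c + RtoC (snd p) * (z + RtoC (fst p) * d - c))%C).
Proof.
  intros H Ht.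
  apply (copen_pre D (fun p : R * R => (c + RtoC (snd p) * (z + RtoC (fst p) * d - c))%C));
    [easy|apply w_cont|]. simpl.
  replace (c + RtoC t * (z + RtoC 0 * d - c))%C with (c + RtoC t * (z - c))%C by ring.
  now apply D_star.
Qed.

Definition primitive (z : C) : C :=
  (RInt (fun t => Re (f (c + RtoC t * (z - c)) * (z - c))%C) 0 1,
   RInt (fun t => Im (f (c + RtoC t * (z - c)) * (z - c))%C) 0 1).

(** [L] abstracts [Re] and [Im], so both components are differentiated under the integral at
    once. *)
Let param_derive (L : C -> R) z d : D z -> (L = Re \/ L = Im) ->
  is_derive (fun h => RInt (fun t => L (phi z d h t)) 0 1) 0
    (RInt (fun t => L (psi z d 0 t)) 0 1).
Proof.
  intros H HL.
  assert (Hder : forall h t, D (c + RtoC t * (z + RtoC h * d - c))%C ->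
    is_derive (fun h => L (phi z d h t)) h (L (psi z d h t))).
  { intros h t Ht. destruct (phi_der z d h t Ht). now destruct HL; subst L. }
  assert (Hc : forall p : R * R, D (c + RtoC (snd p) * (z + RtoC (fst p) * d - c))%C ->
    continuous (fun p : R * R => L (psi z d (fst p) (snd p))) p).
  { intros p Hp. destruct (psi_cont z d p Hp). now destruct HL; subst L. }
  assert (Hin : forall h t, D (z + RtoC h * d)%C -> 0 <= t <= 1 ->
     D (c + RtoC t * (z + RtoC h * d - c))%C) by (intros; now apply D_star).
  assert (H0 : forall t, 0 <= t <= 1 -> D (c + RtoC t * (z + RtoC 0 * d - c))%C).
  { intros t Ht. apply Hin; [|easy]. now replace (z + RtoC 0 * d)%C with z by ring. }
  replace (RInt (fun t => L (psi z d 0 t)) 0 1)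
    with (RInt (fun t => Derive (fun u => L (phi z d u t)) 0) 0 1).
  2: { apply RInt_ext. intros t Ht. rewrite Rmin_left, Rmax_right in Ht by lra.
       apply is_derive_unique. apply Hder, H0. lra. }
  apply (is_derive_RInt_param (fun h t => L (phi z d h t)) 0 1 0).
  - generalize (near_line z d H). apply filter_imp. intros h Hh t Ht.
    rewrite Rmin_left, Rmax_right in Ht by lra.
    eexists. apply Hder. now apply Hin.
  - intros t Ht. rewrite Rmin_left, Rmax_right in Ht by lra.
    apply continuity_2d_pt_filterlim.
    change (continuous (fun p : R * R => Derive (fun v => L (phi z d v (snd p))) (fst p)) (0, t)).
    apply (continuous_ext_loc _ (fun p : R * R => L (psi z d (fst p) (snd p)))).
    + generalize (near_2d z d t H Ht). apply filter_imp. intros p Hp.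
      symmetry. apply is_derive_unique. now apply Hder.
    + apply Hc. now apply H0.
  - generalize (near_line z d H). apply filter_imp. intros h Hh.
    apply (ex_RInt_continuous (V := R_CompleteNormedModule)).
    intros t Ht. rewrite Rmin_left, Rmax_right in Ht by lra.
    assert (K : ccont (fun t => phi z d h t) t).
    { unfold phi. apply ccont_mult; [|apply ccont_const].
      apply (ccont_comp f (fun t : R => (c + RtoC t * (z + RtoC h * d - c))%C)).
      - eapply cder_ccont, cder_affine.
      - apply f_cont. now apply Hin. }
    destruct K. now destruct HL; subst L.
Qed.

(** Cauchy's theorem on a star-shaped domain. After differentiation under the integral, the
    integrand [psi z d 0 t] is the t-derivative of t f(c + t (z - c)) d, so the integral from 0 to 1
    collapses to f z d. *)
Lemma primitive_hol : hol D primitive f.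
Proof.
  intros z d H.
  assert (H0 : forall t, 0 <= t <= 1 -> D (c + RtoC t * (z - c))%C) by (intros; now apply D_star).
  destruct (cder_is_RInt (fun t => (RtoC t * f (c + RtoC t * (z - c)) * d)%C)
     (fun t => ((f (c + RtoC t * (z - c)) + RtoC t * (f' (c + RtoC t * (z - c)) * (z - c))) * d)%C) 0 1)
     as [I1 I2].
  - intros t Ht. rewrite Rmin_left, Rmax_right in Ht by lra.
    apply cder_scal_r. eapply cder_eq.
    + apply cder_mult; [apply cder_id|]. apply (hol_line D f f' c (z - c)); [easy|now apply H0].
    + cbv beta. ring.
  - intros t Ht. rewrite Rmin_left, Rmax_right in Ht by lra.
    assert (A : ccont (fun t : R => (c + RtoC t * (z - c))%C) t) by (eapply cder_ccont, cder_affine).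
    apply ccont_mult; [|apply ccont_const]. apply ccont_plus.
    + apply (ccont_comp f _ _ A). now apply f_cont, H0.
    + apply ccont_mult; [eapply cder_ccont, cder_id|]. apply ccont_mult; [|apply ccont_const].
      apply (ccont_comp f' _ _ A). now apply f'_cont, H0.
  - replace (c + RtoC 1 * (z - c))%C with z in I1, I2 by ring.
    split.
    + replace (Re (f z * d)%C) with (RInt (fun t => Re (psi z d 0 t)) 0 1).
      * apply (param_derive Re z d H). now left.
      * replace (Re (f z * d)%C) with (Re (RtoC 1 * f z * d)%C
           - Re (RtoC 0 * f (c + RtoC 0 * (z - c)) * d)%C).
        -- apply is_RInt_unique. eapply is_RInt_ext; [|exact I1].
           intros t _. cbv beta. f_equal. unfold psi.
           replace (c + RtoC t * (z + RtoC 0 * d - c))%C with (c + RtoC t * (z - c))%C by ring. ring.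
        -- replace (RtoC 1 * f z * d)%C with (f z * d)%C by ring.
           replace (RtoC 0 * f (c + RtoC 0 * (z - c)) * d)%C with (RtoC 0) by ring. simpl. ring.
    + replace (Im (f z * d)%C) with (RInt (fun t => Im (psi z d 0 t)) 0 1).
      * apply (param_derive Im z d H). now right.
      * replace (Im (f z * d)%C) with (Im (RtoC 1 * f z * d)%C
           - Im (RtoC 0 * f (c + RtoC 0 * (z - c)) * d)%C).
        -- apply is_RInt_unique. eapply is_RInt_ext; [|exact I2].
           intros t _. cbv beta. f_equal. unfold psi.
           replace (c + RtoC t * (z + RtoC 0 * d - c))%C with (c + RtoC t * (z - c))%C by ring. ring.
        -- replace (RtoC 1 * f z * d)%C with (f z * d)%C by ring.
           replace (RtoC 0 * f (c + RtoC 0 * (z - c)) * d)%C with (RtoC 0) by ring. simpl. ring.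
Qed.

End Primitive.

(** * The integrands *)

Definition den (x : C) : C := (Cexp (RtoC PI * Ci * x) - Cexp (- (RtoC PI * Ci * x)))%C.

Definition kern (s x : C) : C := (Cpowc x (- s) * Cexp (RtoC PI * Ci * x * x))%C.

(* The integrand of R(s); in the upper half plane it equals minus the sum over
   odd [m] of the terms [gint s m]. *)
Definition fint (s x : C) : C := (kern s x / den x)%C.

Definition gint (s : C) (m : R) (x : C) : C := (kern s x * Cexp (RtoC PI * Ci * RtoC m * x))%C.

Definition den' (x : C) : C :=
  (RtoC PI * Ci * (Cexp (RtoC PI * Ci * x) + Cexp (- (RtoC PI * Ci * x))))%C.

Definition kern' (s x : C) : C := (kern s x * (- s / x + 2 * RtoC PI * Ci * x))%C.

Definition fint' (s x : C) : C := (kern' s x / den x + kern s x * (- den' x / (den x * den x)))%C.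

Definition gint' (s : C) (m : R) (x : C) : C :=
  ((kern' s x + kern s x * (RtoC PI * Ci * RtoC m)) * Cexp (RtoC PI * Ci * RtoC m * x))%C.

(** The zeros of [den] are the integers. Keeping only the interval (0, 1) of the real axis leaves a
    domain that avoids them, is star-shaped about 1/2, and connects the two half planes where the
    contour of R(s) crosses. *)
Definition cut_dom (z : C) : Prop := Im z <> 0 \/ 0 < Re z < 1.

Lemma cut_dom_slit z : cut_dom z -> slit z.
Proof. intros [H|H]; [now right|left; lra]. Qed.

Lemma Re_den x : Re (den x) = - (exp (PI * Im x) - exp (- (PI * Im x))) * cos (PI * Re x).
Proof.
  unfold den. rewrite re_minus, !Re_Cexp.
  replace (Re (RtoC PI * Ci * x)%C) with (- (PI * Im x)) by (simpl; unfold Re, Im; ring).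
  replace (Im (RtoC PI * Ci * x)%C) with (PI * Re x) by (simpl; unfold Re, Im; ring).
  replace (Re (- (RtoC PI * Ci * x))%C) with (PI * Im x) by (simpl; unfold Re, Im; ring).
  replace (Im (- (RtoC PI * Ci * x))%C) with (- (PI * Re x)) by (simpl; unfold Re, Im; ring).
  rewrite cos_neg. ring.
Qed.

Lemma Im_den x : Im (den x) = (exp (PI * Im x) + exp (- (PI * Im x))) * sin (PI * Re x).
Proof.
  unfold den. rewrite im_minus, !Im_Cexp.
  replace (Re (RtoC PI * Ci * x)%C) with (- (PI * Im x)) by (simpl; unfold Re, Im; ring).
  replace (Im (RtoC PI * Ci * x)%C) with (PI * Re x) by (simpl; unfold Re, Im; ring).
  replace (Re (- (RtoC PI * Ci * x))%C) with (PI * Im x) by (simpl; unfold Re, Im; ring).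
  replace (Im (- (RtoC PI * Ci * x))%C) with (- (PI * Re x)) by (simpl; unfold Re, Im; ring).
  rewrite sin_neg. ring.
Qed.

(** Since [den x] is 2 i sin (pi x), this is the identity |sin (u + i v)|^2 = sin^2 u + sinh^2 v. *)
Lemma Cmod_den2 x : Cmod (den x) ^ 2 =
  (exp (PI * Im x) - exp (- (PI * Im x))) ^ 2 + 4 * sin (PI * Re x) ^ 2.
Proof.
  rewrite Cmod2_alt, Re_den, Im_den.
  pose proof (sin2_cos2 (PI * Re x)) as H. unfold Rsqr in H.
  assert (E : exp (PI * Im x) * exp (- (PI * Im x)) = 1)
    by (rewrite <- exp_plus, Rplus_opp_r; apply exp_0).
  set (e := exp (PI * Im x)) in *. set (e' := exp (- (PI * Im x))) in *.
  set (a := sin _) in *. set (b := cos _) in *.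
  replace ((- (e - e') * b) ^ 2 + ((e + e') * a) ^ 2)
    with ((e - e') ^ 2 * (a * a + b * b) + 4 * (e * e') * a ^ 2) by ring.
  rewrite H, E. ring.
Qed.

Lemma two_sinh_ge u : 0 <= u -> 2 * u <= exp u - exp (- u).
Proof.
  intros Hu.
  assert (H : 2 * u - (exp u - exp (- u)) <= 2 * 0 - (exp 0 - exp (- 0))).
  { apply (derive_nonpos_le (fun u => 2 * u - (exp u - exp (- u)))
      (fun u => 2 - (exp u + exp (- u)))); [easy| |].
    - intros v _. auto_derive; [easy|ring].
    - intros v _. assert (E : exp v * exp (- v) = 1) by (rewrite <- exp_plus, Rplus_opp_r; apply exp_0).
      pose proof (exp_pos v). pose proof (exp_pos (-v)).
      assert (0 <= (exp v - exp (-v)) ^ 2) by apply pow2_ge_0. nra. }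
  rewrite Ropp_0, exp_0 in H. lra.
Qed.

Lemma le_of_sq a b : 0 <= b -> a ^ 2 <= b ^ 2 -> a <= b.
Proof. intros. destruct (Rle_dec a b); [easy|nra]. Qed.

Lemma Cmod_den_Im x : 2 * PI * Rabs (Im x) <= Cmod (den x).
Proof.
  apply le_of_sq; [apply Cmod_ge_0|]. rewrite Cmod_den2.
  pose proof PI_RGT_0. pose proof (pow2_ge_0 (sin (PI * Re x))).
  enough ((2 * PI * Rabs (Im x)) ^ 2 <= (exp (PI * Im x) - exp (- (PI * Im x))) ^ 2) by lra.
  destruct (Rle_dec 0 (Im x)).
  - rewrite Rabs_pos_eq by easy. apply pow_incr. split; [nra|].
    replace (2 * PI * Im x) with (2 * (PI * Im x)) by ring. apply two_sinh_ge. nra.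
  - rewrite Rabs_left by lra.
    replace ((exp (PI * Im x) - exp (- (PI * Im x))) ^ 2)
      with ((exp (- (PI * Im x)) - exp (- - (PI * Im x))) ^ 2) by (rewrite Ropp_involutive; ring).
    apply pow_incr. split; [nra|].
    replace (2 * PI * - Im x) with (2 * (- (PI * Im x))) by ring. apply two_sinh_ge. nra.
Qed.

Lemma Cmod_den_sin x : 2 * sin (PI * Re x) <= Cmod (den x).
Proof.
  apply le_of_sq; [apply Cmod_ge_0|]. rewrite Cmod_den2.
  pose proof (pow2_ge_0 (exp (PI * Im x) - exp (- (PI * Im x)))). lra.
Qed.

Lemma den_neq0 x : cut_dom x -> den x <> 0%C.
Proof.
  intros H. apply Cmod_gt_0. pose proof PI_RGT_0.
  destruct H as [H|H].
  - eapply Rlt_le_trans; [|apply Cmod_den_Im]. apply Rabs_pos_lt in H. nra.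
  - eapply Rlt_le_trans; [|apply Cmod_den_sin].
    enough (0 < sin (PI * Re x)) by lra. apply sin_gt_0; nra.
Qed.

Lemma copen_Im : copen (fun z => Im z <> 0).
Proof.
  intros z H.
  destruct (Rdichotomy _ _ H) as [h|h].
  - assert (h' : 0 < - Im z) by lra.
    generalize (locally_lt_continuous _ _ (continuous_Ropp _ _ (proj2 (ccont_id z))) h').
    apply filter_imp. intros y. lra.
  - generalize (locally_lt_continuous _ _ (proj2 (ccont_id z)) h).
    apply filter_imp. intros y. lra.
Qed.

Lemma copen_or D1 D2 : copen D1 -> copen D2 -> copen (fun z => D1 z \/ D2 z).
Proof.
  intros H1 H2 z [H|H].
  - generalize (H1 z H). apply filter_imp. now left.
  - generalize (H2 z H). apply filter_imp. now right.
Qed.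

Lemma copen_Re_pos : copen (fun z => 0 < Re z).
Proof. intros z H. apply (locally_lt_continuous _ _ (proj1 (ccont_id z)) H). Qed.

Lemma copen_slit : copen slit.
Proof. apply copen_or; [apply copen_Re_pos|apply copen_Im]. Qed.

Lemma copen_cut_dom : copen cut_dom.
Proof.
  apply copen_or; [apply copen_Im|].
  intros z [H1 H2]. apply filter_and; [now apply copen_Re_pos|].
  assert (H : 0 < 1 - Re z) by lra.
  assert (K : continuous (fun y : C_UniformSpace => 1 - Re y) z).
  { apply continuous_Rminus; [apply continuous_const|apply (ccont_id z)]. }
  generalize (locally_lt_continuous _ _ K H). apply filter_imp. intros y. lra.
Qed.

Lemma star_slit z t : slit z -> 0 <= t <= 1 -> slit (1 + RtoC t * (z - 1))%C.
Proof.
  intros H Ht.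
  assert (E1 : Re (1 + RtoC t * (z - 1))%C = 1 + t * (Re z - 1)) by (simpl; unfold Re; ring).
  assert (E2 : Im (1 + RtoC t * (z - 1))%C = t * Im z) by (simpl; unfold Im; ring).
  unfold slit. rewrite E1, E2.
  destruct (Req_dec t 0) as [->|T]; [left; lra|].
  destruct H as [H|H]; [left; nra|right]. now apply Rmult_integral_contrapositive.
Qed.

Lemma star_cut_dom z t : cut_dom z -> 0 <= t <= 1 ->
  cut_dom (RtoC (1/2) + RtoC t * (z - RtoC (1/2)))%C.
Proof.
  intros H Ht.
  assert (E1 : Re (RtoC (1/2) + RtoC t * (z - RtoC (1/2)))%C = 1/2 + t * (Re z - 1/2)) by (simpl; unfold Re; ring).
  assert (E2 : Im (RtoC (1/2) + RtoC t * (z - RtoC (1/2)))%C = t * Im z) by (simpl; unfold Im; ring).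
  unfold cut_dom. rewrite E1, E2.
  destruct (Req_dec t 0) as [->|T]; [right; lra|].
  destruct H as [H|H]; [left|right; nra]. now apply Rmult_integral_contrapositive.
Qed.

(* Like [hol], but along arbitrary curves, hence stable under composition. *)
Definition chol (D : C -> Prop) (f f' : C -> C) : Prop :=
  forall g u l, D (g u) -> cder g u l -> cder (fun v => f (g v)) u (f' (g u) * l)%C.

Lemma chol_hol D f f' : chol D f f' -> hol D f f'.
Proof.
  intros H z d Hz.
  assert (E : (z + RtoC 0 * d)%C = z) by ring.
  replace (f' z) with (f' (z + RtoC 0 * d)%C) by now rewrite E.
  apply (H (fun v => (z + RtoC v * d)%C)); [now rewrite E|].
  apply cder_affine.
Qed.

Lemma chol_den : chol (fun _ => True) den den'.
Proof.
  intros g u l _ G. unfold den, den'.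
  eapply cder_eq.
  - apply cder_minus; apply cder_exp; [|apply cder_opp]; apply cder_scal; exact G.
  - cbv beta. ring.
Qed.

Lemma chol_kern s : chol slit (kern s) (kern' s).
Proof.
  intros g u l H G. unfold kern, kern', Cpowc.
  eapply cder_eq.
  - apply cder_mult; apply cder_exp; [apply cder_scal, cder_log; [exact G|exact H]|].
    apply cder_mult; [apply cder_scal; exact G|exact G].
  - cbv beta. apply slit_neq0 in H. unfold kern, Cpowc. field. exact H.
Qed.

Lemma chol_fint s : chol cut_dom (fint s) (fint' s).
Proof.
  intros g u l H G. unfold fint, fint'.
  eapply cder_eq.
  - apply cder_mult; [apply chol_kern; [now apply cut_dom_slit|exact G]|].
    apply cder_inv; [|now apply den_neq0]. apply chol_den; [easy|exact G].
  - cbv beta. apply den_neq0 in H. field. exact H.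
Qed.

Lemma chol_gint s m : chol slit (gint s m) (gint' s m).
Proof.
  intros g u l H G. unfold gint, gint'.
  eapply cder_eq.
  - apply cder_mult; [apply chol_kern; [exact H|exact G]|].
    apply cder_exp, cder_scal; exact G.
  - cbv beta. ring.
Qed.

Ltac ccont_tac :=
  repeat match goal with
  | |- ccont (fun y => y) _ => apply ccont_id
  | |- ccont (fun y => Cplus (@?a y) (@?b y)) _ => apply (ccont_plus a b)
  | |- ccont (fun y => Cminus (@?a y) (@?b y)) _ => apply (ccont_minus a b)
  | |- ccont (fun y => Copp (@?a y)) _ => apply (ccont_opp a)
  | |- ccont (fun y => Cmult (@?a y) (@?b y)) _ => apply (ccont_mult a b)
  | |- ccont (fun y => Cexp (@?a y)) _ => apply (ccont_exp a)
  | |- ccont (Cmult ?c) _ => apply (ccont_mult (fun _ => c) (fun y => y))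
  | |- ccont (fun y => ?c) _ => apply (ccont_const c)
  end.

Lemma ccont_kern s (z : C_UniformSpace) : slit z -> ccont (kern s) z.
Proof.
  intros H. unfold kern, Cpowc. ccont_tac.
  apply (ccont_log (fun y => y)); [apply ccont_id|exact H].
Qed.

Lemma ccont_kern' s (z : C_UniformSpace) : slit z -> ccont (kern' s) z.
Proof.
  intros H. unfold kern'.
  apply ccont_mult; [now apply ccont_kern|].
  apply ccont_plus; [|ccont_tac]. apply ccont_mult; [apply ccont_const|].
  apply ccont_inv; [apply ccont_id|now apply slit_neq0].
Qed.

Lemma ccont_den (z : C_UniformSpace) : ccont den z.
Proof. unfold den. ccont_tac. Qed.

Lemma ccont_den' (z : C_UniformSpace) : ccont den' z.
Proof. unfold den'. ccont_tac. Qed.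

Lemma ccont_fint s (z : C_UniformSpace) : cut_dom z -> ccont (fint s) z.
Proof.
  intros H. unfold fint. apply ccont_mult; [now apply ccont_kern, cut_dom_slit|].
  apply ccont_inv; [apply ccont_den|now apply den_neq0].
Qed.

Lemma ccont_fint' s (z : C_UniformSpace) : cut_dom z -> ccont (fint' s) z.
Proof.
  intros H. pose proof (den_neq0 z H) as N. pose proof (ccont_den z) as Dz.
  pose proof (cut_dom_slit z H) as S.
  unfold fint'. apply ccont_plus; apply ccont_mult.
  - now apply ccont_kern'.
  - now apply ccont_inv.
  - now apply ccont_kern.
  - apply ccont_mult; [apply ccont_opp, ccont_den'|].
    apply ccont_inv; [now apply ccont_mult|]. now apply Cmult_neq_0.
Qed.

Lemma ccont_gint s m (z : C_UniformSpace) : slit z -> ccont (gint s m) z.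
Proof. intros H. unfold gint. apply ccont_mult; [now apply ccont_kern|ccont_tac]. Qed.

Lemma ccont_gint' s m (z : C_UniformSpace) : slit z -> ccont (gint' s m) z.
Proof.
  intros H. unfold gint'. apply ccont_mult; [|ccont_tac].
  apply ccont_plus; [now apply ccont_kern'|]. apply ccont_mult; [now apply ccont_kern|ccont_tac].
Qed.

Definition fprim (s : C) : C -> C := primitive (RtoC (1/2)) (fint s).
Definition gprim (s : C) (m : R) : C -> C := primitive (RtoC 1) (gint s m).

Lemma hol_fprim s : hol cut_dom (fprim s) (fint s).
Proof.
  apply (primitive_hol cut_dom _ (fint s) (fint' s)).
  - apply copen_cut_dom.
  - intros. now apply star_cut_dom.
  - apply chol_hol, chol_fint.
  - apply ccont_fint.
  - apply ccont_fint'.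
Qed.

Lemma hol_gprim s m : hol slit (gprim s m) (gint s m).
Proof.
  apply (primitive_hol slit _ (gint s m) (gint' s m)).
  - apply copen_slit.
  - intros. now apply star_slit.
  - apply chol_hol, chol_gint.
  - apply ccont_gint.
  - apply ccont_gint'.
Qed.

(** * Behaviour of the primitives at 0 and at infinity *)

(** Comparison with - C0 exp (- u) in [cder_Cmod_le] bounds all later increments by C0 exp (- u),
    which gives the Cauchy property and survives in the limit. It also serves for limits at 0,
    through x = exp (- u). *)
Lemma exp_lim (F dF : R -> C) (C0 u0 : R) :
  (forall u, u0 <= u -> cder F u (dF u)) ->
  (forall u, u0 <= u -> Cmod (dF u) <= C0 * exp (- u)) ->
  exists L : C, forall u, u0 <= u -> Cmod (F u - L)%C <= C0 * exp (- u).
Proof.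
  intros HD HB.
  assert (HC : 0 <= C0).
  { pose proof (HB u0 (Rle_refl _)). pose proof (Cmod_ge_0 (dF u0)). pose proof (exp_pos (- u0)). nra. }
  assert (Inc : forall u v, u0 <= u <= v -> Cmod (F v - F u)%C <= C0 * exp (- u)).
  { intros u v Huv.
    eapply Rle_trans.
    - apply (cder_Cmod_le F dF (fun w => - C0 * exp (- w)) (fun w => C0 * exp (- w)) u v); [lra| | |].
      + intros w Hw. apply HD. lra.
      + intros w Hw. auto_derive; [easy|ring].
      + intros w Hw. apply HB. lra.
    - cbv beta. pose proof (exp_pos (- v)). nra. }
  assert (Small : forall eps : posreal, exists v0, u0 <= v0 /\ C0 * exp (- v0) < eps).
  { intros [eps He]. simpl. exists (Rmax u0 (- ln (eps / (C0 + 1)))). split; [apply Rmax_l|].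
    assert (Hp : 0 < eps / (C0 + 1)) by (apply Rdiv_lt_0_compat; lra).
    apply Rle_lt_trans with (C0 * (eps / (C0 + 1))).
    - apply Rmult_le_compat_l; [easy|].
      rewrite <- (exp_ln (eps / (C0 + 1))) at 2 by easy.
      assert (- Rmax u0 (- ln (eps / (C0 + 1))) <= ln (eps / (C0 + 1)))
        by (pose proof (Rmax_r u0 (- ln (eps / (C0 + 1)))); lra).
      destruct H as [H|H]; [left; now apply exp_increasing|right; now rewrite H].
    - apply Rmult_lt_reg_r with (C0 + 1); [lra|]. field_simplify; lra. }
  assert (Lim : forall L : C -> R, (forall a b, Rabs (L a - L b) <= Cmod (a - b)%C) ->
     exists l : R, filterlim (fun u => L (F u)) (Rbar_locally p_infty) (locally l)).
  { intros L HL.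
    apply (filterlim_locally_cauchy (U := R_CompleteSpace) (F := Rbar_locally p_infty) (fun u => L (F u))).
    intros eps. destruct (Small (pos_div_2 eps)) as [v0 [Hv0 Hs]].
    exists (fun u => v0 < u). split; [now exists v0|].
    intros u v Hu Hv.
    apply Rle_lt_trans with (Cmod (F v - F u)%C).
    { apply HL. }
    replace (F v - F u)%C with ((F v - F v0) - (F u - F v0))%C by ring.
    eapply Rle_lt_trans; [apply Cmod_triangle|]. rewrite Cmod_opp.
    pose proof (Inc v0 u). pose proof (Inc v0 v). simpl in Hs. lra. }
  destruct (Lim Re) as [l1 H1].
  { intros a b. rewrite <- re_minus. apply re_le_Cmod. }
  destruct (Lim Im) as [l2 H2].
  { intros a b. rewrite <- im_minus. eapply Rle_trans; [|apply Rmax_Cmod]. apply Rmax_r. }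
  exists (l1, l2). intros u Hu.
  apply le_epsilon. intros eps He.
  assert (He2 : 0 < eps / 2) by lra.
  pose proof (H1 _ (locally_ball l1 (mkposreal _ He2))) as [M1 K1].
  pose proof (H2 _ (locally_ball l2 (mkposreal _ He2))) as [M2 K2].
  set (v := Rmax u (Rmax M1 M2) + 1).
  assert (u < v /\ M1 < v /\ M2 < v) as (Q0 & Q1 & Q2).
  { unfold v. pose proof (Rmax_l u (Rmax M1 M2)). pose proof (Rmax_r u (Rmax M1 M2)).
    pose proof (Rmax_l M1 M2). pose proof (Rmax_r M1 M2). lra. }
  specialize (K1 v Q1). specialize (K2 v Q2).
  change (Rabs (Re (F v) - l1) < eps / 2) in K1. change (Rabs (Im (F v) - l2) < eps / 2) in K2.
  replace (F u - (l1, l2))%C with (- (F v - F u) + (F v - (l1, l2)))%C by ring.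
  eapply Rle_trans; [apply Cmod_triangle|]. rewrite Cmod_opp.
  apply Rplus_le_compat; [apply Inc; lra|].
  set (w := (F v - (l1, l2))%C).
  assert (W1 : Re w = Re (F v) - l1) by (unfold w; now rewrite re_minus).
  assert (W2 : Im w = Im (F v) - l2) by (unfold w; now rewrite im_minus).
  rewrite <- W1 in K1. rewrite <- W2 in K2.
  apply le_of_sq; [lra|]. rewrite Cmod2_alt.
  rewrite <- (pow2_abs (Re w)), <- (pow2_abs (Im w)).
  pose proof (Rabs_pos (Re w)). pose proof (Rabs_pos (Im w)). nra.
Qed.

Lemma Re_le_Cmod z : Re z <= Cmod z.
Proof. eapply Rle_trans; [apply Rle_abs|apply re_le_Cmod]. Qed.

Lemma Rabs_Im_le_Cmod z : Rabs (Im z) <= Cmod z.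
Proof. eapply Rle_trans; [|apply Rmax_Cmod]. apply Rmax_r. Qed.

Lemma Im_le_Cmod z : Im z <= Cmod z.
Proof. eapply Rle_trans; [apply Rle_abs|apply Rabs_Im_le_Cmod]. Qed.

Lemma Cmod_le_abs z : Cmod z <= Rabs (Re z) + Rabs (Im z).
Proof.
  pose proof (Rabs_pos (Re z)). pose proof (Rabs_pos (Im z)).
  apply le_of_sq; [lra|]. rewrite Cmod2_alt.
  rewrite <- (pow2_abs (Re z)), <- (pow2_abs (Im z)). nra.
Qed.

Lemma hol_segment D G g M z0 z1 : hol D G g ->
  (forall v, 0 <= v <= 1 -> D (z0 + RtoC v * (z1 - z0))%C) ->
  (forall v, 0 <= v <= 1 -> Cmod (g (z0 + RtoC v * (z1 - z0))%C) <= M) ->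
  Cmod (G z1 - G z0)%C <= M * Cmod (z1 - z0)%C.
Proof.
  intros H HD HM.
  pose proof (cder_Cmod_le (fun v => G (z0 + RtoC v * (z1 - z0))%C)
    (fun v => (g (z0 + RtoC v * (z1 - z0)) * (z1 - z0))%C)
    (fun v => M * Cmod (z1 - z0)%C * v) (fun v => M * Cmod (z1 - z0)%C) 0 1) as K.
  cbv beta in K.
  replace (z0 + RtoC 1 * (z1 - z0))%C with z1 in K by ring.
  replace (z0 + RtoC 0 * (z1 - z0))%C with z0 in K by ring.
  replace (M * Cmod (z1 - z0)%C) with (M * Cmod (z1 - z0)%C * 1 - M * Cmod (z1 - z0)%C * 0) by ring.
  apply K; [lra| | |].
  - intros u Hu. apply (hol_line D); [easy|now apply HD].
  - intros u Hu. auto_derive; [easy|ring].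
  - intros u Hu. rewrite Cmod_mult. apply Rmult_le_compat_r; [apply Cmod_ge_0|now apply HM].
Qed.

Lemma Cmod_kern s x : Cmod (kern s x) =
  exp (- Re s * ln (Cmod x) + Im s * Arg x - 2 * PI * Re x * Im x).
Proof.
  unfold kern, Cpowc. rewrite Cmod_mult, !Cmod_Cexp, <- exp_plus. f_equal.
  rewrite re_mult, re_opp, im_opp, Re_CLog, Im_CLog.
  replace (Re (RtoC PI * Ci * x * x)%C) with (- (2 * PI * Re x * Im x))
    by (simpl; unfold Re, Im; ring).
  ring.
Qed.

Lemma exp_le a b : a <= b -> exp a <= exp b.
Proof. intros [H|H]; [left; now apply exp_increasing|right; now rewrite H]. Qed.

Lemma ln_le_id x : 0 < x -> ln x <= x.
Proof.
  intros H. pose proof (exp_ineq1_le (ln x)). rewrite exp_ln in H0 by easy. lra.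
Qed.


Section Kernel.
Variable s : C.
Hypothesis Hre : Re s <= -1.
Hypothesis Him : 0 < Im s.

(** In such a sector exp (i pi x^2) decays like a Gaussian in u and beats the power of |x|, bounded
    through ln |x| <= l u; completing the square yields the constant. The rate 2 leaves one factor
    exp (- u) to absorb lengths of segments proportional to u. *)
Lemma kern_inf (k l : R) : 0 < k -> 0 < l -> exists C0, 0 <= C0 /\ forall u x, 1 <= u ->
  k * u <= Re x -> k * u <= Im x -> Cmod x <= l * u ->
  Cmod (kern s x) <= C0 * exp (- (2 * u)).
Proof.
  intros Hk Hl. pose proof PI_RGT_0 as HPI.
  set (N := - Re s * l + 2).
  set (c := 2 * PI * k ^ 2).
  assert (Hc : 0 < c) by (unfold c; apply Rmult_lt_0_compat; [lra|now apply pow_lt]).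
  exists (exp (N ^ 2 / (4 * c) + Im s * PI)). split; [apply Rlt_le, exp_pos|].
  intros u x Hu H1 H2 H3. rewrite Cmod_kern, <- exp_plus. apply exp_le.
  assert (Hx : 0 < Cmod x) by (pose proof (Re_le_Cmod x); nra).
  assert (A : - Re s * ln (Cmod x) <= - Re s * (l * u)).
  { apply Rmult_le_compat_l; [lra|]. pose proof (ln_le_id _ Hx). lra. }
  assert (B : Im s * Arg x <= Im s * PI).
  { apply Rmult_le_compat_l; [lra|]. assert (0 < Im x) by nra. pose proof (Arg_up_bound x). lra. }
  assert (E : c * u ^ 2 <= 2 * PI * Re x * Im x).
  { unfold c. assert (k * u * (k * u) <= Re x * Im x) by (apply Rmult_le_compat; nra). nra. }
  assert (Q : N * u - c * u ^ 2 <= N ^ 2 / (4 * c)).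
  { apply Rmult_le_reg_r with (4 * c); [lra|].
    replace (N ^ 2 / (4 * c) * (4 * c)) with (N ^ 2) by (field; lra).
    assert (0 <= (2 * c * u - N) ^ 2) by apply pow2_ge_0. nra. }
  unfold N in *. nra.
Qed.

(** As Re s <= -1, the factor |x|^(- Re s) is at most |x| in the unit disc. This zero cancels the
    simple pole of 1 / [den] at the origin, which is what allows the contour to be pushed there. *)
Lemma kern_zero : forall x, slit x -> Cmod x <= 1 ->
  Cmod (kern s x) <= exp (Im s * PI + 2 * PI) * Cmod x.
Proof.
  intros x Hs H. pose proof PI_RGT_0 as HPI.
  assert (Hx : 0 < Cmod x) by (apply Cmod_gt_0, slit_neq0, Hs).
  rewrite Cmod_kern. rewrite <- (exp_ln (Cmod x)) at 2 by easy. rewrite <- exp_plus. apply exp_le.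
  assert (L : ln (Cmod x) <= 0) by (rewrite <- ln_1; apply ln_le; lra).
  assert (- Re s * ln (Cmod x) <= ln (Cmod x)) by nra.
  assert (B : Im s * Arg x <= Im s * PI).
  { apply Rmult_le_compat_l; [lra|]. pose proof (Arg_bound x Hs). lra. }
  assert (E : - (Re x * Im x) <= 1).
  { pose proof (re_le_Cmod x). pose proof (Rabs_Im_le_Cmod x).
    eapply Rle_trans; [apply Rle_abs|]. rewrite Rabs_Ropp, Rabs_mult.
    pose proof (Rabs_pos (Re x)). pose proof (Rabs_pos (Im x)). nra. }
  nra.
Qed.

Lemma Rabs_sin_ge r : Rabs r <= / 3 -> PI / 2 * Rabs r <= Rabs (sin (PI * r)).
Proof.
  intros H. pose proof PI_RGT_0 as HPI.
  assert (K : forall q, 0 <= q <= / 3 -> PI / 2 * q <= sin (PI * q)).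
  { intros q Hq.
    enough (PI / 2 * q - sin (PI * q) <= PI / 2 * 0 - sin (PI * 0)).
    { rewrite !Rmult_0_r, sin_0 in H0. lra. }
    apply (derive_nonpos_le (fun q => PI / 2 * q - sin (PI * q))
       (fun q => PI / 2 - PI * cos (PI * q))); [easy| |].
    - intros v _. auto_derive; [easy|ring].
    - intros v Hv. assert (1 / 2 <= cos (PI * v)); [|nra].
      rewrite <- cos_PI3. apply cos_decr_1; nra. }
  destruct (Rle_dec 0 r).
  - rewrite (Rabs_pos_eq r) in * by easy. eapply Rle_trans; [now apply K|apply Rle_abs].
  - rewrite (Rabs_left r) in * by lra. rewrite <- Rabs_Ropp, <- sin_neg.
    replace (- (PI * r)) with (PI * - r) by ring.
    eapply Rle_trans; [apply K; lra|apply Rle_abs].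
Qed.

Lemma Cmod_den_zero x : Cmod x <= / 3 -> Cmod x <= Cmod (den x).
Proof.
  intros H. pose proof PI_RGT_0 as HPI. pose proof PI2_1 as HP.
  assert (S : 2 * Rabs (sin (PI * Re x)) <= Cmod (den x)).
  { apply le_of_sq; [apply Cmod_ge_0|]. rewrite Cmod_den2.
    pose proof (pow2_ge_0 (exp (PI * Im x) - exp (- (PI * Im x)))).
    rewrite Rpow_mult_distr, pow2_abs. lra. }
  pose proof (re_le_Cmod x) as R1. pose proof (Rabs_Im_le_Cmod x) as R2.
  pose proof (Rabs_sin_ge (Re x)) as S2. pose proof (Cmod_den_Im x) as S3.
  pose proof (Rabs_pos (Re x)). pose proof (Rabs_pos (Im x)).
  assert (D1 : 2 * Rabs (Re x) <= Cmod (den x)) by nra.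
  assert (D2 : 2 * Rabs (Im x) <= Cmod (den x)) by nra.
  pose proof (Cmod_le_abs x). lra.
Qed.

Lemma fint_zero x : cut_dom x -> Cmod x <= / 3 ->
  Cmod (fint s x) <= exp (Im s * PI + 2 * PI).
Proof.
  intros Hx H. unfold fint. rewrite Cmod_div by now apply den_neq0.
  pose proof (cut_dom_slit _ Hx) as Sx.
  assert (P : 0 < Cmod x) by (now apply Cmod_gt_0, slit_neq0).
  pose proof (Cmod_den_zero x H). pose proof (kern_zero x Sx).
  apply Rmult_le_reg_r with (Cmod (den x)); [lra|].
  replace (Cmod (kern s x) / Cmod (den x) * Cmod (den x)) with (Cmod (kern s x)) by (field; lra).
  pose proof (exp_pos (Im s * PI + 2 * PI)). nra.
Qed.

Lemma fint_inf (k l : R) : 0 < k -> 0 < l -> exists C0, 0 <= C0 /\ forall u x, 1 <= u ->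
  k * u <= Re x -> k * u <= Im x -> Cmod x <= l * u ->
  Cmod (fint s x) <= C0 * exp (- (2 * u)).
Proof.
  intros Hk Hl. destruct (kern_inf k l Hk Hl) as [C0 [HC K]]. pose proof PI_RGT_0 as HPI.
  assert (P : 0 < 2 * PI * k) by nra.
  exists (C0 / (2 * PI * k)). split; [apply Rmult_le_pos; [easy|apply Rlt_le, Rinv_0_lt_compat, P]|].
  intros u x Hu H1 H2 H3. specialize (K u x Hu H1 H2 H3).
  assert (I : 0 < Im x) by nra.
  unfold fint. rewrite Cmod_div by (apply den_neq0; left; lra).
  assert (D : 2 * PI * k <= Cmod (den x)).
  { eapply Rle_trans; [|apply Cmod_den_Im]. rewrite Rabs_pos_eq by lra.
    apply Rmult_le_compat_l; [lra|]. nra. }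
  pose proof (Cmod_ge_0 (kern s x)).
  apply Rle_trans with (Cmod (kern s x) / (2 * PI * k)).
  - apply Rmult_le_compat_l; [easy|]. now apply Rinv_le_contravar.
  - replace (C0 / (2 * PI * k) * exp (- (2 * u)))
      with (C0 * exp (- (2 * u)) / (2 * PI * k)) by (field; lra).
    apply Rmult_le_compat_r; [apply Rlt_le, Rinv_0_lt_compat, P|easy].
Qed.

Lemma gint_le_kern m x : 0 <= m -> 0 <= Im x -> Cmod (gint s m x) <= Cmod (kern s x).
Proof.
  intros Hm Hx. pose proof PI_RGT_0 as HPI. unfold gint. rewrite Cmod_mult, Cmod_Cexp.
  replace (Re (RtoC PI * Ci * RtoC m * x)%C) with (- (PI * m * Im x)) by (simpl; unfold Re, Im; ring).
  rewrite <- (Rmult_1_r (Cmod (kern s x))) at 2. apply Rmult_le_compat_l; [apply Cmod_ge_0|].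
  rewrite <- exp_0. apply exp_le. assert (0 <= PI * m * Im x) by (apply Rmult_le_pos; [apply Rmult_le_pos|]; lra). lra.
Qed.

Lemma gint_zero m x : 0 <= m -> slit x -> Cmod x <= 1 ->
  Cmod (gint s m x) <= exp (Im s * PI + 2 * PI + PI * m).
Proof.
  intros Hm Hx H. pose proof PI_RGT_0 as HPI. unfold gint. rewrite Cmod_mult, Cmod_Cexp.
  replace (Re (RtoC PI * Ci * RtoC m * x)%C) with (- (PI * m * Im x)) by (simpl; unfold Re, Im; ring).
  rewrite exp_plus. pose proof (kern_zero x Hx H). pose proof (Cmod_ge_0 x).
  pose proof (exp_pos (Im s * PI + 2 * PI)).
  apply Rmult_le_compat; [apply Cmod_ge_0|apply Rlt_le, exp_pos|nra|].
  apply exp_le. pose proof (Rabs_Im_le_Cmod x) as B. apply Rabs_le_between in B.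
  assert (0 <= PI * m) by nra. nra.
Qed.

End Kernel.

Lemma Re_affine a b v : Re (a + RtoC v * b)%C = Re a + v * Re b.
Proof. simpl; unfold Re; ring. Qed.

Lemma Im_affine a b v : Im (a + RtoC v * b)%C = Im a + v * Im b.
Proof. simpl; unfold Im; ring. Qed.

Lemma Cmod_affine_le a b v : 0 <= v -> Cmod (a + RtoC v * b)%C <= Cmod a + v * Cmod b.
Proof.
  intros H. eapply Rle_trans; [apply Cmod_triangle|]. rewrite Cmod_mult, Cmod_R, Rabs_pos_eq by easy. lra.
Qed.

(** The limit is first found along the direction 1 + i. Any other ray of the open first quadrant is
    joined to it by segments whose length grows linearly in v and on which g is O (exp (- 2 v)), so
    the limit is shared. The offset z is needed for the line of R(s), which does not pass through
    0. *)
Lemma prim_inf D G g : hol D G g -> (forall z, 0 < Im z -> D z) ->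
  (forall k l, 0 < k -> 0 < l -> exists C0, 0 <= C0 /\ forall u x, 1 <= u ->
     k * u <= Re x -> k * u <= Im x -> Cmod x <= l * u -> Cmod (g x) <= C0 * exp (- (2 * u))) ->
  exists Ginf, forall z d, 0 < Re d -> 0 < Im d -> exists C0 v0, 0 <= C0 /\
    forall v, v0 <= v -> Cmod (G (z + RtoC v * d) - Ginf)%C <= C0 * exp (- v).
Proof.
  intros HG HD Hdec.
  set (e := (1, 1) : C).
  assert (E1 : Re e = 1) by reflexivity. assert (E2 : Im e = 1) by reflexivity.
  assert (Ee : Cmod e <= 2) by (eapply Rle_trans; [apply Cmod_le_abs|rewrite E1, E2, Rabs_R1; lra]).
  destruct (Hdec 1 2) as [Ce [HCe Ke]]; [lra|lra|].
  destruct (exp_lim (fun u => G (0 + RtoC u * e)%C) (fun u => (g (0 + RtoC u * e) * e)%C) (2 * Ce) 1)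
    as [Ginf HL].
  { intros u Hu. apply (hol_line D); [easy|]. apply HD. rewrite Im_affine, E2. simpl. lra. }
  { intros u Hu. rewrite Cmod_mult.
    assert (B : Cmod (g (0 + RtoC u * e)%C) <= Ce * exp (- (2 * u))).
    { apply Ke; rewrite ?Re_affine, ?Im_affine, ?E1, ?E2; simpl; try lra.
      eapply Rle_trans; [apply Cmod_affine_le; lra|]. rewrite Cmod_0. nra. }
    assert (exp (- (2 * u)) <= exp (- u)) by (apply exp_le; lra).
    pose proof (Cmod_ge_0 e). pose proof (Cmod_ge_0 (g (0 + RtoC u * e)%C)).
    pose proof (exp_pos (- (2 * u))). nra. }
  exists Ginf. intros z d Hd1 Hd2.
  (* The half makes room for the offset: once |z| <= k v, both parts of z + v d are at least 2 k v -
     k v. The bound by 1 takes care of the direction 1 + i. *)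
  set (k := Rmin (Rmin (Re d) (Im d)) 1 / 2).
  assert (Hk : 0 < k /\ 2 * k <= Re d /\ 2 * k <= Im d /\ 2 * k <= 1).
  { unfold k. pose proof (Rmin_l (Rmin (Re d) (Im d)) 1). pose proof (Rmin_r (Rmin (Re d) (Im d)) 1).
    pose proof (Rmin_l (Re d) (Im d)). pose proof (Rmin_r (Re d) (Im d)).
    assert (0 < Rmin (Rmin (Re d) (Im d)) 1) by (repeat apply Rmin_glb_lt; lra). lra. }
  destruct Hk as (Hk & K1 & K2 & K3).
  set (l := k + Cmod d + 2).
  assert (Hl : 0 < l) by (unfold l; pose proof (Cmod_ge_0 d); lra).
  destruct (Hdec k l Hk Hl) as [C1 [HC1 KK]].
  exists (2 * Ce + C1 * l), (Cmod z / k + 1). split; [nra|].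
  intros v Hv.
  assert (Hz : Cmod z <= k * v).
  { apply Rmult_le_reg_r with (/ k); [now apply Rinv_0_lt_compat|].
    replace (k * v * / k) with v by (field; lra). unfold Rdiv in Hv. lra. }
  assert (Hv1 : 1 <= v).
  { assert (0 <= Cmod z / k); [|lra]. apply Rmult_le_pos; [apply Cmod_ge_0|apply Rlt_le, Rinv_0_lt_compat, Hk]. }
  replace (G (z + RtoC v * d) - Ginf)%C
    with ((G (0 + RtoC v * e) - Ginf) + (G (z + RtoC v * d) - G (0 + RtoC v * e)))%C by ring.
  eapply Rle_trans; [apply Cmod_triangle|].
  rewrite Rmult_plus_distr_r. apply Rplus_le_compat; [now apply HL|].
  pose proof (re_le_Cmod z) as Z1. apply Rabs_le_between in Z1.
  pose proof (Rabs_Im_le_Cmod z) as Z2. apply Rabs_le_between in Z2.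
  assert (SR : forall w, Re (0 + RtoC v * e + RtoC w * (z + RtoC v * d - (0 + RtoC v * e)))%C
      = (1 - w) * v + w * (Re z + v * Re d)) by (intros w; simpl; unfold Re; ring).
  assert (SI : forall w, Im (0 + RtoC v * e + RtoC w * (z + RtoC v * d - (0 + RtoC v * e)))%C
      = (1 - w) * v + w * (Im z + v * Im d)) by (intros w; simpl; unfold Im; ring).
  assert (SRk : forall w, 0 <= w <= 1 -> k * v <= (1 - w) * v + w * (Re z + v * Re d)).
  { intros w Hw. assert (k * v <= Re z + v * Re d) by nra. assert (k * v <= v) by nra. nra. }
  assert (SIk : forall w, 0 <= w <= 1 -> k * v <= (1 - w) * v + w * (Im z + v * Im d)).
  { intros w Hw. assert (k * v <= Im z + v * Im d) by nra. assert (k * v <= v) by nra. nra. }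
  assert (Hlen : Cmod (z + RtoC v * d - (0 + RtoC v * e))%C <= l * v).
  { unfold Cminus. eapply Rle_trans; [apply Cmod_triangle|]. rewrite Cmod_opp.
    pose proof (Cmod_affine_le z d v). pose proof (Cmod_affine_le 0 e v). rewrite Cmod_0 in *.
    unfold l. nra. }
  eapply Rle_trans.
  - apply (hol_segment D G g (C1 * exp (- (2 * v)))); [easy| |].
    + intros w Hw. apply HD. rewrite SI. specialize (SIk w Hw). nra.
    + intros w Hw. apply KK; [easy|rewrite SR; auto|rewrite SI; auto|].
      replace (0 + RtoC v * e + RtoC w * (z + RtoC v * d - (0 + RtoC v * e)))%C
        with (RtoC (1 - w) * (0 + RtoC v * e) + RtoC w * (z + RtoC v * d))%C
        by (rewrite RtoC_minus; ring).
      eapply Rle_trans; [apply Cmod_triangle|]. rewrite !Cmod_mult, !Cmod_R, !Rabs_pos_eq by lra.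
      pose proof (Cmod_affine_le z d v). pose proof (Cmod_affine_le 0 e v). rewrite Cmod_0 in *.
      assert (Q1 : Cmod (0 + RtoC v * e)%C <= l * v) by (unfold l; pose proof (Cmod_ge_0 d); nra).
      assert (Q2 : Cmod (z + RtoC v * d)%C <= l * v) by (unfold l; nra).
      nra.
  - assert (Ev : v * exp (- (2 * v)) <= exp (- v)).
    { replace (- (2 * v)) with (- v + - v) by ring. rewrite exp_plus.
      assert (v * exp (- v) <= 1).
      { apply Rmult_le_reg_r with (exp v); [apply exp_pos|].
        rewrite Rmult_assoc, <- exp_plus, Rplus_opp_l, exp_0. pose proof (exp_ineq1_le v). lra. }
      pose proof (exp_pos (- v)). nra. }
    apply Rle_trans with (C1 * exp (- (2 * v)) * (l * v)).
    + apply Rmult_le_compat_l; [|easy]. apply Rmult_le_pos; [easy|apply Rlt_le, exp_pos].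
    + replace (C1 * exp (- (2 * v)) * (l * v)) with (C1 * l * (v * exp (- (2 * v)))) by ring.
      apply Rmult_le_compat_l; [nra|easy].
Qed.

Lemma exp_m2_le : exp (- (2)) <= / 3.
Proof.
  rewrite exp_Ropp. apply Rinv_le_contravar; [lra|]. pose proof (exp_ineq1_le 2). lra.
Qed.

(** The substitution x = exp (- v) turns boundedness of g into a derivative O (exp (- v)), which
    gives the limit along the positive axis; another direction d is reached by the segment from u to
    u d, of length O (u). The threshold exp (- 2) keeps these segments inside the disc of radius
    1/3. *)
Lemma prim_zero D G g C0 : hol D G g -> (forall u : R, 0 < u < 1 -> D (RtoC u)) ->
  (forall x, D x -> Cmod x <= / 3 -> Cmod (g x) <= C0) ->
  exists G0, forall d,
    (forall u w, 0 < u < 1 -> 0 <= w <= 1 -> D (RtoC u + RtoC w * (RtoC u * d - RtoC u))%C) ->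
    exists C1, forall u, 0 < u -> u * (1 + Cmod d) <= exp (- (2)) ->
      Cmod (G (RtoC u * d) - G0)%C <= C1 * u.
Proof.
  intros HG HD HB. pose proof exp_m2_le as E2.
  destruct (exp_lim (fun v => G (0 + RtoC (exp (- v)) * 1)%C)
     (fun v => (RtoC (- exp (- v)) * (g (0 + RtoC (exp (- v)) * 1) * 1))%C) C0 2) as [G0 HL].
  { intros v Hv. apply (cder_comp_R (fun w => G (0 + RtoC w * 1)%C) (fun v => exp (- v))).
    - apply (hol_line D); [easy|].
      replace (0 + RtoC (exp (- v)) * 1)%C with (RtoC (exp (- v))) by ring. apply HD.
      split; [apply exp_pos|]. assert (exp (- v) <= exp (- (2))) by (apply exp_le; lra). lra.
    - auto_derive; [easy|ring]. }
  { intros v Hv. assert (exp (- v) <= exp (- (2))) by (apply exp_le; lra). pose proof (exp_pos (- v)).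
    rewrite !Cmod_mult, Cmod_R, Rabs_Ropp, Rabs_pos_eq, Cmod_1 by lra.
    replace (0 + RtoC (exp (- v)) * 1)%C with (RtoC (exp (- v))) by ring.
    rewrite Rmult_1_r, Rmult_comm. apply Rmult_le_compat_r; [lra|].
    apply HB; [apply HD; lra|]. rewrite Cmod_R, Rabs_pos_eq; lra. }
  exists G0. intros d Hd. exists (C0 + C0 * (1 + Cmod d)). intros u Hu Hu2.
  pose proof (Cmod_ge_0 d) as Pd.
  assert (Hu3 : u <= exp (- (2))) by nra.
  replace (G (RtoC u * d) - G0)%C with ((G (RtoC u) - G0) + (G (RtoC u * d) - G (RtoC u)))%C by ring.
  eapply Rle_trans; [apply Cmod_triangle|]. rewrite Rmult_plus_distr_r. apply Rplus_le_compat.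
  - assert (L : 2 <= - ln u).
    { assert (ln u <= - (2)); [|lra]. rewrite <- (ln_exp (- (2))). apply ln_le; lra. }
    specialize (HL (- ln u) L). rewrite Ropp_involutive, exp_ln in HL by easy.
    replace (0 + RtoC u * 1)%C with (RtoC u) in HL by ring. exact HL.
  - assert (C0p : 0 <= C0).
    { eapply Rle_trans; [apply (Cmod_ge_0 (g (RtoC u)))|]. apply HB; [apply HD; lra|].
      rewrite Cmod_R, Rabs_pos_eq; lra. }
    eapply Rle_trans.
    + apply (hol_segment D G g C0); [easy|intros; apply Hd; lra|].
      intros w Hw. apply HB; [apply Hd; lra|].
      replace (RtoC u + RtoC w * (RtoC u * d - RtoC u))%C
        with (RtoC ((1 - w) * u) + RtoC (w * u) * d)%C by (rewrite !RtoC_mult, RtoC_minus; ring).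
      eapply Rle_trans; [apply Cmod_affine_le; nra|].
      rewrite Cmod_R, Rabs_pos_eq by nra. nra.
    + rewrite Rmult_assoc. apply Rmult_le_compat_l; [easy|].
      replace (RtoC u * d - RtoC u)%C with (RtoC (- u) + RtoC u * d)%C by (rewrite RtoC_opp; ring).
      eapply Rle_trans; [apply Cmod_affine_le; lra|]. rewrite Cmod_R, Rabs_Ropp, Rabs_pos_eq by lra. lra.
Qed.

Lemma Cmod_le_small_eq (a b : C) : (forall eps, 0 < eps -> Cmod (a - b)%C <= eps) -> a = b.
Proof.
  intros H.
  assert (E : (a - b)%C = 0%C).
  { apply Cmod_eq_0. apply Rle_antisym; [|apply Cmod_ge_0]. apply le_epsilon. intros eps He.
    rewrite Rplus_0_l. now apply H. }
  replace a with ((a - b) + b)%C by ring. rewrite E. ring.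
Qed.

(** * The value of R(s) in terms of limits of a primitive *)

Lemma CLog_opp y : 0 < Im y -> CLog (- y)%C = (CLog y - Ci * RtoC PI)%C.
Proof.
  intros H. apply C_ext.
  - rewrite re_minus, !Re_CLog, Cmod_opp. simpl. ring.
  - rewrite im_minus, !Im_CLog. rewrite Arg_down by (rewrite im_opp; lra). rewrite Arg_up by easy.
    rewrite re_opp, im_opp. replace (- Re y / - Im y) with (Re y / Im y) by (field; lra).
    simpl. unfold Im. simpl. field.
Qed.

Lemma fint_opp s y : 0 < Im y ->
  fint s (- y)%C = (- (Cexp (Ci * RtoC PI * s) * fint s y))%C.
Proof.
  intros H. unfold fint.
  assert (D : den (- y)%C = (- den y)%C).
  { unfold den. replace (RtoC PI * Ci * - y)%C with (- (RtoC PI * Ci * y))%C by ring.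
    replace (- - (RtoC PI * Ci * y))%C with (RtoC PI * Ci * y)%C by ring. ring. }
  assert (K : kern s (- y)%C = (Cexp (Ci * RtoC PI * s) * kern s y)%C).
  { unfold kern, Cpowc. rewrite CLog_opp by easy.
    replace (- s * (CLog y - Ci * RtoC PI))%C with (Ci * RtoC PI * s + - s * CLog y)%C by ring.
    rewrite Cexp_plus. replace (RtoC PI * Ci * - y * - y)%C with (RtoC PI * Ci * y * y)%C by ring. ring. }
  rewrite D, K. assert (N : den y <> 0%C) by (apply den_neq0; left; lra). field. exact N.
Qed.

Section Rvalue.
Variable s : C.
Hypothesis Hre : Re s <= -1.
Hypothesis Him : 0 < Im s.

(** The limit [P0] at the origin is common to the upper and the lower half plane, because both are
    reached by segments starting on the interval (0, 1). *)
Lemma fprim_limits : exists Pinf P0,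
  (forall z d, 0 < Re d -> 0 < Im d -> exists C0 v0, 0 <= C0 /\
    forall v, v0 <= v -> Cmod (fprim s (z + RtoC v * d) - Pinf)%C <= C0 * exp (- v)) /\
  (forall d, Im d <> 0 -> exists C1, forall u, 0 < u -> u * (1 + Cmod d) <= exp (- (2)) ->
      Cmod (fprim s (RtoC u * d) - P0)%C <= C1 * u).
Proof.
  destruct (prim_inf cut_dom (fprim s) (fint s)) as [Pinf HI].
  - apply hol_fprim.
  - intros z Hz. left. lra.
  - now apply fint_inf.
  - destruct (prim_zero cut_dom (fprim s) (fint s) (exp (Im s * PI + 2 * PI))) as [P0 HZ].
    + apply hol_fprim.
    + intros u Hu. right. exact Hu.
    + intros x Hx Hm. now apply fint_zero.
    + exists Pinf, P0. split; [exact HI|]. intros d Hd. apply HZ. intros u w Hu Hw.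
      unfold cut_dom.
      replace (Im (RtoC u + RtoC w * (RtoC u * d - RtoC u))%C) with (w * u * Im d) by (simpl; unfold Im; ring).
      replace (Re (RtoC u + RtoC w * (RtoC u * d - RtoC u))%C) with (u * (1 - w) + w * u * Re d)
        by (simpl; unfold Re; ring).
      destruct (Req_dec w 0) as [->|W]; [right; lra|left].
      apply Rmult_integral_contrapositive. split; [nra|easy].
Qed.

(** By [fint_opp] the combination has zero derivative along the segment from y0 to y1, which stays
    in the upper half plane. *)
Lemma fprim_opp_const (y0 y1 : C) : 0 < Im y0 -> 0 < Im y1 ->
  (fprim s (- y1) + - (Cexp (Ci * RtoC PI * s) * fprim s y1)
   = fprim s (- y0) + - (Cexp (Ci * RtoC PI * s) * fprim s y0))%C.
Proof.
  intros H0 H1.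
  set (k := Cexp (Ci * RtoC PI * s)).
  pose (F := fun v : R => (fprim s (- y0 + RtoC v * (- (y1 - y0)))
     + - (k * fprim s (y0 + RtoC v * (y1 - y0))))%C).
  assert (E : F 1 = F 0).
  { apply cder_0_const; [lra|]. intros u Hu.
    assert (Hp : 0 < Im (y0 + RtoC u * (y1 - y0))%C) by (rewrite Im_affine, im_minus; nra).
    eapply cder_eq.
    - apply cder_plus.
      + apply (hol_line cut_dom); [apply hol_fprim|].
        left. rewrite Im_affine, !im_opp, im_minus. rewrite Im_affine, im_minus in Hp. nra.
      + apply cder_opp, cder_scal. apply (hol_line cut_dom); [apply hol_fprim|left; lra].
    - cbv beta.
      replace (- y0 + RtoC u * - (y1 - y0))%C with (- (y0 + RtoC u * (y1 - y0)))%C by ring.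
      rewrite fint_opp by easy. fold k. ring. }
  unfold F in E.
  replace (- y0 + RtoC 1 * - (y1 - y0))%C with (- y1)%C in E by ring.
  replace (- y0 + RtoC 0 * - (y1 - y0))%C with (- y0)%C in E by ring.
  replace (y0 + RtoC 1 * (y1 - y0))%C with y1 in E by ring.
  replace (y0 + RtoC 0 * (y1 - y0))%C with y0 in E by ring.
  exact E.
Qed.
End Rvalue.

Lemma omega_neg : Re omega < 0 /\ Im omega < 0.
Proof.
  unfold omega. rewrite Re_Cexp, Im_Cexp.
  replace (Re (Ci * RtoC (- (3 * PI / 4)))%C) with 0 by (simpl; unfold Re; simpl; ring).
  replace (Im (Ci * RtoC (- (3 * PI / 4)))%C) with (- (3 * (PI / 4))) by (simpl; unfold Im; simpl; field).
  rewrite exp_0, cos_neg, sin_neg, cos_3PI4, sin_3PI4.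
  assert (0 < / sqrt 2) by (apply Rinv_0_lt_compat, sqrt_lt_R0; lra).
  unfold Rdiv. lra.
Qed.

(* The two halves of the contour of R(s) are related by [x -> - x], under which
   [x^(-s)] picks up the factor [exp (PI Ci s)]. *)
Lemma fprim_opp s P0 y : 
  (forall d, Im d <> 0 -> exists C1, forall u, 0 < u -> u * (1 + Cmod d) <= exp (- (2)) ->
      Cmod (fprim s (RtoC u * d) - P0)%C <= C1 * u) ->
  0 < Im y ->
  fprim s (- y)%C = (Cexp (Ci * RtoC PI * s) * (fprim s y - P0) + P0)%C.
Proof.
  intros HZ Hy. set (k := Cexp (Ci * RtoC PI * s)).
  assert (E : (fprim s (- y) + - (k * fprim s y))%C = (P0 + - (k * P0))%C).
  { apply Cmod_le_small_eq. intros eps He.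
    destruct (HZ Ci) as [C1 H1]; [simpl; lra|]. destruct (HZ (- Ci)%C) as [C2 H2]; [simpl; lra|].
    set (M := Rabs C2 + Cmod k * Rabs C1 + 1).
    assert (HM : 1 <= M).
    { unfold M. pose proof (Rabs_pos C2). pose proof (Rabs_pos C1). pose proof (Cmod_ge_0 k). nra. }
    set (u := Rmin (eps / M) (exp (- (2)) / 2)).
    assert (Hu : 0 < u).
    { apply Rmin_glb_lt; [apply Rdiv_lt_0_compat; lra|]. pose proof (exp_pos (- (2))). lra. }
    assert (Hu1 : u * M <= eps).
    { apply Rmult_le_reg_r with (/ M); [apply Rinv_0_lt_compat; lra|].
      rewrite Rmult_assoc, Rinv_r, Rmult_1_r by lra. apply Rmin_l. }
    assert (Hu2 : u <= exp (- (2)) / 2) by apply Rmin_r.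
    assert (Hc : 0 < Im (RtoC u * Ci)%C) by (simpl; lra).
    pose proof (fprim_opp_const s (RtoC u * Ci)%C y Hc Hy) as Q. fold k in Q. rewrite Q.
    replace (- (RtoC u * Ci))%C with (RtoC u * - Ci)%C by ring.
    specialize (H1 u Hu). specialize (H2 u Hu). rewrite Cmod_opp in H2. rewrite Cmod_Ci in *.
    assert (Hu3 : u * (1 + 1) <= exp (- (2))) by lra. specialize (H1 Hu3). specialize (H2 Hu3).
    replace (fprim s (RtoC u * - Ci) + - (k * fprim s (RtoC u * Ci)) - (P0 + - (k * P0)))%C
      with ((fprim s (RtoC u * - Ci) - P0) + - (k * (fprim s (RtoC u * Ci) - P0)))%C by ring.
    eapply Rle_trans; [apply Cmod_triangle|]. rewrite Cmod_opp, Cmod_mult.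
    pose proof (Rle_abs C1). pose proof (Rle_abs C2). pose proof (Cmod_ge_0 k).
    pose proof (Cmod_ge_0 (fprim s (RtoC u * Ci) - P0)%C).
    assert (Cmod (fprim s (RtoC u * Ci) - P0)%C <= Rabs C1 * u) by nra.
    assert (Cmod (fprim s (RtoC u * - Ci) - P0)%C <= Rabs C2 * u) by nra.
    unfold M in Hu1. nra. }
  replace (fprim s (- y)%C) with ((fprim s (- y) + - (k * fprim s y)) + k * fprim s y)%C by ring.
  rewrite E. ring.
Qed.

Lemma is_RInt_Rintegrand s c a b : 0 < c < 1 ->
  is_RInt (V := prod_NormedModule R_AbsRing R_NormedModule R_NormedModule) (Rintegrand s c) a b
    (fprim s (RtoC c + RtoC b * omega) - fprim s (RtoC c + RtoC a * omega))%C.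
Proof.
  intros Hc. destruct omega_neg as [O1 O2].
  assert (HD : forall u, cut_dom (RtoC c + RtoC u * omega)%C).
  { intros u. destruct (Req_dec u 0) as [->|Hu].
    - right. rewrite Re_affine. simpl. lra.
    - left. rewrite Im_affine. simpl. rewrite Rplus_0_l. apply Rmult_integral_contrapositive.
      split; [exact Hu|apply Rlt_not_eq; exact O2]. }
  destruct (cder_is_RInt (fun u => fprim s (RtoC c + RtoC u * omega)%C)
     (fun u => (fint s (RtoC c + RtoC u * omega) * omega)%C) a b) as [I1 I2].
  - intros u _. apply (hol_line cut_dom); [apply hol_fprim|apply HD].
  - intros u _. apply ccont_mult; [|apply ccont_const].
    apply (ccont_comp (fint s) (fun u : R => (RtoC c + RtoC u * omega)%C)).
    + eapply cder_ccont, cder_affine.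
    + apply ccont_fint, HD.
  - exact (is_RInt_fct_extend_pair (U := R_NormedModule) (V := R_NormedModule) _ _ _ _ _ I1 I2).
Qed.

(** The incoming end of the line lies in the first quadrant and contributes - [Pinf]. The outgoing
    end is minus a point of the ray from - c in the direction - [omega], so by [fprim_opp] it
    contributes k (Pinf - P0) + P0 with k = exp (i pi s). The sum is (k - 1) (Pinf - P0), whatever c
    is. *)
Lemma RiemannAux_value s : Re s <= -1 -> 0 < Im s -> forall Pinf P0 : C,
  (forall z d, 0 < Re d -> 0 < Im d -> exists C0 v0, 0 <= C0 /\
    forall v, v0 <= v -> Cmod (fprim s (z + RtoC v * d) - Pinf)%C <= C0 * exp (- v)) ->
  (forall d, Im d <> 0 -> exists C1, forall u, 0 < u -> u * (1 + Cmod d) <= exp (- (2)) ->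
      Cmod (fprim s (RtoC u * d) - P0)%C <= C1 * u) ->
  forall c, 0 < c < 1 -> 
  RiemannAux_is s c ((Cexp (Ci * RtoC PI * s) - 1) * (Pinf - P0))%C.
Proof.
  intros Hre Him Pinf P0 HI HZ c Hc. set (k := Cexp (Ci * RtoC PI * s)).
  destruct omega_neg as [O1 O2].
  destruct (HI (RtoC c) (- omega)%C) as [C1 [v1 [HC1 K1]]]; [rewrite re_opp; lra|rewrite im_opp; lra|].
  destruct (HI (RtoC (- c)) (- omega)%C) as [C2 [v2 [HC2 K2]]]; [rewrite re_opp; lra|rewrite im_opp; lra|].
  set (V := ((k - 1) * (Pinf - P0))%C).
  assert (Est : forall a b, v1 <= - a -> v2 <= b -> 0 < b ->
    Cmod (fprim s (RtoC c + RtoC b * omega) - fprim s (RtoC c + RtoC a * omega) - V)%C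
      <= C1 * exp a + Cmod k * C2 * exp (- b)).
  { intros a b Ha Hb Hb0. specialize (K1 (- a) Ha). specialize (K2 b Hb).
    replace (RtoC (- a) * - omega)%C with (RtoC a * omega)%C in K1 by (rewrite RtoC_opp; ring).
    rewrite Ropp_involutive in K1.
    replace (RtoC c + RtoC b * omega)%C with (- (RtoC (- c) + RtoC b * - omega))%C
      by (rewrite RtoC_opp; ring).
    rewrite (fprim_opp s P0); [|exact HZ|]. 
    - fold k. unfold V.
      set (X := fprim s (RtoC (- c) + RtoC b * - omega)%C) in *.
      set (Y := fprim s (RtoC c + RtoC a * omega)%C) in *.
      replace (k * (X - P0) + P0 - Y - (k - 1) * (Pinf - P0))%C
        with (- (Y - Pinf) + k * (X - Pinf))%C by ring.
      eapply Rle_trans; [apply Cmod_triangle|]. rewrite Cmod_opp, Cmod_mult.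
      pose proof (Cmod_ge_0 k). nra.
    - rewrite Im_affine, im_opp. rewrite im_RtoC. nra. }
  set (M := C1 + Cmod k * C2 + 1).
  assert (HM : 0 < M).
  { unfold M. pose proof (Rmult_le_pos _ _ (Cmod_ge_0 k) HC2). lra. }
  unfold RiemannAux_is, is_RInt_gen. intros Q [eps HQ]. 
  destruct eps as [eps He].
  set (L := ln (eps / M)).
  assert (HL : exp L = eps / M) by (apply exp_ln, Rdiv_lt_0_compat; lra).
  exists (fun a => a < Rmin (- v1) L) (fun b => Rmax (Rmax v2 0) (- L) < b);
    [now exists (Rmin (- v1) L)|now exists (Rmax (Rmax v2 0) (- L))|].
  intros a b Ha Hb.
  eexists. split; [simpl; now apply is_RInt_Rintegrand|].
  apply HQ.
  pose proof (Rmin_l (- v1) L). pose proof (Rmin_r (- v1) L).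
  pose proof (Rmax_l (Rmax v2 0) (- L)). pose proof (Rmax_r (Rmax v2 0) (- L)).
  pose proof (Rmax_l v2 0). pose proof (Rmax_r v2 0).
  assert (E : Cmod (fprim s (RtoC c + RtoC b * omega) - fprim s (RtoC c + RtoC a * omega) - V)%C < eps).
  { eapply Rle_lt_trans; [apply Est; lra|].
    assert (exp a < eps / M) by (rewrite <- HL; apply exp_increasing; lra).
    assert (exp (- b) < eps / M) by (rewrite <- HL; apply exp_increasing; lra).
    apply Rle_lt_trans with ((C1 + Cmod k * C2) * (eps / M)).
    - pose proof (Cmod_ge_0 k).
      assert (0 <= Cmod k * C2) by (now apply Rmult_le_pos). nra.
    - replace (C1 + Cmod k * C2) with (M - 1) by (unfold M; ring).
      assert (0 < eps / M) by (apply Rdiv_lt_0_compat; lra).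
      assert (M * (eps / M) = eps) by (field; lra). nra. }
  split.
  - eapply Rle_lt_trans; [|exact E]. eapply Rle_trans; [|apply re_le_Cmod]. right. reflexivity.
  - eapply Rle_lt_trans; [|exact E]. eapply Rle_trans; [|apply Rabs_Im_le_Cmod]. right. reflexivity.
Qed.

(** * Finite sums, limits along rays, and the geometric expansion *)

Fixpoint csum (f : nat -> C) (n : nat) : C :=
  match n with O => 0%C | S k => (csum f k + f k)%C end.

Lemma csum_S f n : csum f (S n) = (csum f n + f n)%C.
Proof. reflexivity. Qed.

Lemma cder_csum (g : nat -> R -> C) l u n : (forall k, cder (g k) u (l k)) ->
  cder (fun v => csum (fun k => g k v) n) u (csum l n).
Proof.
  intros H. induction n as [|n IH]; simpl; [apply cder_const|].
  apply (cder_plus (fun v => csum (fun k => g k v) n)); auto.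
Qed.

Lemma csum_mult_r f c n : (csum f n * c = csum (fun k => f k * c) n)%C.
Proof. induction n as [|n IH]; simpl; [ring|]. rewrite <- IH. ring. Qed.

Definition tinf (d : C) (G : C -> C) (L : C) : Prop :=
  exists C0 v0, 0 <= C0 /\ forall v, v0 <= v -> Cmod (G (RtoC v * d) - L)%C <= C0 * exp (- v).

Definition tzero (d : C) (G : C -> C) (L : C) : Prop :=
  exists C1 u0, 0 <= C1 /\ 0 < u0 /\ forall u, 0 < u <= u0 -> Cmod (G (RtoC u * d) - L)%C <= C1 * u.

Lemma tinf_plus d G H L M : tinf d G L -> tinf d H M -> tinf d (fun z => G z + H z)%C (L + M)%C.
Proof.
  intros [C0 [v0 [P0 K0]]] [C1 [v1 [P1 K1]]].
  exists (C0 + C1), (Rmax v0 v1). split; [lra|]. intros v Hv.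
  pose proof (Rmax_l v0 v1). pose proof (Rmax_r v0 v1).
  specialize (K0 v ltac:(lra)). specialize (K1 v ltac:(lra)).
  replace (G (RtoC v * d) + H (RtoC v * d) - (L + M))%C
    with ((G (RtoC v * d) - L) + (H (RtoC v * d) - M))%C by ring.
  eapply Rle_trans; [apply Cmod_triangle|]. lra.
Qed.

Lemma tzero_plus d G H L M : tzero d G L -> tzero d H M -> tzero d (fun z => G z + H z)%C (L + M)%C.
Proof.
  intros [C0 [v0 [P0 [Q0 K0]]]] [C1 [v1 [P1 [Q1 K1]]]].
  exists (C0 + C1), (Rmin v0 v1). split; [lra|]. split; [now apply Rmin_glb_lt|]. intros v Hv.
  pose proof (Rmin_l v0 v1). pose proof (Rmin_r v0 v1).
  specialize (K0 v ltac:(lra)). specialize (K1 v ltac:(lra)).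
  replace (G (RtoC v * d) + H (RtoC v * d) - (L + M))%C
    with ((G (RtoC v * d) - L) + (H (RtoC v * d) - M))%C by ring.
  eapply Rle_trans; [apply Cmod_triangle|]. lra.
Qed.

Lemma tinf_csum d (G : nat -> C -> C) L n : (forall k, (k < n)%nat -> tinf d (G k) (L k)) ->
  tinf d (fun z => csum (fun k => G k z) n) (csum L n).
Proof.
  induction n as [|n IH]; intros H; simpl.
  - exists 0, 0. split; [lra|]. intros v Hv. replace (0 - 0)%C with (RtoC 0) by ring. rewrite Cmod_0. lra.
  - apply (tinf_plus d (fun z => csum (fun k => G k z) n)); auto.
Qed.

Lemma tzero_csum d (G : nat -> C -> C) L n : (forall k, (k < n)%nat -> tzero d (G k) (L k)) ->
  tzero d (fun z => csum (fun k => G k z) n) (csum L n).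
Proof.
  induction n as [|n IH]; intros H; simpl.
  - exists 0, 1. split; [lra|]. split; [lra|]. intros v Hv. replace (0 - 0)%C with (RtoC 0) by ring. rewrite Cmod_0. lra.
  - apply (tzero_plus d (fun z => csum (fun k => G k z) n)); auto.
Qed.

Lemma exp_le_1 x : x <= 0 -> exp x <= 1.
Proof. intros H. apply exp_le in H. now rewrite exp_0 in H. Qed.

Lemma exp_neg_le v : 0 < v -> exp (- v) <= / v.
Proof.
  intros H. rewrite exp_Ropp. apply Rinv_le_contravar; [easy|]. pose proof (exp_ineq1_le v). lra.
Qed.

Lemma tinf_bound d G L (X : C) B : tinf d G L ->
  (forall v, 1 <= v -> Cmod (G (RtoC v * d) - X)%C <= B) -> Cmod (L - X)%C <= B.
Proof.
  intros [C0 [v0 [P0 K0]]] H. apply le_epsilon. intros eps He.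
  set (v := Rmax (Rmax v0 1) (C0 / eps)).
  assert (v0 <= v /\ 1 <= v /\ C0 / eps <= v) as (V1 & V2 & V3).
  { unfold v. pose proof (Rmax_l (Rmax v0 1) (C0 / eps)). pose proof (Rmax_r (Rmax v0 1) (C0 / eps)).
    pose proof (Rmax_l v0 1). pose proof (Rmax_r v0 1). lra. }
  specialize (K0 v V1). specialize (H v V2).
  replace (L - X)%C with ((G (RtoC v * d) - X) + - (G (RtoC v * d) - L))%C by ring.
  eapply Rle_trans; [apply Cmod_triangle|]. rewrite Cmod_opp.
  pose proof (exp_neg_le v ltac:(lra)).
  assert (C0 <= eps * v).
  { apply Rmult_le_reg_r with (/ eps); [now apply Rinv_0_lt_compat|].
    replace (eps * v * / eps) with v by (field; lra). exact V3. }
  assert (C0 * exp (- v) <= C0 * / v) by (now apply Rmult_le_compat_l).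
  assert (C0 * / v <= eps).
  { apply Rmult_le_reg_r with v; [lra|]. replace (C0 * / v * v) with C0 by (field; lra). easy. }
  lra.
Qed.

Lemma tzero_bound d G L (X : C) u1 B : 0 < u1 -> tzero d G L ->
  (forall u, 0 < u <= u1 -> Cmod (X - G (RtoC u * d))%C <= B) -> Cmod (X - L)%C <= B.
Proof.
  intros Hu1 [C0 [u0 [P0 [Q0 K0]]]] H. apply le_epsilon. intros eps He.
  set (u := Rmin (Rmin u0 u1) (eps / (C0 + 1))).
  assert (U : 0 < u).
  { unfold u. repeat apply Rmin_glb_lt; try easy. apply Rdiv_lt_0_compat; lra. }
  assert (u <= u0 /\ u <= u1 /\ u <= eps / (C0 + 1)) as (V1 & V2 & V3).
  { unfold u. pose proof (Rmin_l (Rmin u0 u1) (eps / (C0 + 1))). pose proof (Rmin_r (Rmin u0 u1) (eps / (C0 + 1))).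
    pose proof (Rmin_l u0 u1). pose proof (Rmin_r u0 u1). lra. }
  specialize (K0 u ltac:(lra)). specialize (H u ltac:(lra)).
  replace (X - L)%C with ((X - G (RtoC u * d)) + (G (RtoC u * d) - L))%C by ring.
  eapply Rle_trans; [apply Cmod_triangle|].
  assert (C0 * u <= eps).
  { apply Rle_trans with (C0 * (eps / (C0 + 1))); [now apply Rmult_le_compat_l|].
    apply Rmult_le_reg_r with (C0 + 1); [lra|]. field_simplify; lra. }
  lra.
Qed.

(** Rays from the origin keep [Arg x] fixed, so the factor exp (Im s * Arg x), which is enormous for
    large t, cancels from every comparison along a ray. *)
Lemma kern_ray s l x : 0 < l -> slit x -> Cmod (kern s (RtoC l * x)%C) =
  Cmod (kern s x) * exp (- Re s * ln l - 2 * PI * (Re x * Im x) * (l ^ 2 - 1)).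
Proof.
  intros Hl Hx. rewrite !Cmod_kern, <- exp_plus. f_equal.
  assert (Px : 0 < Cmod x) by (now apply Cmod_gt_0, slit_neq0).
  assert (A : Arg (RtoC l * x)%C = Arg x).
  { rewrite <- !Im_CLog, CLog_scal, im_plus by easy. simpl. ring. }
  rewrite A, Cmod_mult, Cmod_R, Rabs_pos_eq, ln_mult, re_scal_l, im_scal_l by lra. ring.
Qed.

(** With q = exp (i pi x), [den x] is q - 1 / q, and q^(2 k + 1) (q - 1 / q) = q^(2 k + 2) - q^(2 k)
    telescopes. *)
Lemma geom_den x K : Im x <> 0 ->
  (/ den x + csum (fun k => Cexp (RtoC PI * Ci * RtoC (INR (2 * k + 1)) * x)) K
   = Cexp (RtoC PI * Ci * RtoC (INR (2 * K)) * x) / den x)%C.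
Proof.
  intros Hx. assert (N : den x <> 0%C) by (apply den_neq0; now left).
  assert (E : (1 + csum (fun k => Cexp (RtoC PI * Ci * RtoC (INR (2 * k + 1)) * x)) K * den x
    = Cexp (RtoC PI * Ci * RtoC (INR (2 * K)) * x))%C).
  { clear N. induction K as [|K IH].
    - simpl csum. simpl INR. replace (RtoC PI * Ci * RtoC 0 * x)%C with (RtoC 0) by ring. rewrite Cexp_0. ring.
    - set (f := fun k : nat => Cexp (RtoC PI * Ci * RtoC (INR (2 * k + 1)) * x)) in *.
      change (csum f (S K)) with (csum f K + f K)%C.
      replace (1 + (csum f K + f K) * den x)%C with (1 + csum f K * den x + f K * den x)%C by ring.
      rewrite IH. unfold f, den.
      set (q := (RtoC PI * Ci * x)%C).
      replace (RtoC PI * Ci * RtoC (INR (2 * S K)) * x)%C with (RtoC (INR (2 * K + 1)) * q + q)%C.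
      2: { replace (2 * S K)%nat with ((2 * K + 1) + 1)%nat by lia. unfold q.
           rewrite (plus_INR (2 * K + 1)), RtoC_plus. simpl (INR 1). ring. }
      replace (RtoC PI * Ci * RtoC (INR (2 * K)) * x)%C with (RtoC (INR (2 * K + 1)) * q + - q)%C.
      2: { unfold q. rewrite plus_INR, RtoC_plus. simpl (INR 1). ring. }
      replace (RtoC PI * Ci * RtoC (INR (2 * K + 1)) * x)%C with (RtoC (INR (2 * K + 1)) * q)%C by (unfold q; ring).
      rewrite !Cexp_plus. ring. }
  rewrite <- E. field. exact N.
Qed.

(** * The remainder on the ray through the saddle point *)

Section Eta.
Variables (s e : C).
Hypothesis Hs : (s - 1 = 2 * RtoC PI * Ci * e * e)%C.
Hypothesis Hb : 0 < Im e.
Hypothesis Hab : Im e < Re e.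
Hypothesis Hre : Re s <= -1.

Lemma Re_s : Re s = 1 - 4 * PI * Re e * Im e.
Proof.
  replace s with ((s - 1) + 1)%C by ring. rewrite Hs. simpl. unfold Re, Im. ring.
Qed.

Lemma Im_s : Im s = 2 * PI * (Re e ^ 2 - Im e ^ 2).
Proof.
  replace s with ((s - 1) + 1)%C by ring. rewrite Hs. simpl. unfold Re, Im. ring.
Qed.

Lemma Im_s_pos : 0 < Im s.
Proof. rewrite Im_s. pose proof PI_RGT_0. assert (0 < Re e ^ 2 - Im e ^ 2) by nra. nra. Qed.

(** The terms have no poles, so the limit at 0 holds in every direction of positive real part. This
    generality matters: the lower end of the segment through the saddle point may lie below the real
    axis. *)
Lemma gprim_limits m : 0 <= m -> exists Ginf G0,
  (forall d, 0 < Re d -> 0 < Im d -> tinf d (gprim s m) Ginf) /\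
  (forall d, 0 < Re d -> tzero d (gprim s m) G0).
Proof.
  intros Hm. pose proof Im_s_pos as Him.
  destruct (prim_inf slit (gprim s m) (gint s m)) as [Ginf HI].
  - apply hol_gprim.
  - intros z Hz. right. lra.
  - intros k l Hk Hl. destruct (kern_inf s Hre Him k l Hk Hl) as [C0 [HC K]].
    exists C0. split; [easy|]. intros u x Hu H1 H2 H3.
    eapply Rle_trans; [apply gint_le_kern; [easy|nra]|now apply K].
  - destruct (prim_zero slit (gprim s m) (gint s m) (exp (Im s * PI + 2 * PI + PI * m))) as [G0 HZ].
    + apply hol_gprim.
    + intros u Hu. left. simpl. lra.
    + intros x Hx Hxm. apply gint_zero; try easy. lra.
    + exists Ginf, G0. split.
      * intros d H1 H2. destruct (HI 0%C d H1 H2) as [C0 [v0 [P K]]]. exists C0, v0. split; [easy|].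
        intros v Hv. replace (RtoC v * d)%C with (0 + RtoC v * d)%C by ring. now apply K.
      * intros d H1. destruct (HZ d) as [C1 K].
        { intros u w Hu Hw. left.
          replace (Re (RtoC u + RtoC w * (RtoC u * d - RtoC u))%C) with (u * (1 - w + w * Re d))
            by (simpl; unfold Re; ring).
          apply Rmult_lt_0_compat; [easy|]. destruct (Req_dec w 0); [subst; lra|nra]. }
        pose proof (Cmod_ge_0 d).
        exists (Rabs C1), (exp (- (2)) / (1 + Cmod d)). split; [apply Rabs_pos|].
        split; [apply Rdiv_lt_0_compat; [apply exp_pos|lra]|].
        intros u Hu. eapply Rle_trans; [apply K; [easy|]|].
        { apply Rmult_le_reg_r with (/ (1 + Cmod d)); [apply Rinv_0_lt_compat; lra|].
          rewrite Rmult_assoc, Rinv_r, Rmult_1_r by lra. apply Hu. }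
        apply Rmult_le_compat_r; [lra|apply Rle_abs].
Qed.

(** As 4 pi Re e Im e = 1 - Re s, the power and the Gaussian combine into one multiple of ln l -
    (l^2 - 1) / 2, which is nonpositive and vanishes to second order at l = 1. *)
Lemma kern_ray_eta l : 0 < l -> Cmod (kern s (RtoC l * e)%C) =
  Cmod (kern s e) * (/ l * exp ((1 - Re s) * (ln l - (l ^ 2 - 1) / 2))).
Proof.
  intros Hl. rewrite kern_ray; [|easy|left; lra]. f_equal.
  rewrite <- (exp_ln (/ l)) by (now apply Rinv_0_lt_compat). rewrite <- exp_plus. f_equal.
  rewrite ln_Rinv by easy.
  assert (E : 2 * PI * (Re e * Im e) = (1 - Re s) / 2) by (rewrite Re_s; field). rewrite E. field.
Qed.

Lemma ln2_ge : 3 / 5 <= ln 2.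
Proof.
  rewrite <- (ln_exp (3 / 5)). apply ln_le; [apply exp_pos|].
  assert (H : exp (/ 10) <= 10 / 9).
  { assert (E : exp (/ 10) = / exp (- / 10)) by (rewrite exp_Ropp, Rinv_inv; easy).
    rewrite E. replace (10 / 9) with (/ (9 / 10)) by field. apply Rinv_le_contravar; [lra|].
    pose proof (exp_ineq1_le (- / 10)). lra. }
  (* It suffices that exp (3/5) <= 2, and exp (3/5) is the sixth power of exp (1/10) <= 10/9. *)
  replace (3 / 5) with (/10 + (/10 + (/10 + (/10 + (/10 + /10))))) by field.
  rewrite !exp_plus. set (x := exp (/ 10)) in *. assert (0 < x) by apply exp_pos.
  replace (x * (x * (x * (x * (x * x))))) with (x ^ 6) by ring.
  apply Rle_trans with ((10 / 9) ^ 6); [apply pow_incr; lra|]. lra.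
Qed.

Lemma ln_le_sq l : 0 < l -> ln l - (l ^ 2 - 1) / 2 <= 0.
Proof.
  intros H. pose proof (exp_ineq1_le (2 * ln l)) as E.
  replace (exp (2 * ln l)) with (l ^ 2) in E; [lra|].
  replace (2 * ln l) with (ln l + ln l) by ring. rewrite exp_plus, exp_ln by easy. ring.
Qed.

(* What is left of [fint] after [K] terms of its geometric expansion. *)
Definition remint (K : nat) (x : C) : C :=
  (fint s x * Cexp (RtoC PI * Ci * RtoC (INR (2 * K)) * x))%C.

Definition remprim (K : nat) (x : C) : C :=
  (fprim s x + csum (fun k => gprim s (INR (2 * k + 1)) x) K)%C.

Lemma remprim_ray K l : 0 < l ->
  cder (fun v => remprim K (RtoC v * e)) l (remint K (RtoC l * e) * e)%C.
Proof.
  intros Hl.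
  assert (I : 0 < Im (RtoC l * e)%C) by (rewrite im_scal_l; nra).
  assert (P : slit (0 + RtoC l * e)%C) by (right; rewrite Cplus_0_l; lra).
  assert (Q : cut_dom (0 + RtoC l * e)%C) by (left; rewrite Cplus_0_l; lra).
  apply (cder_ext (fun v => (fprim s (0 + RtoC v * e)
     + csum (fun k => gprim s (INR (2 * k + 1)) (0 + RtoC v * e)) K)%C)).
  { intros v. now rewrite Cplus_0_l. }
  assert (S : cder (fun v => csum (fun k => gprim s (INR (2 * k + 1)) (0 + RtoC v * e)%C) K) l
     (csum (fun k => gint s (INR (2 * k + 1)) (0 + RtoC l * e)%C) K * e)%C).
  { rewrite csum_mult_r.
    apply (cder_csum (fun k v => gprim s (INR (2 * k + 1)) (0 + RtoC v * e)%C)).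
    intros k. apply (hol_line slit); [apply hol_gprim|exact P]. }
  eapply cder_eq.
  - apply cder_plus; [|exact S]. apply (hol_line cut_dom); [apply hol_fprim|exact Q].
  - cbv beta. rewrite Cplus_0_l. unfold remint, fint.
    assert (G : forall K, csum (fun k => gint s (INR (2 * k + 1)) (RtoC l * e)%C) K
       = (kern s (RtoC l * e) * csum (fun k => Cexp (RtoC PI * Ci * RtoC (INR (2 * k + 1)) * (RtoC l * e))) K)%C).
    { clear. induction K as [|K IH];
      [simpl; ring|rewrite !csum_S; cbv beta]. rewrite IH. unfold gint. ring. }
    rewrite G. unfold Cdiv.
    replace (kern s (RtoC l * e) * / den (RtoC l * e) * Cexp (RtoC PI * Ci * RtoC (INR (2 * K)) * (RtoC l * e)) * e)%C
      with (kern s (RtoC l * e) * (Cexp (RtoC PI * Ci * RtoC (INR (2 * K)) * (RtoC l * e)) / den (RtoC l * e)) * e)%C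
      by (unfold Cdiv; ring).
    rewrite <- geom_den by lra. ring.
Qed.

Lemma remint_le K l : 0 < l -> Cmod (remint K (RtoC l * e) * e)%C <=
  Cmod (kern s e) * Cmod e / (2 * PI * Im e) *
   (/ l ^ 2 * exp ((1 - Re s) * (ln l - (l ^ 2 - 1) / 2)) * exp (- (2 * PI * INR K * l * Im e))).
Proof.
  intros Hl. pose proof PI_RGT_0 as HPI.
  assert (I : 0 < Im (RtoC l * e)%C) by (rewrite im_scal_l; nra).
  assert (N : den (RtoC l * e)%C <> 0%C) by (apply den_neq0; left; lra).
  unfold remint, fint. rewrite !Cmod_mult, Cmod_div, Cmod_Cexp, kern_ray_eta by easy.
  replace (Re (RtoC PI * Ci * RtoC (INR (2 * K)) * (RtoC l * e))%C) with (- (2 * PI * INR K * l * Im e)).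
  2: { rewrite mult_INR. simpl (INR 2). simpl; unfold Re, Im; ring. }
  assert (D : 2 * PI * (l * Im e) <= Cmod (den (RtoC l * e)%C)).
  { rewrite <- im_scal_l. rewrite <- (Rabs_pos_eq (Im _)) by lra. apply Cmod_den_Im. }
  assert (Pd : 0 < 2 * PI * (l * Im e)) by (apply Rmult_lt_0_compat; [lra|nra]).
  set (M := Cmod (kern s e)). set (X := exp ((1 - Re s) * _)). set (Y := exp (- _)).
  assert (0 <= M * (/ l * X) * Y * Cmod e).
  { repeat apply Rmult_le_pos; try apply Cmod_ge_0; try (apply Rlt_le, exp_pos).
    now apply Rlt_le, Rinv_0_lt_compat. }
  apply Rle_trans with (M * (/ l * X) * Y * Cmod e * / (2 * PI * (l * Im e))).
  - replace (M * (/ l * X) / Cmod (den (RtoC l * e)) * Y * Cmod e)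
      with (M * (/ l * X) * Y * Cmod e * / Cmod (den (RtoC l * e)%C)) by (unfold Rdiv; ring).
    apply Rmult_le_compat_l; [easy|]. now apply Rinv_le_contravar.
  - right. field. repeat split; lra.
Qed.

(** The ray is cut at l = 1/2. Beyond it the geometric factor exp (- 2 pi K l Im e) is already at
    most exp (- pi K Im e), and 1 / l^2 is integrable at infinity. Below it that factor is useless,
    but the distance from the saddle makes the kernel exponentially small in - Re s. *)
Lemma remprim_bound K u v : 0 < u <= 1 / 2 -> 1 <= v ->
  Cmod (remprim K (RtoC v * e) - remprim K (RtoC u * e))%C <=
  Cmod (kern s e) * Cmod e / Im e * (exp (- (PI * INR K * Im e)) + exp (- ((- 1 - Re s) / 10))).
Proof.
  intros Hu Hv. pose proof PI_RGT_0 as HPI. pose proof PI2_1 as HPI2.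
  set (c := Cmod (kern s e) * Cmod e / (2 * PI * Im e)).
  assert (Hc : 0 <= c).
  { unfold c, Rdiv. repeat apply Rmult_le_pos; try apply Cmod_ge_0.
    apply Rlt_le, Rinv_0_lt_compat. apply Rmult_lt_0_compat; lra. }
  assert (HK : 0 <= INR K) by apply pos_INR.
  set (E1 := exp (- (PI * INR K * Im e))).
  set (E2 := exp (- ((- 1 - Re s) / 10))).
  pose proof (exp_pos (- (PI * INR K * Im e))) as PE1. fold E1 in PE1.
  pose proof (exp_pos (- ((- 1 - Re s) / 10))) as PE2. fold E2 in PE2.
  assert (A : Cmod (remprim K (RtoC v * e) - remprim K (RtoC (1/2) * e))%C
     <= - (c * E1) * / v - - (c * E1) * / (1/2)).
  { apply (cder_Cmod_le (fun v => remprim K (RtoC v * e)%C) (fun l => (remint K (RtoC l * e) * e)%C)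
      (fun v => - (c * E1) * / v) (fun l => c * E1 * / l ^ 2)); [lra| | |].
    - intros l Hl. apply remprim_ray. lra.
    - intros l Hl. auto_derive; [lra|]. field. lra.
    - intros l Hl. eapply Rle_trans; [apply remint_le; lra|]. fold c.
      replace (c * E1 * / l ^ 2) with (c * (/ l ^ 2 * (1 * E1))) by ring.
      apply Rmult_le_compat_l; [easy|].
      assert (Pl : 0 < / l ^ 2) by (apply Rinv_0_lt_compat, pow_lt; lra).
      rewrite Rmult_assoc. apply Rmult_le_compat_l; [lra|].
      apply Rmult_le_compat; try (apply Rlt_le, exp_pos).
      + apply exp_le_1. rewrite <- (Rmult_0_r (1 - Re s)).
        apply Rmult_le_compat_l; [lra|]. apply ln_le_sq. lra.
      + apply exp_le. assert (0 <= PI * INR K * Im e) by (apply Rmult_le_pos; [apply Rmult_le_pos|]; lra). nra. }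
  assert (B : Cmod (remprim K (RtoC (1/2) * e) - remprim K (RtoC u * e))%C
     <= 3 * c * E2 * (1/2) - 3 * c * E2 * u).
  { apply (cder_Cmod_le (fun v => remprim K (RtoC v * e)%C) (fun l => (remint K (RtoC l * e) * e)%C)
      (fun v => 3 * c * E2 * v) (fun l => 3 * c * E2)); [lra| | |].
    - intros l Hl. apply remprim_ray. lra.
    - intros l Hl. auto_derive; [easy|]. ring.
    - intros l Hl. eapply Rle_trans; [apply remint_le; lra|]. fold c.
      replace (3 * c * E2) with (c * (3 * E2)) by ring. apply Rmult_le_compat_l; [easy|].
      assert (Pl : 0 < l) by lra.
      assert (Q1 : exp (- (2 * PI * INR K * l * Im e)) <= 1).
      { apply exp_le_1. assert (0 <= 2 * PI * INR K * l * Im e); [|lra].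
        apply Rmult_le_pos; [apply Rmult_le_pos; [apply Rmult_le_pos|]|]; lra. }
      assert (Q2 : / l ^ 2 * exp ((1 - Re s) * (ln l - (l ^ 2 - 1) / 2)) <= 3 * E2).
      { replace (/ l ^ 2) with (exp (- (2 * ln l))).
        2: { rewrite exp_Ropp. f_equal. replace (2 * ln l) with (ln l + ln l) by ring.
             rewrite exp_plus, exp_ln by easy. ring. }
        rewrite <- exp_plus.
        (* The factor 1 / l^2 costs two of the 1 - Re s powers of l. With ln l <= - 3/5 and - (l^2 -
           1) / 2 <= 1/2, each remaining power gains 1/10, and the two spent ones leave the summand
           1. *)
        apply Rle_trans with (exp (1 + - ((-1 - Re s) / 10))).
        - apply exp_le.
          assert (L : ln l <= - (3 / 5)).
          { apply Rle_trans with (ln (/ 2)); [apply ln_le; lra|]. rewrite ln_Rinv by lra.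
            pose proof ln2_ge. lra. }
          assert (0 <= l ^ 2) by apply pow2_ge_0.
          nra.
        - rewrite exp_plus. apply Rmult_le_compat_r; [apply Rlt_le, PE2|apply exp_le_3]. }
      pose proof (exp_pos (- (2 * PI * INR K * l * Im e))).
      assert (0 <= / l ^ 2 * exp ((1 - Re s) * (ln l - (l ^ 2 - 1) / 2))).
      { apply Rmult_le_pos; [|apply Rlt_le, exp_pos]. apply Rlt_le, Rinv_0_lt_compat, pow_lt, Pl. }
      nra. }
  replace (remprim K (RtoC v * e) - remprim K (RtoC u * e))%C
    with ((remprim K (RtoC v * e) - remprim K (RtoC (1/2) * e))
      + (remprim K (RtoC (1/2) * e) - remprim K (RtoC u * e)))%C by ring.
  eapply Rle_trans; [apply Cmod_triangle|].
  assert (Pv : 0 < / v) by (apply Rinv_0_lt_compat; lra).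
  assert (cE1 : 0 <= c * E1) by nra. assert (cE2 : 0 <= c * E2) by nra.
  replace (Cmod (kern s e) * Cmod e / Im e) with (2 * PI * c) by (unfold c; field; lra).
  assert (2 * (c * E1) + 2 * (c * E2) <= 2 * PI * c * (E1 + E2)).
  { replace (2 * PI * c * (E1 + E2)) with (2 * PI * (c * E1) + 2 * PI * (c * E2)) by ring. nra. }
  replace (/ (1/2)) with 2 in A by field. nra.
Qed.

End Eta.

(** * Expansions of the logarithm and the exponential *)

Lemma Cmod_1_plus z : Cmod z <= 1 / 2 -> 1 / 2 <= Cmod (1 + z)%C.
Proof.
  intros H. assert (Cmod 1 <= Cmod (1 + z)%C + Cmod z).
  { replace (RtoC 1) with ((1 + z) + - z)%C at 1 by ring.
    eapply Rle_trans; [apply Cmod_triangle|]. rewrite Cmod_opp. lra. }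
  rewrite Cmod_1 in H0. lra.
Qed.

Lemma Re_1_plus z : Cmod z <= 1 / 2 -> 0 < Re (1 + z)%C.
Proof.
  intros H. rewrite re_plus. simpl. pose proof (re_le_Cmod z) as B. apply Rabs_le_between in B. lra.
Qed.

(** Along v z the remainder has derivative z^3 v^2 / (1 + v z), whose denominator is at least 1/2 in
    modulus; integrating 2 |z|^3 v^2 gives 2/3. *)
Lemma CLog_1_plus z : Cmod z <= 1 / 2 ->
  Cmod (CLog (1 + z) - (z - z * z / 2))%C <= 2 / 3 * Cmod z ^ 3.
Proof.
  intros H. pose proof (Cmod_ge_0 z) as Hz.
  pose (F := fun v : R => (CLog (1 + RtoC v * z) - (RtoC v * z - RtoC v * RtoC v * (z * z / 2)))%C).
  pose proof (cder_Cmod_le F (fun v => (RtoC v * RtoC v * (z * z * z) / (1 + RtoC v * z))%C)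
    (fun v => 2 / 3 * Cmod z ^ 3 * v ^ 3) (fun v => 2 * Cmod z ^ 3 * v ^ 2) 0 1) as K.
  assert (Hv : forall v, 0 <= v <= 1 -> Cmod (RtoC v * z)%C <= 1 / 2).
  { intros v Hv. rewrite Cmod_mult, Cmod_R, Rabs_pos_eq by lra. nra. }
  unfold F in K. cbv beta in K.
  replace (CLog (1 + z) - (z - z * z / 2))%C with
   (CLog (1 + RtoC 1 * z) - (RtoC 1 * z - RtoC 1 * RtoC 1 * (z * z / 2)) -
      (CLog (1 + RtoC 0 * z) - (RtoC 0 * z - RtoC 0 * RtoC 0 * (z * z / 2))))%C.
  - eapply Rle_trans; [apply K|]; [lra| | | |].
    + intros u Hu. pose proof (Re_1_plus _ (Hv u Hu)) as Rp.
      assert (N : (1 + RtoC u * z)%C <> 0%C) by (apply slit_neq0; now left).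
      eapply cder_eq.
      * apply cder_minus; [apply cder_log; [apply cder_affine|now left]|].
        apply cder_minus; [apply cder_scal_r, cder_id|].
        apply cder_scal_r, cder_mult; apply cder_id.
      * cbv beta. field. exact N.
    + intros u Hu. auto_derive; [easy|field].
    + intros u Hu. pose proof (Re_1_plus _ (Hv u Hu)) as Rp.
      assert (N : (1 + RtoC u * z)%C <> 0%C) by (apply slit_neq0; now left).
      rewrite Cmod_div, !Cmod_mult, Cmod_R, Rabs_pos_eq by (easy || lra).
      pose proof (Cmod_1_plus _ (Hv u Hu)) as L.
      apply Rmult_le_reg_r with (Cmod (1 + RtoC u * z)%C); [lra|].
      unfold Rdiv. rewrite Rmult_assoc, Rinv_l, Rmult_1_r by lra.
      assert (0 <= Cmod z ^ 3 * u ^ 2) by (apply Rmult_le_pos; apply pow_le; lra). nra.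
    + right. ring.
  - replace (1 + RtoC 0 * z)%C with (RtoC 1) by ring. rewrite CLog_RtoC, ln_1 by lra.
    replace (1 + RtoC 1 * z)%C with (1 + z)%C by ring. ring.
Qed.

Lemma Cexp_sub_1 w : Cmod (Cexp w - 1)%C <= Cmod w * exp (Cmod w).
Proof.
  pose proof (cder_Cmod_le (fun v => Cexp (RtoC v * w)) (fun v => (Cexp (RtoC v * w) * w)%C)
    (fun v => Cmod w * exp (Cmod w) * v) (fun v => Cmod w * exp (Cmod w)) 0 1) as K.
  cbv beta in K.
  replace (RtoC 0 * w)%C with (RtoC 0) in K by ring. rewrite Cexp_0 in K.
  replace (RtoC 1 * w)%C with w in K by ring.
  eapply Rle_trans; [apply K|]; [lra| | | |].
  - intros u _. apply cder_exp. eapply cder_eq; [apply cder_scal_r, cder_id|ring].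
  - intros u _. auto_derive; [easy|ring].
  - intros u Hu. rewrite Cmod_mult, Cmod_Cexp, Rmult_comm.
    apply Rmult_le_compat_l; [apply Cmod_ge_0|]. apply exp_le.
    rewrite re_scal_l. pose proof (Re_le_Cmod w). pose proof (Cmod_ge_0 w). nra.
  - right. ring.
Qed.

(** * The Gaussian integral *)

(** The scale comes from 2 pi i (r (1 + i))^2 = - 4 pi r^2; the integral over the whole line is then
    1/2. *)
Definition gauss (x : R) : R := RInt (fun r => exp (- (4 * PI * r ^ 2))) 0 x.

Lemma gauss_cont r : continuous (fun r => exp (- (4 * PI * r ^ 2))) r.
Proof.
  eapply is_derive_continuous_R. auto_derive; easy.
Qed.

Lemma gauss_ex a b : ex_RInt (fun r => exp (- (4 * PI * r ^ 2))) a b.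
Proof. apply (ex_RInt_continuous (V := R_CompleteNormedModule)). intros; apply gauss_cont. Qed.

Lemma gauss_der x : is_derive gauss x (exp (- (4 * PI * x ^ 2))).
Proof.
  apply (is_derive_RInt (V := R_NormedModule) (fun r => exp (- (4 * PI * r ^ 2))) gauss 0 x).
  - apply filter_forall. intros y. apply (RInt_correct (V := R_CompleteNormedModule)), gauss_ex.
  - apply gauss_cont.
Qed.

(** With fixed limits of integration, oddness is immediate and the derivative of [gaussG] becomes
    recognisable as a multiple of [gauss]. *)
Lemma gauss_scale x : gauss x = x * RInt (fun t => exp (- (4 * PI * (x * t) ^ 2))) 0 1.
Proof.
  unfold gauss.
  pose proof (RInt_comp_lin (V := R_CompleteNormedModule) (fun r => exp (- (4 * PI * r ^ 2))) x 0 0 1) as H.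
  replace (x * 0 + 0) with 0 in H by ring. replace (x * 1 + 0) with x in H by ring.
  rewrite <- H by apply gauss_ex.
  rewrite (RInt_scal (V := R_CompleteNormedModule)).
  - change (scal x) with (Rmult x). f_equal. apply RInt_ext. intros t _. now rewrite Rplus_0_r.
  - apply (ex_RInt_continuous (V := R_CompleteNormedModule)). intros t _.
    eapply is_derive_continuous_R. auto_derive; easy.
Qed.

Lemma gauss_odd x : gauss (- x) = - gauss x.
Proof.
  rewrite !gauss_scale, Ropp_mult_distr_l_reverse. f_equal. f_equal.
  apply RInt_ext. intros t _. f_equal. ring.
Qed.

(* Classical companion: [4 PI gauss^2 + gaussG] has derivative zero. *)
Definition gaussG (x : R) : R :=
  RInt (fun t => exp (- (4 * PI * x ^ 2 * (1 + t ^ 2))) / (1 + t ^ 2)) 0 1.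

Lemma gaussG_der x : is_derive gaussG x (- (8 * PI) * exp (- (4 * PI * x ^ 2)) * gauss x).
Proof.
  assert (Dx : forall y t, is_derive (fun u => exp (- (4 * PI * u ^ 2 * (1 + t ^ 2))) / (1 + t ^ 2)) y
     (- (8 * PI * y) * exp (- (4 * PI * y ^ 2 * (1 + t ^ 2))))).
  { intros y t. auto_derive; [nra|]. simpl pow. field. nra. }
  replace (- (8 * PI) * exp (- (4 * PI * x ^ 2)) * gauss x)
    with (RInt (fun t => Derive (fun u => exp (- (4 * PI * u ^ 2 * (1 + t ^ 2))) / (1 + t ^ 2)) x) 0 1).
  - apply (is_derive_RInt_param (fun x t => exp (- (4 * PI * x ^ 2 * (1 + t ^ 2))) / (1 + t ^ 2)) 0 1 x).
    + apply filter_forall. intros y t _. eexists. apply Dx.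
    + intros t _. apply continuity_2d_pt_filterlim.
      change (continuous (fun p : R * R => Derive (fun v => exp (- (4 * PI * v ^ 2 * (1 + snd p ^ 2)))
         / (1 + snd p ^ 2)) (fst p)) (x, t)).
      apply (continuous_ext (fun p : R * R => - (8 * PI * fst p) * exp (- (4 * PI * fst p ^ 2 * (1 + snd p ^ 2))))).
      { intros p. symmetry. apply is_derive_unique, Dx. }
      destruct (ccont_R2 (x, t)) as [[C1 _] [C3 _]]. simpl in C1, C3.
      apply continuous_Rmult.
      * apply continuous_Ropp, continuous_Rmult; [apply continuous_const|exact C1].
      * apply (continuous_Rcomp exp); [|apply derivable_continuous_pt, derivable_pt_exp].
        apply continuous_Ropp, continuous_Rmult.
        -- apply continuous_Rmult; [apply continuous_const|]. now apply continuous_pow2.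
        -- apply continuous_Rplus; [apply continuous_const|]. now apply continuous_pow2.
    + apply filter_forall. intros y. apply (ex_RInt_continuous (V := R_CompleteNormedModule)).
      intros t _. eapply is_derive_continuous_R. auto_derive; [nra|reflexivity].
  - rewrite gauss_scale.
    rewrite (RInt_ext _ (fun t => scal (- (8 * PI) * exp (- (4 * PI * x ^ 2)) * x) (exp (- (4 * PI * (x * t) ^ 2))))).
    + rewrite (RInt_scal (V := R_CompleteNormedModule)).
      * change scal with Rmult. Req. ring.
      * apply (ex_RInt_continuous (V := R_CompleteNormedModule)). intros t _.
        eapply is_derive_continuous_R. auto_derive; easy.
    + intros t _. etransitivity; [exact (is_derive_unique _ _ _ (Dx x t))|]. change scal with Rmult.
      replace (- (4 * PI * x ^ 2 * (1 + t ^ 2))) with (- (4 * PI * x ^ 2) + - (4 * PI * (x * t) ^ 2)) by ring.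
      rewrite exp_plus. Req. ring.
Qed.

Lemma gaussG_0 : gaussG 0 = PI / 4.
Proof.
  unfold gaussG. rewrite <- atan_1.
  replace (atan 1) with (atan 1 - atan 0) by (rewrite atan_0; ring).
  apply is_RInt_unique.
  apply (is_RInt_ext (fun t => / (1 + t²))).
  - intros t _. replace (- (4 * PI * 0 ^ 2 * (1 + t ^ 2))) with 0 by ring. rewrite exp_0.
    unfold Rsqr. Req. field. nra.
  - apply (is_RInt_derive (V := R_CompleteNormedModule) atan (fun t => / (1 + t²))).
    + intros t _. apply is_derive_atan.
    + intros t _. eapply is_derive_continuous_R. unfold Rsqr. auto_derive; [nra|reflexivity].
Qed.

Lemma gauss_0 : gauss 0 = 0.
Proof. rewrite gauss_scale. ring. Qed.

Lemma gauss_sq x : 0 <= x -> 4 * PI * gauss x ^ 2 + gaussG x = PI / 4.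
Proof.
  intros Hx. rewrite <- gaussG_0.
  replace (gaussG 0) with (4 * PI * gauss 0 ^ 2 + gaussG 0) by (rewrite gauss_0; ring).
  (* Taking k = 1 and k = -1 turns the one-sided monotonicity criterion into constancy. *)
  assert (E : forall k, k * (4 * PI * gauss x ^ 2 + gaussG x) <= k * (4 * PI * gauss 0 ^ 2 + gaussG 0)).
  { intros k. apply (derive_nonpos_le (fun x => k * (4 * PI * gauss x ^ 2 + gaussG x)) (fun _ => 0)); [easy| |intros; lra].
    intros u _. pose proof (gauss_der u) as D1. pose proof (gaussG_der u) as D2.
    eapply is_derive_eq.
    - apply is_derive_scal, isd_plus; [apply is_derive_scal, is_derive_pow, D1|exact D2].
    - simpl. ring. }
  pose proof (E 1). pose proof (E (-1)). lra.
Qed.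

(** [gauss_sq] factors as 4 pi (gauss - 1/4) (gauss + 1/4) = - gaussG. Since gauss >= 0, the factor
    4 pi (gauss + 1/4) is at least 1, so the error is at most gaussG <= exp (- 4 pi x^2). The rate 1
    / x is all that the saddle estimate, of relative size 1 / |e|, asks for. *)
Lemma gauss_limit x : 1 <= x -> Rabs (gauss x - 1 / 4) <= / x.
Proof.
  intros Hx. pose proof PI_RGT_0 as HPI. pose proof PI2_1.
  assert (G0 : 0 <= gauss x).
  { rewrite <- gauss_0. apply Ropp_le_cancel.
    apply (derive_nonpos_le (fun x => - gauss x) (fun x => - exp (- (4 * PI * x ^ 2)))); [lra| |].
    - intros u _. apply isd_opp, gauss_der.
    - intros u _. pose proof (exp_pos (- (4 * PI * u ^ 2))). lra. }
  assert (GG : 0 <= gaussG x <= exp (- (4 * PI * x ^ 2))).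
  { assert (I : ex_RInt (fun t => exp (- (4 * PI * x ^ 2 * (1 + t ^ 2))) / (1 + t ^ 2)) 0 1).
    { apply (ex_RInt_continuous (V := R_CompleteNormedModule)).
      intros t _. eapply is_derive_continuous_R. auto_derive; [nra|reflexivity]. }
    assert (P : forall t, 0 < / (1 + t ^ 2)) by (intros; apply Rinv_0_lt_compat; nra).
    split.
    - unfold gaussG. apply RInt_ge_0; [lra|exact I|]. intros t _.
      apply Rmult_le_pos; apply Rlt_le; [apply exp_pos|apply P].
    - replace (exp (- (4 * PI * x ^ 2))) with (RInt (fun _ : R => exp (- (4 * PI * x ^ 2))) 0 1).
      + apply RInt_le; [lra|exact I|apply ex_RInt_const|]. intros t _.
        rewrite <- (Rmult_1_r (exp (- (4 * PI * x ^ 2)))).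
        apply Rmult_le_compat.
        * apply Rlt_le, exp_pos.
        * apply Rlt_le, P.
        * apply exp_le. assert (0 <= 4 * PI * x ^ 2 * t ^ 2); [|lra].
          apply Rmult_le_pos; [|apply pow2_ge_0]. apply Rmult_le_pos; [lra|apply pow2_ge_0].
        * rewrite <- Rinv_1 at 2. apply Rinv_le_contravar; nra.
      + rewrite RInt_const. change ((1 - 0) * exp (- (4 * PI * x ^ 2)) = exp (- (4 * PI * x ^ 2))).
        rewrite Rminus_0_r, Rmult_1_l. reflexivity. }
  pose proof (gauss_sq x ltac:(lra)) as E.
  assert (B : exp (- (4 * PI * x ^ 2)) <= / x).
  { eapply Rle_trans; [apply exp_neg_le; nra|]. apply Rinv_le_contravar; nra. }
  assert (F : 4 * PI * (gauss x - 1 / 4) * (gauss x + 1 / 4) = - gaussG x) by nra.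
  set (y := gauss x - 1 / 4) in *. replace (gauss x + 1 / 4) with (y + 1 / 2) in F by (unfold y; lra).
  assert (Y : - (1 / 4) <= y) by (unfold y; lra).
  assert (- gaussG x <= y <= 0).
  { assert (Hy : y <= 0) by nra. split; [|easy]. 
    assert (4 * PI * (y + 1/2) >= 1) by nra. nra. }
  apply Rabs_le. lra.
Qed.

Lemma PI_lt_4 : PI <= 4.
Proof. pose proof PI_4. lra. Qed.

Lemma PI_gt_2 : 2 < PI.
Proof. pose proof PI2_1. lra. Qed.

(** * Saddle-point asymptotics *)

(* The contour of the [m]-th term consists of the ray from 0 to [p (- d)], the
   segment [p (- d), p d] of direction [1 + Ci] through [e - m / 4], and the ray
   from [p d] to infinity. Shifting the saddle [e] by [- m / 4] turns
   [2 PI Ci y^2 + PI Ci m y] into a real Gaussian times the phase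
   [exp (- PI Ci m^2 / 8)]; on the line through [e] itself the modulus of the
   integrand would exceed that of the integral by [exp (PI m^2 / 16)]. *)
Section SaddlePoint.
Variables (s e : C) (m : R).
Hypothesis Hs : (s - 1 = 2 * RtoC PI * Ci * e * e)%C.
Hypothesis Hb : 0 < Im e.
Hypothesis Hab : Im e < Re e.
Hypothesis Hre : Re s <= -1.
Hypothesis Hm : 1 <= m.
Hypothesis Hm3 : m ^ 3 <= Re e.
Hypothesis Ha : 10 ^ 6 <= Re e.

Let a := Re e.
Let rho := Cmod e.
(** Half the range of r on the central segment: short enough that |y r / e| <= 1/2 and the cubic
    error stays below the Gaussian, long enough that the ends are exponentially small in a^2. *)
Let d := a / 100.
Let base : C := (kern s e * Cexp (RtoC PI * Ci * RtoC m * e) * Cexp (- (RtoC PI * Ci * RtoC (m ^ 2 / 8))))%C.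
Let y (r : R) : C := (RtoC (- (m / 4)) + RtoC r * (1 + Ci))%C.

Lemma m_le : 10 ^ 4 * m <= a.
Proof.
  unfold a. destruct (Rle_dec m 100).
  - lra.
  - assert (m ^ 3 = m * (m * m)) by ring. assert (10^4 <= m * m) by nra. nra.
Qed.

Lemma rho_bounds : a <= rho <= 2 * a.
Proof.
  unfold a, rho. split; [apply Re_le_Cmod|].
  eapply Rle_trans; [apply Cmod_le_abs|]. rewrite !Rabs_pos_eq by lra. lra.
Qed.

Lemma y_le r : Cmod (y r) <= m / 4 + 2 * Rabs r.
Proof.
  unfold y. eapply Rle_trans; [apply Cmod_triangle|].
  rewrite Cmod_R, Rabs_Ropp, Rabs_pos_eq by lra. rewrite Cmod_mult, Cmod_R.
  assert (Cmod (1 + Ci)%C <= 2).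
  { eapply Rle_trans; [apply Cmod_triangle|]. rewrite Cmod_1, Cmod_Ci. lra. }
  pose proof (Rabs_pos r). nra.
Qed.

Lemma Arg_e : 0 < Arg e < PI / 2.
Proof.
  pose proof (Arg_up_bound e Hb). pose proof (Arg_right_bound e ltac:(lra)). lra.
Qed.

Let zeta r : C := (y r / e)%C.

Lemma e_neq0 : e <> 0%C.
Proof. apply slit_neq0. left. lra. Qed.

Lemma rho_pos : 0 < rho.
Proof. pose proof rho_bounds. unfold a in *. lra. Qed.

Lemma zeta_mod r : Cmod (zeta r) = Cmod (y r) / rho.
Proof. unfold zeta. apply Cmod_div, e_neq0. Qed.

Lemma zeta_le r : Rabs r <= d -> Cmod (zeta r) <= 1 / 2.
Proof.
  intros Hr. rewrite zeta_mod. pose proof (y_le r). pose proof rho_bounds. pose proof rho_pos.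
  pose proof m_le.
  apply Rmult_le_reg_r with rho; [easy|]. unfold Rdiv. rewrite Rmult_assoc, Rinv_l by lra.
  unfold d in Hr. lra.
Qed.

Let E3 r : C := (CLog (1 + zeta r) - (zeta r - zeta r * zeta r / 2))%C.
Let w r : C := (- (2 * RtoC PI * Ci * e * e * E3 r))%C.

(** Expanding log (1 + zeta) to second order, the terms linear in y that do not involve m cancel
    because e is the saddle point, and the quadratic ones add up to 2 pi i y^2. The cubic remainder
    is put into [w]; the denominator 1 + zeta comes from the exponent - s = - (s - 1) - 1. *)
Lemma gint_shift r : Rabs r <= d ->
  gint s m (e + y r)%C = (base * RtoC (exp (- (4 * PI * r ^ 2))) * (Cexp (w r) / (1 + zeta r)))%C.
Proof.
  intros Hr. pose proof (Re_1_plus _ (zeta_le r Hr)) as Rp.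
  assert (L : CLog (e + y r)%C = (CLog e + CLog (1 + zeta r))%C).
  { rewrite <- CLog_mult.
    - f_equal. unfold zeta. field. apply e_neq0.
    - left; lra.
    - now left.
    - pose proof Arg_e. pose proof (Arg_right_bound _ Rp). lra. }
  assert (I : (/ (1 + zeta r) = Cexp (- CLog (1 + zeta r)))%C).
  { rewrite Cexp_opp, Cexp_CLog; [easy|now left]. }
  unfold Cdiv. rewrite I. rewrite <- Cexp_RtoC.
  unfold gint, base, kern, Cpowc. rewrite L. rewrite <- !Cexp_plus. f_equal.
  assert (S : (- s = - (2 * RtoC PI * Ci * e * e) - 1)%C) by (rewrite <- Hs; ring).
  unfold w.
  assert (LE : CLog (1 + zeta r)%C = (E3 r + (zeta r - zeta r * zeta r / 2))%C) by (unfold E3; ring).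
  rewrite S, LE. generalize (E3 r). intros X. generalize (CLog e). intros Y.
  (* Completing the square: the shift by - m / 4 in [y] removes the term linear in r and leaves only
     the phase. *)
  assert (V : (2 * RtoC PI * Ci * y r * y r + RtoC PI * Ci * RtoC m * y r
     = - (RtoC PI * Ci * RtoC (m ^ 2 / 8)) + RtoC (- (4 * PI * r ^ 2)))%C).
  { unfold y. apply C_ext; simpl; unfold Re, Im; simpl; field. }
  unfold zeta. pose proof e_neq0 as NE. clear L LE I Rp S.
  revert V. generalize (y r). intros Z V.
  transitivity ((- (2 * RtoC PI * Ci * e * e) - 1) * Y + RtoC PI * Ci * e * e + RtoC PI * Ci * RtoC m * e
     - (2 * RtoC PI * Ci * e * e) * X - (X + (Z / e - Z / e * (Z / e) / 2))
     + (2 * RtoC PI * Ci * Z * Z + RtoC PI * Ci * RtoC m * Z))%C.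
  - field. easy.
  - rewrite V. ring.
Qed.

Lemma w_le r : Rabs r <= d -> Cmod (w r) <= 6 * Cmod (y r) ^ 3 / rho.
Proof.
  intros Hr. pose proof (CLog_1_plus _ (zeta_le r Hr)) as H. fold (E3 r) in H.
  pose proof PI_lt_4. pose proof PI_gt_2. pose proof rho_pos.
  unfold w. rewrite Cmod_opp, !Cmod_mult, Cmod_Ci, !Cmod_R, !Rabs_pos_eq by lra. fold rho.
  rewrite zeta_mod in H.
  replace ((Cmod (y r) / rho) ^ 3) with (Cmod (y r) ^ 3 / rho ^ 3) in H by (field; lra).
  set (Y := Cmod (y r) ^ 3) in *.
  assert (HY : 0 <= Y) by (apply pow_le, Cmod_ge_0).
  assert (P : 0 <= 2 * PI * rho * rho) by (repeat (apply Rmult_le_pos; [|lra]); lra).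
  replace (2 * PI * 1 * rho * rho * Cmod (E3 r)) with (2 * PI * rho * rho * Cmod (E3 r)) by ring.
  eapply Rle_trans; [apply Rmult_le_compat_l; [exact P|exact H]|].
  replace (2 * PI * rho * rho * (2 / 3 * (Y / rho ^ 3))) with (4 / 3 * PI * (Y / rho)) by (field; lra).
  assert (0 <= Y / rho) by (apply Rmult_le_pos; [easy|apply Rlt_le, Rinv_0_lt_compat; easy]).
  replace (6 * Y / rho) with (6 * (Y / rho)) by (field; lra). nra.
Qed.

Lemma rho_inv_pos : 0 < / rho.
Proof. apply Rinv_0_lt_compat, rho_pos. Qed.

Lemma m3_rho : m ^ 3 * / rho <= 1.
Proof.
  pose proof rho_bounds. pose proof rho_pos. apply Rmult_le_reg_r with rho; [easy|].
  rewrite Rmult_assoc, Rinv_l by lra. unfold a in *. lra.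
Qed.

(** On the segment |r| / |e| <= 1/100 trades one power of r in the cubic bound for a small constant,
    and m^3 <= |e| bounds the part coming from the shift. Thus exp |w| loses at most exp (2 r^2)
    against the Gaussian. *)
Lemma w_le1 r : Rabs r <= d -> Cmod (w r) <= 1 + 2 * r ^ 2.
Proof.
  intros Hr. eapply Rle_trans; [now apply w_le|].
  pose proof (y_le r) as Hy. pose proof rho_inv_pos as Hi. pose proof m3_rho as H3.
  pose proof (Rabs_pos r) as Hr0. pose proof rho_bounds. pose proof rho_pos.
  assert (Y3 : Cmod (y r) ^ 3 <= m ^ 3 / 16 + 32 * (r ^ 2 * Rabs r)).
  { apply Rle_trans with ((m / 4 + 2 * Rabs r) ^ 3).
    - apply pow_incr. split; [apply Cmod_ge_0|easy].
    - rewrite <- (pow2_abs r). set (x := m / 4). set (z := 2 * Rabs r).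
      replace (m ^ 3 / 16) with (4 * x ^ 3) by (unfold x; field).
      replace (32 * (Rabs r ^ 2 * Rabs r)) with (4 * z ^ 3) by (unfold z; ring).
      assert (0 <= x) by (unfold x; lra). assert (0 <= z) by (unfold z; lra).
      assert (0 <= (x + z) * (x - z) ^ 2) by (apply Rmult_le_pos; [lra|apply pow2_ge_0]). nra. }
  assert (D : Rabs r * / rho <= / 100).
  { apply Rmult_le_reg_r with rho; [easy|]. rewrite Rmult_assoc, Rinv_l by lra.
    unfold d in Hr. lra. }
  unfold Rdiv. rewrite Rmult_assoc.
  apply Rle_trans with (6 * ((m ^ 3 / 16 + 32 * (r ^ 2 * Rabs r)) * / rho)).
  - apply Rmult_le_compat_l; [lra|]. apply Rmult_le_compat_r; lra.
  - replace (6 * ((m ^ 3 / 16 + 32 * (r ^ 2 * Rabs r)) * / rho))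
      with (6 / 16 * (m ^ 3 * / rho) + 192 * (r ^ 2 * (Rabs r * / rho))) by (field; lra).
    assert (0 <= r ^ 2) by apply pow2_ge_0.
    assert (r ^ 2 * (Rabs r * / rho) <= r ^ 2 * / 100) by (now apply Rmult_le_compat_l). lra.
Qed.

Lemma exp_w r : Rabs r <= d -> exp (Cmod (w r)) <= 3 * exp (2 * r ^ 2).
Proof.
  intros Hr. eapply Rle_trans; [apply exp_le, w_le1, Hr|]. rewrite exp_plus.
  apply Rmult_le_compat_r; [apply Rlt_le, exp_pos|apply exp_le_3].
Qed.

(** The weight 1 / (1 + r^2) is chosen for its primitive [atan]. The Gaussian provides exp (- 8
    r^2); of this, exp |w| uses up exp (2 r^2), and the cubic growth together with the weight uses
    up exp (3 r^2). *)
Lemma saddle_error r : Rabs r <= d ->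
  exp (- (4 * PI * r ^ 2)) * Cmod (Cexp (w r) / (1 + zeta r) - 1)%C <= 2400 * (m ^ 3 * / rho) * / (1 + r ^ 2).
Proof.
  intros Hr. pose proof (Cmod_1_plus _ (zeta_le r Hr)) as L.
  assert (N : (1 + zeta r)%C <> 0%C) by (apply slit_neq0; left; apply Re_1_plus, zeta_le, Hr).
  pose proof rho_inv_pos as Hi. pose proof (Rabs_pos r) as Hr0.
  set (v := 1 + Rabs r).
  assert (Hv : 1 <= v) by (unfold v; lra).
  assert (Hy : Cmod (y r) <= 2 * m * v) by (pose proof (y_le r); unfold v; nra).
  pose proof (Cmod_ge_0 (y r)) as Hy0.
  assert (Hm1 : 1 <= m ^ 2) by nra.
  assert (Hv1 : 1 <= v ^ 2) by nra.
  set (X := m ^ 3 * v ^ 3 * / rho).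
  assert (HX : 0 <= X).
  { unfold X. apply Rmult_le_pos; [|lra]. apply Rmult_le_pos; apply pow_le; lra. }
  assert (HW : Cmod (w r) <= 48 * X).
  { eapply Rle_trans; [now apply w_le|]. unfold Rdiv, X.
    replace (48 * (m ^ 3 * v ^ 3 * / rho)) with (6 * (2 * m * v) ^ 3 * / rho) by ring.
    apply Rmult_le_compat_r; [lra|]. apply Rmult_le_compat_l; [lra|]. apply pow_incr. lra. }
  assert (HZ : Cmod (zeta r) <= 2 * X).
  { rewrite zeta_mod. unfold Rdiv, X.
    replace (2 * (m ^ 3 * v ^ 3 * / rho)) with (2 * m * v * (m ^ 2 * v ^ 2) * / rho) by ring.
    apply Rmult_le_compat_r; [lra|].
    assert (1 <= m ^ 2 * v ^ 2) by nra. assert (0 <= m * v) by nra. nra. }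
  set (G := exp (2 * r ^ 2)).
  assert (HG : 1 <= G) by (unfold G; rewrite <- exp_0; apply exp_le; nra).
  assert (HE : Cmod (Cexp (w r) / (1 + zeta r) - 1)%C <= 300 * X * G).
  { replace (Cexp (w r) / (1 + zeta r) - 1)%C with (((Cexp (w r) - 1) + - zeta r) / (1 + zeta r))%C
      by (field; exact N).
    rewrite Cmod_div by exact N.
    assert (B : Cmod (Cexp (w r) - 1 + - zeta r)%C <= 150 * X * G).
    { eapply Rle_trans; [apply Cmod_triangle|]. rewrite Cmod_opp.
      pose proof (Cexp_sub_1 (w r)) as C1. pose proof (exp_w r Hr) as C3. fold G in C3.
      pose proof (Cmod_ge_0 (w r)).
      assert (Cmod (w r) * exp (Cmod (w r)) <= 48 * X * (3 * G)).
      { apply Rmult_le_compat; try easy. apply Rlt_le, exp_pos. }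
      nra. }
    apply Rmult_le_reg_r with (Cmod (1 + zeta r)%C); [lra|].
    unfold Rdiv. rewrite Rmult_assoc, Rinv_l, Rmult_1_r by lra.
    assert (0 <= X * G) by nra. nra. }
  set (r2 := r ^ 2) in *.
  assert (Hr2 : 0 <= r2) by apply pow2_ge_0.
  assert (Gau : exp (- (4 * PI * r2)) <= exp (- (8 * r2))).
  { apply exp_le. pose proof PI_gt_2. nra. }
  assert (V3 : v ^ 3 * (1 + r2) <= 4 * exp (3 * r2)).
  { assert (v ^ 2 <= 2 * (1 + r2)).
    { unfold v, r2. rewrite <- (pow2_abs r). pose proof (pow2_ge_0 (1 - Rabs r)). nra. }
    assert (v ^ 3 <= 4 * (1 + r2) ^ 2) by (assert (v ^ 3 <= v ^ 2 * v ^ 2) by nra; nra).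
    apply Rle_trans with (4 * (1 + r2) ^ 3).
    - replace (4 * (1 + r2) ^ 3) with (4 * (1 + r2) ^ 2 * (1 + r2)) by ring.
      apply Rmult_le_compat_r; lra.
    - apply Rmult_le_compat_l; [lra|].
      replace (exp (3 * r2)) with (exp r2 ^ 3).
      + apply pow_incr. pose proof (exp_ineq1_le r2). lra.
      + replace (3 * r2) with (r2 + (r2 + r2)) by ring. rewrite !exp_plus. ring. }
  apply Rmult_le_reg_r with (1 + r2); [lra|].
  rewrite (Rmult_assoc _ (/ (1 + r2))), Rinv_l, Rmult_1_r by lra.
  apply Rle_trans with (exp (- (8 * r2)) * (300 * X * G) * (1 + r2)).
  - apply Rmult_le_compat_r; [lra|]. apply Rmult_le_compat; try easy; [apply Rlt_le, exp_pos|apply Cmod_ge_0].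
  - unfold X.
    replace (exp (- (8 * r2)) * (300 * (m ^ 3 * v ^ 3 * / rho) * G) * (1 + r2))
      with (300 * (m ^ 3 * / rho) * ((v ^ 3 * (1 + r2)) * (exp (- (8 * r2)) * G))) by ring.
    assert (0 <= m ^ 3 * / rho) by (apply Rmult_le_pos; [apply pow_le|]; lra).
    assert ((v ^ 3 * (1 + r2)) * (exp (- (8 * r2)) * G) <= 8).
    { apply Rle_trans with (4 * exp (3 * r2) * (exp (- (8 * r2)) * G)).
      - apply Rmult_le_compat_r; [|easy]. apply Rmult_le_pos; [apply Rlt_le, exp_pos|lra].
      - replace (4 * exp (3 * r2) * (exp (- (8 * r2)) * G)) with (4 * (exp (3 * r2) * exp (- (8 * r2)) * G)) by ring.
        unfold G. rewrite <- !exp_plus.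
        assert (exp (3 * r2 + - (8 * r2) + 2 * r2) <= 1) by (apply exp_le_1; nra). lra. }
    nra.
Qed.

Lemma base_pos : 0 <= Cmod base.
Proof. apply Cmod_ge_0. Qed.

Let p (r : R) : C := (e + y r)%C.

Lemma p_Re r : Re (p r) = a - m / 4 + r.
Proof. unfold p, y, a. simpl. unfold Re. ring. Qed.

Lemma p_Im r : Im (p r) = Im e + r.
Proof. unfold p, y. simpl. unfold Im. ring. Qed.

Lemma d_pos : 10 ^ 4 <= d.
Proof. unfold d. unfold a. lra. Qed.

Lemma p_slit r : Rabs r <= d -> slit (p r).
Proof.
  intros Hr. left. rewrite p_Re. apply Rabs_le_between in Hr. pose proof m_le. unfold d in Hr. lra.
Qed.

Lemma middle_part :
  Cmod (gprim s m (p d) - gprim s m (p (- d)) - base * (1 + Ci) * RtoC (gauss d - gauss (- d)))%C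
   <= 19200 * (Cmod base * (m ^ 3 * / rho)).
Proof.
  pose proof d_pos as Hd. pose proof base_pos as HB. pose proof rho_inv_pos as Hi.
  set (k := Cmod base * (m ^ 3 * / rho)).
  assert (Hk : 0 <= k).
  { unfold k. apply Rmult_le_pos; [easy|]. apply Rmult_le_pos; [apply pow_le|]; lra. }
  pose (F := fun r : R => (gprim s m (p r) - base * (1 + Ci) * RtoC (gauss r))%C).
  replace (gprim s m (p d) - gprim s m (p (- d)) - base * (1 + Ci) * RtoC (gauss d - gauss (- d)))%C
    with (F d - F (Ropp d))%C by (unfold F; rewrite RtoC_minus; ring).
  eapply Rle_trans.
  - apply (cder_Cmod_le F
      (fun r => (gint s m (p r) * (1 + Ci) - base * (1 + Ci) * RtoC (exp (- (4 * PI * r ^ 2))))%C)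
      (fun r => 4800 * k * atan r) (fun r => 4800 * k * / (1 + r ^ 2))); [lra| | |].
    + intros r Hr. apply cder_minus.
      * assert (Sr : slit (e + RtoC (- (m / 4)) + RtoC r * (1 + Ci))%C).
        { rewrite <- Cplus_assoc. apply p_slit. now apply Rabs_le. }
        apply (cder_ext (fun r => gprim s m (e + RtoC (- (m / 4)) + RtoC r * (1 + Ci))%C)).
        { intros v. unfold p, y. f_equal. ring. }
        eapply cder_eq; [apply (hol_line slit); [apply hol_gprim|exact Sr]|].
        unfold p, y. f_equal. f_equal. ring.
      * apply cder_scal, cder_RtoC, gauss_der.
    + intros r _. auto_derive; [easy|]. unfold Rsqr. field. nra.
    + intros r Hr.
      assert (Hr' : Rabs r <= d) by now apply Rabs_le.
      unfold p. rewrite gint_shift by easy.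
      replace (base * RtoC (exp (- (4 * PI * r ^ 2))) * (Cexp (w r) / (1 + zeta r)) * (1 + Ci)
         - base * (1 + Ci) * RtoC (exp (- (4 * PI * r ^ 2))))%C
        with (base * ((1 + Ci) * (RtoC (exp (- (4 * PI * r ^ 2))) * (Cexp (w r) / (1 + zeta r) - 1))))%C by ring.
      rewrite !Cmod_mult, Cmod_R, (Rabs_pos_eq (exp _)) by apply Rlt_le, exp_pos.
      pose proof (saddle_error r Hr') as SE.
      assert (C2i : Cmod (1 + Ci)%C <= 2).
      { eapply Rle_trans; [apply Cmod_triangle|]. rewrite Cmod_1, Cmod_Ci. lra. }
      replace (4800 * k * / (1 + r ^ 2)) with (Cmod base * (2 * (2400 * (m ^ 3 * / rho) * / (1 + r ^ 2))))
        by (unfold k; ring).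
      apply Rmult_le_compat_l; [easy|]. apply Rmult_le_compat; try easy; [apply Cmod_ge_0|].
      apply Rmult_le_pos; [apply Rlt_le, exp_pos|apply Cmod_ge_0].
  (* The two arctangents differ by less than PI <= 4, and 4 * 4800 = 19200. *)
  - pose proof (atan_bound d). pose proof (atan_bound (- d)). pose proof PI_lt_4. nra.
Qed.

Lemma edge_le r : Rabs r = d -> Cmod (gint s m (p r)) <= 6 * (Cmod base * exp (- (6 * d ^ 2))).
Proof.
  intros Hr. assert (Hr' : Rabs r <= d) by lra.
  unfold p. rewrite gint_shift by easy.
  assert (N : (1 + zeta r)%C <> 0%C) by (apply slit_neq0; left; apply Re_1_plus, zeta_le, Hr').
  pose proof (Cmod_1_plus _ (zeta_le r Hr')) as L.
  rewrite !Cmod_mult, Cmod_R, (Rabs_pos_eq (exp _)), Cmod_div by (exact N || apply Rlt_le, exp_pos).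
  rewrite Rmult_assoc. replace (6 * (Cmod base * exp (- (6 * d ^ 2)))) with (Cmod base * (6 * exp (- (6 * d ^ 2)))) by ring.
  apply Rmult_le_compat_l; [apply base_pos|].
  assert (W : Cmod (Cexp (w r)) <= 3 * exp (2 * r ^ 2)).
  { rewrite Cmod_Cexp. eapply Rle_trans; [apply exp_le, Re_le_Cmod|]. now apply exp_w. }
  assert (Q : Cmod (Cexp (w r)) / Cmod (1 + zeta r)%C <= 6 * exp (2 * r ^ 2)).
  { apply Rmult_le_reg_r with (Cmod (1 + zeta r)%C); [lra|].
    unfold Rdiv. rewrite Rmult_assoc, Rinv_l, Rmult_1_r by lra. pose proof (exp_pos (2 * r ^ 2)). nra. }
  apply Rle_trans with (exp (- (8 * r ^ 2)) * (6 * exp (2 * r ^ 2))).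
  - apply Rmult_le_compat; try easy; [apply Rlt_le, exp_pos| |].
    + apply Rmult_le_pos; [apply Cmod_ge_0|]. apply Rlt_le, Rinv_0_lt_compat. lra.
    + apply exp_le. pose proof PI_gt_2. pose proof (pow2_ge_0 r). nra.
  - right. rewrite <- Hr, pow2_abs.
    replace (- (6 * r ^ 2)) with (- (8 * r ^ 2) + 2 * r ^ 2) by ring. rewrite exp_plus. ring.
Qed.

Lemma gint_ray l x : 0 < l -> slit x -> Cmod (gint s m (RtoC l * x)%C) =
  Cmod (gint s m x) * exp (- Re s * ln l - 2 * PI * (Re x * Im x) * (l ^ 2 - 1) - PI * m * Im x * (l - 1)).
Proof.
  intros Hl Hx. unfold gint. rewrite !Cmod_mult, !Cmod_Cexp, kern_ray by easy.
  rewrite !Rmult_assoc. f_equal.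
  rewrite <- !exp_plus. f_equal. simpl. unfold Re, Im. simpl. ring.
Qed.

Lemma p_mod r : Rabs r = d -> Cmod (p r) <= 2 * rho.
Proof.
  intros Hr. unfold p. eapply Rle_trans; [apply Cmod_triangle|]. fold rho.
  pose proof (y_le r). pose proof rho_bounds. pose proof m_le. unfold d in *. lra.
Qed.

(** On the way from p (- d) to 0, Re q Im q <= Re e Im e lets [ln_le_sq] control the kernel. The
    m-th exponential can grow by at most exp (4 d^2), because 10^4 m <= a, and the gain exp (- 6
    d^2) at the end of the segment outweighs this. *)
Lemma lower_part u : 0 < u <= 1 ->
  Cmod (gprim s m (p (- d)) - gprim s m (RtoC u * p (- d)))%C <= 36 * rho * (Cmod base * exp (- (2 * d ^ 2))).
Proof.
  intros Hu. pose proof d_pos as Hd. pose proof base_pos as HB. pose proof rho_pos as Hrho.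
  pose proof PI_gt_2. pose proof PI_lt_4. pose proof m_le as Hml.
  assert (Hd' : Rabs (- d) = d) by (rewrite Rabs_Ropp; apply Rabs_pos_eq; lra).
  assert (Sp : slit (p (- d))) by (apply p_slit; lra).
  pose proof (p_Re (- d)) as R1. pose proof (p_Im (- d)) as R2.
  set (q := p (- d)) in *.
  assert (Rq : 0 < Re q <= a) by (rewrite R1; unfold d in *; lra).
  assert (Iq : Im q <= Im e) by (rewrite R2; lra).
  set (k := 36 * rho * (Cmod base * exp (- (2 * d ^ 2)))).
  assert (Hk : 0 <= k).
  { unfold k. apply Rmult_le_pos; [lra|]. apply Rmult_le_pos; [easy|apply Rlt_le, exp_pos]. }
  pose proof (cder_Cmod_le (fun l => gprim s m (0 + RtoC l * q)%C) (fun l => (gint s m (0 + RtoC l * q) * q)%C)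
    (fun l => k * l) (fun l => k) u 1) as K. cbv beta in K.
  replace (0 + RtoC 1 * q)%C with q in K by ring.
  replace (0 + RtoC u * q)%C with (RtoC u * q)%C in K by ring.
  eapply Rle_trans; [apply K|]; [lra| | | |].
  - intros l Hl. apply (hol_line slit); [apply hol_gprim|].
    left. rewrite Re_affine, re_RtoC. nra.
  - intros l _. auto_derive; [easy|ring].
  - intros l Hl. replace (0 + RtoC l * q)%C with (RtoC l * q)%C by ring.
    rewrite Cmod_mult, gint_ray by (easy || lra).
    pose proof (edge_le (- d) Hd') as Ed. fold q in Ed.
    pose proof (p_mod (- d) Hd') as Mo. fold q in Mo.
    set (Ex := exp (- Re s * ln l - _ - _)).
    assert (HEx : Ex <= 3 * exp (4 * d ^ 2)).
    { apply Rle_trans with (exp (1 + 4 * d ^ 2)).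
      - unfold Ex. apply exp_le.
        assert (X0 : Re q * Im q <= a * Im e).
        { destruct (Rle_dec 0 (Im q)); [apply Rmult_le_compat; lra|]. assert (0 <= a * Im e) by (unfold a; nra). nra. }
        assert (X1 : 4 * PI * (a * Im e) = 1 - Re s) by (rewrite (Re_s s e Hs); unfold a; ring).
        assert (X2 : 2 * PI * (Re q * Im q) * (1 - l ^ 2) <= (1 - Re s) / 2 * (1 - l ^ 2)).
        { apply Rmult_le_compat_r; [nra|]. rewrite <- X1. nra. }
        assert (X3 : PI * m * Im q * (1 - l) <= 4 * d ^ 2).
        { assert (PI * m * Im q <= 4 * d ^ 2).
          { apply Rle_trans with (4 * m * a).
            - assert (Im q <= a) by (unfold a; lra). assert (0 <= PI * m) by nra.
              assert (PI * m * Im q <= PI * m * a) by (now apply Rmult_le_compat_l).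
              assert (0 <= m * a) by (unfold a; nra). nra.
            - unfold d. assert (10 ^ 4 * m * a <= a * a) by (apply Rmult_le_compat_r; [unfold a; lra|easy]). nra. }
          assert (0 <= 4 * d ^ 2) by nra. nra. }
        pose proof (ln_le_sq l ltac:(lra)) as X4.
        assert (X5 : (-1 - Re s) * (ln l - (l ^ 2 - 1) / 2) <= 0) by (rewrite <- (Rmult_0_r (-1 - Re s)); apply Rmult_le_compat_l; lra).
        assert (ln l <= 0) by (rewrite <- ln_1; apply ln_le; lra).
        nra.
      - rewrite exp_plus. apply Rmult_le_compat_r; [apply Rlt_le, exp_pos|apply exp_le_3]. }
    unfold k.
    replace (36 * rho * (Cmod base * exp (- (2 * d ^ 2))))
      with (6 * (Cmod base * exp (- (6 * d ^ 2))) * (3 * exp (4 * d ^ 2)) * (2 * rho)).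
    + apply Rmult_le_compat; try easy; [|apply Cmod_ge_0|].
      * apply Rmult_le_pos; [apply Cmod_ge_0|apply Rlt_le, exp_pos].
      * apply Rmult_le_compat; try easy; [apply Cmod_ge_0|apply Rlt_le, exp_pos].
    + replace (- (2 * d ^ 2)) with (- (6 * d ^ 2) + 4 * d ^ 2) by ring. rewrite exp_plus. ring.
  - nra.
Qed.

(** Beyond p d the product Re q Im q exceeds Re e Im e by at least a d. The inequality for the
    kernel at e therefore holds with a surplus, which supplies the integrable factor exp (- (l -
    1)). *)
Lemma upper_part v : 1 <= v ->
  Cmod (gprim s m (RtoC v * p d) - gprim s m (p d))%C <= 12 * rho * (Cmod base * exp (- (6 * d ^ 2))).
Proof.
  intros Hv. pose proof d_pos as Hd. pose proof base_pos as HB. pose proof rho_pos as Hrho.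
  pose proof PI_gt_2. pose proof PI_lt_4. pose proof m_le as Hml.
  assert (Hd' : Rabs d = d) by (apply Rabs_pos_eq; lra).
  assert (Sp : slit (p d)) by (apply p_slit; lra).
  pose proof (p_Re d) as R1. pose proof (p_Im d) as R2.
  set (q := p d) in *.
  assert (Rq : a <= Re q) by (rewrite R1; unfold d in *; lra).
  assert (Iq : Im e + d = Im q) by (rewrite R2; lra).
  set (k := 12 * rho * (Cmod base * exp (- (6 * d ^ 2)))).
  assert (Hk : 0 <= k).
  { unfold k. apply Rmult_le_pos; [lra|]. apply Rmult_le_pos; [easy|apply Rlt_le, exp_pos]. }
  pose proof (cder_Cmod_le (fun l => gprim s m (0 + RtoC l * q)%C) (fun l => (gint s m (0 + RtoC l * q) * q)%C)
    (fun l => - k * exp (- (l - 1))) (fun l => k * exp (- (l - 1))) 1 v) as K. cbv beta in K.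
  replace (0 + RtoC 1 * q)%C with q in K by ring.
  replace (0 + RtoC v * q)%C with (RtoC v * q)%C in K by ring.
  eapply Rle_trans; [apply K|]; [lra| | | |].
  - intros l Hl. apply (hol_line slit); [apply hol_gprim|].
    left. rewrite Re_affine, re_RtoC. unfold a in *. nra.
  - intros l _. auto_derive; [easy|]. unfold Rminus. ring.
  - intros l Hl. replace (0 + RtoC l * q)%C with (RtoC l * q)%C by ring.
    rewrite Cmod_mult, gint_ray by (easy || lra).
    pose proof (edge_le d Hd') as Ed. fold q in Ed.
    pose proof (p_mod d Hd') as Mo. fold q in Mo.
    set (Ex := exp (- Re s * ln l - _ - _)).
    assert (HEx : Ex <= exp (- (l - 1))).
    { unfold Ex. apply exp_le.
      assert (X0 : a * Im e + a * d <= Re q * Im q).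
      { rewrite <- Iq. rewrite <- Rmult_plus_distr_l. apply Rmult_le_compat_r; lra. }
      assert (X1 : 4 * PI * (a * Im e) = 1 - Re s) by (rewrite (Re_s s e Hs); unfold a; ring).
      assert (L2 : 0 <= l ^ 2 - 1) by nra.
      assert (X2 : ((1 - Re s) / 2 + (a * d)) * (l ^ 2 - 1) <= 2 * PI * (Re q * Im q) * (l ^ 2 - 1)).
      { apply Rmult_le_compat_r; [easy|]. rewrite <- X1.
        assert (0 <= a * d) by (unfold a in *; nra). nra. }
      assert (X3 : 0 <= PI * m * Im q * (l - 1)).
      { apply Rmult_le_pos; [|lra]. apply Rmult_le_pos; [nra|lra]. }
      pose proof (ln_le_sq l ltac:(lra)) as X4.
      assert (X5 : (1 - Re s) * (ln l - (l ^ 2 - 1) / 2) <= 0) by (rewrite <- (Rmult_0_r (1 - Re s)); apply Rmult_le_compat_l; lra).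
      assert (0 <= ln l) by (rewrite <- ln_1; apply ln_le; lra).
      assert (X6 : l - 1 <= a * d * (l ^ 2 - 1)).
      { assert (1 <= a * d) by (unfold a in *; nra). nra. }
      nra. }
    unfold k.
    replace (12 * rho * (Cmod base * exp (- (6 * d ^ 2))) * exp (- (l - 1)))
      with (6 * (Cmod base * exp (- (6 * d ^ 2))) * exp (- (l - 1)) * (2 * rho)) by ring.
    apply Rmult_le_compat; try easy; [|apply Cmod_ge_0|].
    + apply Rmult_le_pos; [apply Cmod_ge_0|apply Rlt_le, exp_pos].
    + apply Rmult_le_compat; try easy; [apply Cmod_ge_0|apply Rlt_le, exp_pos].
  - replace (- (1 - 1)) with 0 by ring. rewrite exp_0. pose proof (exp_pos (- (v - 1))). nra.
Qed.

Lemma d2_exp c : 2 <= c -> rho * exp (- (c * d ^ 2)) <= 20000 * / rho.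
Proof.
  intros Hc. pose proof d_pos. pose proof rho_bounds as [B1 B2]. pose proof rho_pos.
  assert (D2 : 0 < d ^ 2) by (apply pow_lt; lra).
  assert (E : exp (- (c * d ^ 2)) <= / (2 * d ^ 2)).
  { eapply Rle_trans; [apply exp_neg_le; nra|]. apply Rinv_le_contravar; nra. }
  apply Rmult_le_reg_r with rho; [easy|]. rewrite (Rmult_assoc 20000), Rinv_l, Rmult_1_r by lra.
  apply Rle_trans with (rho * rho * / (2 * d ^ 2)).
  - replace (rho * exp (- (c * d ^ 2)) * rho) with (rho * rho * exp (- (c * d ^ 2))) by ring.
    apply Rmult_le_compat_l; nra.
  - apply Rmult_le_reg_r with (2 * d ^ 2); [lra|]. rewrite Rmult_assoc, Rinv_l, Rmult_1_r by lra.
    assert (rho * rho <= (2 * a) * (2 * a)) by (apply Rmult_le_compat; lra).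
    unfold d. nra.
Qed.

(** The factor (1 + i) / 2 is the direction of the segment times the full Gaussian integral. The
    upper ray, the lower ray, the segment and the truncation of the Gaussian contribute 240000,
    720000, 19200 and 800 to the constant. *)
Lemma saddle_asymptotics Ginf G0 :
  (forall d, 0 < Re d -> 0 < Im d -> tinf d (gprim s m) Ginf) ->
  (forall d, 0 < Re d -> tzero d (gprim s m) G0) ->
  Cmod ((Ginf - G0) - base * ((1 + Ci) / 2))%C <= 10 ^ 6 * (Cmod base * (m ^ 3 * / rho)).
Proof.
  intros HI HZ. pose proof d_pos as Hd. pose proof base_pos as HB. pose proof rho_inv_pos as Hi.
  pose proof rho_bounds as [B1 B2]. pose proof rho_pos as Hrho. pose proof m_le as Hml.
  assert (U : Cmod (Ginf - gprim s m (p d))%C <= 12 * rho * (Cmod base * exp (- (6 * d ^ 2)))).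
  { apply (tinf_bound (p d) (gprim s m)).
    - apply HI; [rewrite p_Re; unfold d in *; lra|rewrite p_Im; lra].
    - intros v Hv. now apply upper_part. }
  assert (L : Cmod (gprim s m (p (- d)) - G0)%C <= 36 * rho * (Cmod base * exp (- (2 * d ^ 2)))).
  { apply (tzero_bound (p (- d)) (gprim s m) _ _ 1); [lra| |].
    - apply HZ. rewrite p_Re. unfold d in *; lra.
    - intros v Hv. now apply lower_part. }
  pose proof middle_part as M.
  pose proof (gauss_limit d ltac:(lra)) as G.
  set (X := Cmod base * (m ^ 3 * / rho)) in *.
  assert (H1 : Cmod base * / rho <= X).
  { unfold X. apply Rmult_le_compat_l; [easy|]. assert (1 <= m ^ 3); [|nra].
    rewrite <- (pow1 3). apply pow_incr. lra. }
  assert (P0 : 0 <= Cmod base * / rho) by (apply Rmult_le_pos; lra).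
  pose proof (d2_exp 6 ltac:(lra)) as D6. pose proof (d2_exp 2 ltac:(lra)) as D2.
  assert (U' : 12 * rho * (Cmod base * exp (- (6 * d ^ 2))) <= 240000 * X).
  { replace (12 * rho * (Cmod base * exp (- (6 * d ^ 2)))) with (12 * (Cmod base * (rho * exp (- (6 * d ^ 2))))) by ring.
    assert (Cmod base * (rho * exp (- (6 * d ^ 2))) <= Cmod base * (20000 * / rho)) by (now apply Rmult_le_compat_l). lra. }
  assert (L' : 36 * rho * (Cmod base * exp (- (2 * d ^ 2))) <= 720000 * X).
  { replace (36 * rho * (Cmod base * exp (- (2 * d ^ 2)))) with (36 * (Cmod base * (rho * exp (- (2 * d ^ 2))))) by ring.
    assert (Cmod base * (rho * exp (- (2 * d ^ 2))) <= Cmod base * (20000 * / rho)) by (now apply Rmult_le_compat_l). lra. }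
  set (Y := (base * ((1 + Ci) * (RtoC (gauss d - gauss (- d)) - RtoC (1 / 2))))%C).
  assert (HY : Cmod Y <= 800 * X).
  { unfold Y. rewrite <- RtoC_minus, !Cmod_mult, Cmod_R, gauss_odd.
    replace (gauss d - - gauss d - 1 / 2) with (2 * (gauss d - 1 / 4)) by field.
    rewrite Rabs_mult, (Rabs_pos_eq 2) by lra.
    assert (C2i : Cmod (1 + Ci)%C <= 2).
    { eapply Rle_trans; [apply Cmod_triangle|]. rewrite Cmod_1, Cmod_Ci. lra. }
    assert (Dinv : / d <= 200 * / rho).
    { replace (200 * / rho) with (/ (rho / 200)) by (field; lra).
      apply Rinv_le_contravar; [lra|]. unfold d. lra. }
    apply Rle_trans with (Cmod base * (2 * (2 * (200 * / rho)))).
    - apply Rmult_le_compat_l; [easy|]. apply Rmult_le_compat; try easy; [apply Cmod_ge_0| |lra].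
      pose proof (Rabs_pos (gauss d - 1 / 4)). lra.
    - lra. }
  replace (Ginf - G0 - base * ((1 + Ci) / 2))%C
    with ((Ginf - gprim s m (p d)) + (gprim s m (p (- d)) - G0)
      + (gprim s m (p d) - gprim s m (p (- d)) - base * (1 + Ci) * RtoC (gauss d - gauss (- d))) + Y)%C.
  2: { unfold Y. rewrite (RtoC_div 1 2). field. lra. }
  eapply Rle_trans; [apply Cmod_triangle|]. 
  eapply Rle_trans; [apply Rplus_le_compat_r, Cmod_triangle|].
  eapply Rle_trans; [apply Rplus_le_compat_r, Rplus_le_compat_r, Cmod_triangle|].
  lra.
Qed.
End SaddlePoint.

(** * Stirling's formula for Gauss' product *)

(** Componentwise, to match the way [CGamma] takes its limit. *)
Definition clim (u : nat -> C) (l : C) : Prop :=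
  is_lim_seq (fun n => Re (u n)) (Re l) /\ is_lim_seq (fun n => Im (u n)) (Im l).

Lemma clim_ext_loc u v l : eventually (fun n => u n = v n) -> clim u l -> clim v l.
Proof.
  intros E [H1 H2]. split.
  - apply (is_lim_seq_ext_loc (fun n => Re (u n))); [|exact H1].
    revert E. apply filter_imp. intros n Hn. now rewrite Hn.
  - apply (is_lim_seq_ext_loc (fun n => Im (u n))); [|exact H2].
    revert E. apply filter_imp. intros n Hn. now rewrite Hn.
Qed.

Lemma clim_const c : clim (fun _ => c) c.
Proof. split; apply is_lim_seq_const. Qed.

Lemma clim_mult u v l m : clim u l -> clim v m -> clim (fun n => (u n * v n)%C) (l * m)%C.
Proof.
  intros [U1 U2] [V1 V2]. split.
  - apply (is_lim_seq_minus' (fun n => Re (u n) * Re (v n)) (fun n => Im (u n) * Im (v n)));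
      now apply is_lim_seq_mult'.
  - apply (is_lim_seq_plus' (fun n => Re (u n) * Im (v n)) (fun n => Im (u n) * Re (v n)));
      now apply is_lim_seq_mult'.
Qed.

Lemma clim_inv u l : clim u l -> l <> 0%C -> clim (fun n => (/ u n)%C) (/ l)%C.
Proof.
  intros [U1 U2] H. apply sqr_sum_pos in H.
  assert (N : is_lim_seq (fun n => Re (u n) ^ 2 + Im (u n) ^ 2) (Re l ^ 2 + Im l ^ 2)).
  { apply is_lim_seq_plus'.
    - apply (is_lim_seq_ext (fun n => Re (u n) * Re (u n))); [intros; ring|].
      replace (Re l ^ 2) with (Re l * Re l) by ring. now apply is_lim_seq_mult'.
    - apply (is_lim_seq_ext (fun n => Im (u n) * Im (u n))); [intros; ring|].
      replace (Im l ^ 2) with (Im l * Im l) by ring. now apply is_lim_seq_mult'. }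
  split.
  - apply (is_lim_seq_div' (fun n => Re (u n))); [easy|exact N|apply Rgt_not_eq; exact H].
  - apply (is_lim_seq_div' (fun n => - Im (u n))); [|exact N|apply Rgt_not_eq; exact H].
    now apply (is_lim_seq_opp (fun n => Im (u n)) (Im l)).
Qed.

Lemma clim_exp u l : clim u l -> clim (fun n => Cexp (u n)) (Cexp l).
Proof.
  intros [U1 U2].
  assert (E : is_lim_seq (fun n => exp (Re (u n))) (exp (Re l))).
  { apply (is_lim_seq_continuous exp); [|easy]. apply derivable_continuous_pt, derivable_pt_exp. }
  split.
  - apply (is_lim_seq_ext (fun n => exp (Re (u n)) * cos (Im (u n)))); [intros; now rewrite Re_Cexp|].
    rewrite Re_Cexp. apply is_lim_seq_mult'; [easy|].
    apply (is_lim_seq_continuous cos); [|easy]. apply derivable_continuous_pt, derivable_pt_cos.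
  - apply (is_lim_seq_ext (fun n => exp (Re (u n)) * sin (Im (u n)))); [intros; now rewrite Im_Cexp|].
    rewrite Im_Cexp. apply is_lim_seq_mult'; [easy|].
    apply (is_lim_seq_continuous sin); [|easy]. apply derivable_continuous_pt, derivable_pt_sin.
Qed.

Lemma clim_S u l : clim u l -> clim (fun n => u (S n)) l.
Proof.
  intros [H1 H2]. split.
  - now apply (is_lim_seq_incr_1 (fun n => Re (u n))).
  - now apply (is_lim_seq_incr_1 (fun n => Im (u n))).
Qed.

Lemma RtoC_neq x : x <> 0 -> RtoC x <> 0%C.
Proof. intros H E. apply H. now apply RtoC_inj. Qed.

Lemma clim_small (u : nat -> C) (c : R) : 
  eventually (fun n => Cmod (u n) <= c * / INR n) -> clim u 0%C.
Proof.
  intros H.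
  assert (L : is_lim_seq (fun n => c * / INR n) 0).
  { replace (Finite 0) with (Rbar_mult c (Rbar_inv p_infty)) by (simpl; f_equal; ring).
    apply is_lim_seq_scal_l. apply is_lim_seq_inv; [apply is_lim_seq_INR|easy]. }
  assert (L' : is_lim_seq (fun n => - (c * / INR n)) 0).
  { pose proof (proj1 (is_lim_seq_opp _ _) L) as Q. simpl in Q. rewrite Ropp_0 in Q. exact Q. }
  split.
  - apply (is_lim_seq_le_le_loc (fun n => - (c * / INR n)) _ (fun n => c * / INR n)); [|exact L'|exact L].
    revert H. apply filter_imp. intros n Hn. apply Rabs_le_between.
    eapply Rle_trans; [apply re_le_Cmod|exact Hn].
  - apply (is_lim_seq_le_le_loc (fun n => - (c * / INR n)) _ (fun n => c * / INR n)); [|exact L'|exact L].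
    revert H. apply filter_imp. intros n Hn. apply Rabs_le_between.
    eapply Rle_trans; [apply Rabs_Im_le_Cmod|exact Hn].
Qed.

Lemma clim_Cmod_le u l B : clim u l -> (forall n, Cmod (u n) <= B) -> Cmod l <= B.
Proof.
  intros [H1 H2] HB.
  assert (B0 : 0 <= B) by (eapply Rle_trans; [apply (Cmod_ge_0 (u O))|apply HB]).
  apply le_of_sq; [easy|]. rewrite Cmod2_alt.
  assert (L : is_lim_seq (fun n => Re (u n) * Re (u n) + Im (u n) * Im (u n)) (Re l * Re l + Im l * Im l)).
  { apply is_lim_seq_plus'; now apply is_lim_seq_mult'. }
  replace (Re l ^ 2 + Im l ^ 2) with (Re l * Re l + Im l * Im l) by ring.
  apply (is_lim_seq_le _ (fun _ => B ^ 2) (Finite _) (Finite _)) with (2 := L) (3 := is_lim_seq_const _).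
  intros n. specialize (HB n). pose proof (Cmod_ge_0 (u n)).
  replace (Re (u n) * Re (u n) + Im (u n) * Im (u n)) with (Cmod (u n) ^ 2) by (rewrite Cmod2_alt; ring).
  apply pow_incr. easy.
Qed.

(** Integral comparison in telescoping form: the increments of the bounded sequence T play the role
    of integrals of a majorant, and B - T 0 bounds the whole sum. *)
Lemma csum_converges (f : nat -> C) (T : nat -> R) (B : R) :
  (forall k, Cmod (f k) <= T (S k) - T k) -> (forall k, T k <= B) ->
  exists L, clim (csum f) L /\ Cmod L <= B - T O.
Proof.
  intros Hf HB.
  assert (Inc : forall n k, Cmod (csum f (k + n) - csum f n)%C <= T (k + n)%nat - T n).
  { intros n k. induction k as [|k IH]; simpl.
    - replace (csum f n - csum f n)%C with (RtoC 0) by ring. rewrite Cmod_0. lra.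
    - replace (csum f (k + n) + f (k + n)%nat - csum f n)%C
        with ((csum f (k + n) - csum f n) + f (k + n)%nat)%C by ring.
      eapply Rle_trans; [apply Cmod_triangle|]. specialize (Hf (k + n)%nat). lra. }
  assert (Tinc : forall n, T n <= T (S n)).
  { intros n. pose proof (Hf n). pose proof (Cmod_ge_0 (f n)). lra. }
  destruct (ex_finite_lim_seq_incr T B Tinc HB) as [l Hl].
  assert (TC : ex_lim_seq_cauchy T) by (apply ex_lim_seq_cauchy_corr; now exists l).
  assert (Cau : forall P : C -> R, (forall a b, Rabs (P a - P b) <= Cmod (a - b)%C) ->
     ex_finite_lim_seq (fun n => P (csum f n))).
  { intros P HP. apply ex_lim_seq_cauchy_corr. intros eps. destruct (TC eps) as [N HN].
    assert (W : forall n m, (N <= n)%nat -> (n <= m)%nat -> Cmod (csum f m - csum f n)%C < eps).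
    { intros n m Hn Hm. pose proof (Inc n (m - n)%nat) as I.
      replace (m - n + n)%nat with m in I by lia.
      specialize (HN m n ltac:(lia) ltac:(lia)). pose proof (Rle_abs (T m - T n)). lra. }
    exists N. intros n m Hn Hm. eapply Rle_lt_trans; [apply HP|].
    destruct (Nat.le_gt_cases n m).
    - rewrite <- Cmod_opp. replace (- (csum f n - csum f m))%C with (csum f m - csum f n)%C by ring. now apply W.
    - apply W; lia. }
  destruct (Cau Re) as [x Hx]; [intros; rewrite <- re_minus; apply re_le_Cmod|].
  destruct (Cau Im) as [z Hz]; [intros; rewrite <- im_minus; apply Rabs_Im_le_Cmod|].
  assert (CL : clim (csum f) (x, z)) by (split; assumption).
  exists (x, z). split; [exact CL|].
  apply (clim_Cmod_le (csum f)); [exact CL|]. intros n.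
  pose proof (Inc O n) as I. rewrite Nat.add_0_r in I. simpl in I.
  replace (csum f n - 0)%C with (csum f n) in I by ring. specialize (HB n). lra.
Qed.

(** Adding a positive real never crosses the cut: off the real axis 1 + r / z has imaginary part of
    sign opposite to that of z, so the two arguments cannot add up to PI or - PI. *)
Lemma CLog_shift (z : C) (r : R) : slit z -> 0 < r -> Cmod (RtoC r / z)%C <= 1 / 2 ->
  CLog (z + RtoC r)%C = (CLog z + CLog (1 + RtoC r / z))%C.
Proof.
  intros Hz Hr H. pose proof (slit_neq0 _ Hz) as N. pose proof (Re_1_plus _ H) as Rp.
  rewrite <- CLog_mult; [f_equal; field; exact N|exact Hz|now left|].
  pose proof (Arg_right_bound _ Rp) as A1. pose proof PI_RGT_0.
  assert (I : Im (1 + RtoC r / z)%C = - r * Im z / (Re z ^ 2 + Im z ^ 2)).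
  { unfold Cdiv. rewrite im_plus, im_scal_l, im_inv. simpl. unfold Rdiv. ring. }
  pose proof (sqr_sum_pos z N) as Sq.
  destruct Hz as [h|h].
  - pose proof (Arg_right_bound _ h). lra.
  - destruct (Rdichotomy _ _ h) as [g|g].
    + pose proof (Arg_down_bound _ g). pose proof (Arg_up_bound (1 + RtoC r / z)%C) as A2.
      rewrite I in A2. assert (0 < - r * Im z / (Re z ^ 2 + Im z ^ 2)) by (apply Rdiv_lt_0_compat; nra).
      specialize (A2 H2). lra.
    + pose proof (Arg_up_bound _ g). pose proof (Arg_down_bound (1 + RtoC r / z)%C) as A2.
      rewrite I in A2. assert (- r * Im z / (Re z ^ 2 + Im z ^ 2) < 0) by (apply Rdiv_neg_pos; nra).
      specialize (A2 H2). lra.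
Qed.

(* [stir] is the main part of Gamma without the factor sqrt (2 PI), which cancels in [chi]. *)
Definition stir (z : C) : C := Cexp ((z - RtoC (1 / 2)) * CLog z - z)%C.
(** The logarithmic defect of [stir] in the functional equation of Gamma; its sum over z, z + 1, z +
    2, ... is Gudermann's series for Binet's correction. *)
Definition mu (z : C) : C := ((z + RtoC (1 / 2)) * CLog (1 + RtoC 1 / z) - 1)%C.

Lemma Cmod_inv_le z : 2 <= Cmod z -> Cmod (RtoC 1 / z)%C <= 1 / 2.
Proof.
  intros H. rewrite Cmod_div, Cmod_1.
  - unfold Rdiv. rewrite !Rmult_1_l. apply Rinv_le_contravar; lra.
  - apply Cmod_gt_0. lra.
Qed.

Lemma stir_step z : slit z -> 2 <= Cmod z -> stir (z + RtoC 1)%C = (z * stir z * Cexp (mu z))%C.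
Proof.
  intros Hz H. unfold stir.
  rewrite CLog_shift; [|easy|lra|now apply Cmod_inv_le].
  rewrite <- (Cexp_CLog z Hz) at 5. rewrite <- !Cexp_plus. f_equal. unfold mu.
  rewrite (RtoC_div 1 2). field. lra.
Qed.

(** The shift by 1/2 cancels the term of order 1 / z, so what remains is - 1 / (4 z^2) and z + 1/2
    times the cubic error of the logarithm. *)
Lemma mu_le z : 2 <= Cmod z -> Cmod (mu z) <= 2 * / Cmod z ^ 2.
Proof.
  intros H. assert (N : z <> 0%C) by (apply Cmod_gt_0; lra).
  pose proof (CLog_1_plus _ (Cmod_inv_le z H)) as B.
  set (k := (RtoC 1 / z)%C) in *. set (E := (CLog (1 + k) - (k - k * k / 2))%C) in *.
  assert (Mk : Cmod k = / Cmod z) by (unfold k; rewrite Cmod_div, Cmod_1 by easy; unfold Rdiv; ring).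
  assert (M : mu z = (- (k * k / 4) + (z + RtoC (1 / 2)) * E)%C).
  { unfold mu. fold k. replace (CLog (1 + k)) with (E + (k - k * k / 2))%C by (unfold E; ring).
    generalize E. intros X. unfold k. rewrite (RtoC_div 1 2); [field; exact N|lra]. }
  rewrite M. eapply Rle_trans; [apply Cmod_triangle|].
  rewrite Cmod_opp, Cmod_div, !Cmod_mult by (apply RtoC_neq; lra).
  assert (Z : Cmod (z + RtoC (1 / 2))%C <= Cmod z + 1 / 2).
  { eapply Rle_trans; [apply Cmod_triangle|]. rewrite (Cmod_R (1 / 2)), Rabs_pos_eq by lra. lra. }
  rewrite Cmod_R, Rabs_pos_eq by lra. rewrite Mk in *.
  set (v := / Cmod z) in *.
  assert (Hv : 0 < v <= 1 / 2).
  { unfold v. split; [apply Rinv_0_lt_compat; lra|].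
    replace (1 / 2) with (/ 2) by field. apply Rinv_le_contravar; lra. }
  assert (Cmod (z + RtoC (1 / 2))%C * Cmod E <= (Cmod z + 1 / 2) * (2 / 3 * v ^ 3))
    by (apply Rmult_le_compat; try easy; apply Cmod_ge_0).
  assert (Cmod z * v = 1) by (unfold v; field; lra).
  replace (/ Cmod z ^ 2) with (v ^ 2) by (unfold v; field; lra).
  assert (Cmod z * v ^ 3 = v ^ 2) by (replace (Cmod z * v ^ 3) with (Cmod z * v * v ^ 2) by ring; rewrite H1; ring).
  assert (0 <= v ^ 2) by apply pow2_ge_0. nra.
Qed.

Definition good (z : C) : Prop := forall k : nat, slit (z + RtoC (INR k))%C /\ 2 <= Cmod (z + RtoC (INR k))%C.

Lemma good_Im z : 2 <= Rabs (Im z) -> good z.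
Proof.
  intros H k. assert (E : Im (z + RtoC (INR k))%C = Im z) by (rewrite im_plus, im_RtoC; ring).
  split.
  - right. rewrite E. intros F. rewrite F, Rabs_R0 in H. lra.
  - eapply Rle_trans; [|apply Rabs_Im_le_Cmod]. now rewrite E.
Qed.

Lemma good_2 : good 2.
Proof.
  intros k. pose proof (pos_INR k). rewrite <- RtoC_plus. split.
  - left. rewrite re_RtoC. lra.
  - rewrite Cmod_R, Rabs_pos_eq; lra.
Qed.

Lemma Cprod_S z n : Cprod_shift z (S n) = (Cprod_shift z n * (z + RtoC (INR (S n))))%C.
Proof. reflexivity. Qed.

Lemma Cprod_stir z n : good z ->
  (Cprod_shift z n * stir z * Cexp (csum (fun k => mu (z + RtoC (INR k))) (S n))
    = stir (z + RtoC (INR n) + RtoC 1))%C.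
Proof.
  intros G. induction n as [|n IH].
  - destruct (G O) as [G1 G2]. simpl INR in *. simpl csum. simpl Cprod_shift.
    replace (z + RtoC 0)%C with z in * by ring. rewrite Cplus_0_l.
    symmetry. now apply stir_step.
  - rewrite csum_S, Cexp_plus, Cprod_S.
    destruct (G (S n)) as [G1 G2].
    rewrite stir_step by easy.
    replace (stir (z + RtoC (INR (S n))))%C with (stir (z + RtoC (INR n) + RtoC 1))%C
      by (rewrite S_INR, RtoC_plus; f_equal; ring).
    rewrite <- IH. ring.
Qed.

Lemma stir_neq0 z : stir z <> 0%C.
Proof. apply Cexp_neq0. Qed.

Lemma Cprod_neq0 z n : good z -> Cprod_shift z n <> 0%C.
Proof.
  intros G E. pose proof (Cprod_stir z n G) as H. rewrite E in H.
  apply (stir_neq0 (z + RtoC (INR n) + RtoC 1)%C). rewrite <- H. ring.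
Qed.

(* [stirD] does not depend on the argument; it is evaluated in the limit by means of Gamma(2) = 1. *)
Definition stirD (n : nat) : C :=
  (RtoC (INR (Factorial.fact n)) * Cexp (- (RtoC (INR n) + RtoC (1 / 2)) * RtoC (ln (INR n)) + RtoC (INR n)))%C.

Definition stirV (z : C) (n : nat) : C :=
  (Cexp (z * RtoC (ln (INR n)) + (RtoC (INR n) + RtoC (1 / 2)) * RtoC (ln (INR n)) - RtoC (INR n))
    / stir (z + RtoC (INR n) + RtoC 1))%C.

Definition muS (z : C) (n : nat) : C := csum (fun k => mu (z + RtoC (INR k))) (S n).

Lemma Gamma_seq_stir z n : good z ->
  Gamma_seq z n = (stirD n * (stirV z n * (stir z * Cexp (muS z n))))%C.
Proof.
  intros G. pose proof (Cprod_neq0 z n G) as N. pose proof (stir_neq0 z).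
  pose proof (stir_neq0 (z + RtoC (INR n) + RtoC 1)%C) as NN.
  unfold Gamma_seq, stirD, stirV, muS. rewrite <- (Cprod_stir z n G).
  assert (NE := Cexp_neq0 (csum (fun k => mu (z + RtoC (INR k))) (S n))).
  replace (Cexp (z * RtoC (ln (INR n)))) with
    (Cexp (- (RtoC (INR n) + RtoC (1 / 2)) * RtoC (ln (INR n)) + RtoC (INR n)) *
     Cexp (z * RtoC (ln (INR n)) + (RtoC (INR n) + RtoC (1 / 2)) * RtoC (ln (INR n)) - RtoC (INR n)))%C.
  2: { rewrite <- Cexp_plus. f_equal. ring. }
  field. repeat split; assumption.
Qed.

(** With w = (z + 1) / n the exponent is z + 1 - (z + n + 1/2) log (1 + w). Its leading part z + 1 =
    n w cancels, and the rest is O (1 / n). *)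
Lemma stirV_lim z : clim (stirV z) 1%C.
Proof.
  set (dl := fun n => ((z + RtoC 1) - (z + RtoC (INR n) + RtoC (1 / 2)) * CLog (1 + (z + 1) / RtoC (INR n)))%C).
  assert (Big : eventually (fun n => 1 <= INR n /\ 2 * Cmod (z + 1)%C <= INR n)).
  { destruct (INR_unbounded (Rmax 1 (2 * Cmod (z + 1)%C))) as [N HN]. exists N. intros n Hn.
    apply le_INR in Hn. pose proof (Rmax_l 1 (2 * Cmod (z + 1)%C)). pose proof (Rmax_r 1 (2 * Cmod (z + 1)%C)). lra. }
  assert (Wb : forall n, 1 <= INR n /\ 2 * Cmod (z + 1)%C <= INR n ->
     Cmod ((z + 1) / RtoC (INR n))%C = Cmod (z + 1)%C * / INR n /\ Cmod ((z + 1) / RtoC (INR n))%C <= 1 / 2).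
  { intros n [H1 H2]. rewrite Cmod_div, Cmod_R, Rabs_pos_eq by (try apply RtoC_neq; lra). split; [easy|].
    apply Rmult_le_reg_r with (INR n); [lra|]. unfold Rdiv. rewrite Rmult_assoc, Rinv_l by lra. lra. }
  apply (clim_ext_loc (fun n => Cexp (dl n))).
  - revert Big. apply filter_imp. intros n Hn. destruct (Wb n Hn) as [W1 W2]. destruct Hn as [H1 H2].
    unfold stirV, stir. rewrite <- Cexp_minus. f_equal.
    replace (z + RtoC (INR n) + RtoC 1)%C with (RtoC (INR n) * (1 + (z + 1) / RtoC (INR n)))%C at 2
      by (field; apply RtoC_neq; lra).
    rewrite CLog_scal; [|lra|left; now apply Re_1_plus].
    unfold dl. rewrite (RtoC_div 1 2). field. lra.
  - rewrite <- Cexp_0. apply clim_exp.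
    apply (clim_small _ (Cmod (z + RtoC (1 / 2))%C * Cmod (z + 1)%C
       + (1 + Cmod (z + RtoC (1 / 2))%C) * Cmod (z + 1)%C ^ 2)).
    revert Big. apply filter_imp. intros n Hn. destruct (Wb n Hn) as [W1 W2]. destruct Hn as [H1 H2].
    pose proof (CLog_1_plus _ W2) as B. set (w := ((z + 1) / RtoC (INR n))%C) in *.
    set (E := (CLog (1 + w) - (w - w * w / 2))%C) in *.
    set (N := INR n) in *.
    assert (D : dl n = (- ((z + RtoC (1 / 2)) * w) + (RtoC N + (z + RtoC (1 / 2))) * (w * w / 2 - E))%C).
    { unfold dl. fold N. fold w. replace (CLog (1 + w)) with (E + (w - w * w / 2))%C by (unfold E; ring).
      assert (NW : (z + 1 = RtoC N * w)%C) by (unfold w; field; apply RtoC_neq; lra).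
      transitivity ((z + 1) - (z + RtoC N + RtoC (1 / 2)) * (E + (w - w * w / 2)))%C; [reflexivity|].
      rewrite NW at 1. ring. }
    rewrite D. set (h := (z + RtoC (1 / 2))%C). eapply Rle_trans; [apply Cmod_triangle|].
    rewrite Cmod_opp, !Cmod_mult, Rmult_plus_distr_r. apply Rplus_le_compat.
    + rewrite W1. right. ring.
    + assert (B2 : Cmod (w * w / 2 - E)%C <= Cmod w ^ 2).
      { unfold Cminus. eapply Rle_trans; [apply Cmod_triangle|]. rewrite Cmod_opp, Cmod_div, Cmod_mult by (apply RtoC_neq; lra).
        rewrite Cmod_R, Rabs_pos_eq by lra. pose proof (Cmod_ge_0 w). nra. }
      assert (B3 : Cmod (RtoC N + h)%C <= N * (1 + Cmod h)).
      { eapply Rle_trans; [apply Cmod_triangle|]. rewrite Cmod_R, Rabs_pos_eq by lra. pose proof (Cmod_ge_0 h). nra. }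
      eapply Rle_trans; [apply Rmult_le_compat; [apply Cmod_ge_0|apply Cmod_ge_0|exact B3|exact B2]|].
      rewrite W1. right. field. lra.
Qed.

Lemma Cprod_2 n : Cprod_shift 2 n = RtoC (INR (Factorial.fact n) * (INR n + 1) * (INR n + 2)).
Proof.
  induction n as [|n IH].
  - simpl. f_equal. ring.
  - rewrite Cprod_S, IH, fact_simpl, mult_INR, <- RtoC_plus, <- RtoC_mult, S_INR. f_equal. ring.
Qed.

Lemma Gamma_seq_2_lim : clim (Gamma_seq 2) 1%C.
Proof.
  assert (L : forall c : R, is_lim_seq (fun n => INR n * / (INR n + c)) 1).
  { intros c. apply (is_lim_seq_ext_loc (fun n => / (1 + c * / INR n))).
    - destruct (INR_unbounded (Rabs c + 1)) as [N HN]. exists N. intros n Hn. apply le_INR in Hn.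
      pose proof (Rle_abs (- c)). rewrite Rabs_Ropp in H. pose proof (Rabs_pos c).
      field. repeat split; lra.
    - replace (Finite 1) with (Rbar_inv (Finite (1 + c * 0))) by (simpl; f_equal; field).
      apply is_lim_seq_inv; [|simpl; intros E; injection E; lra].
      apply is_lim_seq_plus'; [apply is_lim_seq_const|].
      apply is_lim_seq_mult'; [apply is_lim_seq_const|].
      replace (Finite 0) with (Rbar_inv p_infty) by reflexivity.
      apply is_lim_seq_inv; [apply is_lim_seq_INR|easy]. }
  apply (clim_ext_loc (fun n => RtoC ((INR n * / (INR n + 1)) * (INR n * / (INR n + 2))))).
  - exists 1%nat. intros n Hn. apply le_INR in Hn. simpl in Hn. unfold Gamma_seq. rewrite Cprod_2.
    replace (2 * RtoC (ln (INR n)))%C with (RtoC (ln (INR n) + ln (INR n))) by (rewrite RtoC_plus; ring).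
    rewrite Cexp_RtoC, exp_plus, exp_ln by lra.
    pose proof (INR_fact_neq_0 n).
    rewrite <- RtoC_mult, <- RtoC_div.
    + f_equal. field. repeat split; lra.
    + apply Rmult_integral_contrapositive; split; [apply Rmult_integral_contrapositive; split|]; lra.
  - split; simpl.
    + replace 1 with (1 * 1) by ring. apply is_lim_seq_mult'; apply L.
    + apply is_lim_seq_const.
Qed.

Lemma stirD_lim L2 : clim (muS 2) L2 -> clim stirD (/ (stir 2 * Cexp L2))%C.
Proof.
  intros H.
  apply (clim_ext_loc (fun n => (Gamma_seq 2 n * / (stirV 2 n * (stir 2 * Cexp (muS 2 n))))%C)).
  - exists O. intros n _. rewrite (Gamma_seq_stir 2 n good_2).
    pose proof (stir_neq0 2). pose proof (Cexp_neq0 (muS 2 n)).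
    assert (stirV 2 n <> 0%C).
    { unfold stirV. unfold stir. rewrite <- Cexp_minus. apply Cexp_neq0. }
    field. repeat split; assumption.
  - pose proof (stir_neq0 2) as N1. pose proof (Cexp_neq0 L2) as N2.
    replace (/ (stir 2 * Cexp L2))%C with (1 * / (1 * (stir 2 * Cexp L2)))%C.
    + apply clim_mult; [apply Gamma_seq_2_lim|]. apply clim_inv.
      * apply clim_mult; [apply stirV_lim|]. apply clim_mult; [apply clim_const|now apply clim_exp].
      * rewrite Cmult_1_l. now apply Cmult_neq_0.
    + field. split; assumption.
Qed.

Lemma CGamma_stir z L L2 : good z -> clim (muS z) L -> clim (muS 2) L2 ->
  CGamma z = (/ (stir 2 * Cexp L2) * (stir z * Cexp L))%C.
Proof.
  intros G H H2.
  assert (K : clim (Gamma_seq z) (/ (stir 2 * Cexp L2) * (1 * (stir z * Cexp L)))%C).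
  { apply (clim_ext_loc (fun n => (stirD n * (stirV z n * (stir z * Cexp (muS z n))))%C)).
    - exists O. intros n _. symmetry. now apply Gamma_seq_stir.
    - apply clim_mult; [now apply stirD_lim|]. apply clim_mult; [apply stirV_lim|].
      apply clim_mult; [apply clim_const|now apply clim_exp]. }
  rewrite Cmult_1_l in K. destruct K as [K1 K2].
  apply C_ext.
  - transitivity (real (Lim_seq (fun n => Re (Gamma_seq z n)))); [reflexivity|].
    rewrite (is_lim_seq_unique _ _ K1). reflexivity.
  - transitivity (real (Lim_seq (fun n => Im (Gamma_seq z n)))); [reflexivity|].
    rewrite (is_lim_seq_unique _ _ K2). reflexivity.
Qed.

Lemma muS_2_lim : exists L2, clim (muS 2) L2.
Proof.
  destruct (csum_converges (fun k => mu (2 + RtoC (INR k))) (fun k => - (2 * / (INR k + 1))) 0) as [L [H _]].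
  - intros k. pose proof (pos_INR k). destruct (good_2 k) as [_ G]. eapply Rle_trans; [now apply mu_le|].
    rewrite <- RtoC_plus, Cmod_R, Rabs_pos_eq by lra. rewrite S_INR.
    replace (- (2 * / (INR k + 1 + 1)) - - (2 * / (INR k + 1))) with (2 * / ((INR k + 1) * (INR k + 2))) by (field; lra).
    apply Rmult_le_compat_l; [lra|]. apply Rinv_le_contravar; nra.
  - intros k. pose proof (pos_INR k). assert (0 < / (INR k + 1)) by (apply Rinv_0_lt_compat; lra). lra.
  - exists L. apply (clim_S _ _ H).
Qed.

(** The majorant 2 / |z + k|^2 is compared with increments of an arctangent, so the bound depends on
    Im z alone. This uniformity is essential: in [chi] one argument has a large negative real part.
    The 6 is 2 times 3, as u^2 + h^2 <= 3 (x^2 + h^2) for u in [x, x + 1] and h >= 2. *)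
Lemma muS_lim z : 2 <= Rabs (Im z) -> exists L, clim (muS z) L /\ Cmod L <= 24 * / Rabs (Im z).
Proof.
  intros Hz. set (h := Rabs (Im z)) in *.
  destruct (csum_converges (fun k => mu (z + RtoC (INR k))) (fun k => 6 * / h * atan ((Re z + INR k) / h)) (6 * / h * 2))
    as [L [H HB]].
  - intros k. destruct (good_Im z Hz k) as [_ G]. eapply Rle_trans; [now apply mu_le|].
    assert (M : Cmod (z + RtoC (INR k))%C ^ 2 = (Re z + INR k) ^ 2 + h ^ 2).
    { rewrite Cmod2_alt. unfold h. rewrite pow2_abs. simpl. unfold Re, Im. simpl. ring. }
    rewrite M, S_INR. set (x := Re z + INR k). replace (Re z + (INR k + 1)) with (x + 1) by (unfold x; ring).
    assert (P : 0 < x ^ 2 + h ^ 2) by nra.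
    assert (I : - (6 * / h * atan ((x + 1) / h)) + 2 * / (x ^ 2 + h ^ 2) * (x + 1) 
        <= - (6 * / h * atan (x / h)) + 2 * / (x ^ 2 + h ^ 2) * x).
    { apply (derive_nonpos_le (fun u => - (6 * / h * atan (u / h)) + 2 * / (x ^ 2 + h ^ 2) * u)
        (fun u => - (6 * / (u ^ 2 + h ^ 2)) + 2 * / (x ^ 2 + h ^ 2))); [lra| |].
      - intros u _. assert (0 < u ^ 2 + h ^ 2) by nra. auto_derive; [easy|]. unfold Rsqr. field. repeat split; nra.
      - intros u Hu. assert (Pu : 0 < u ^ 2 + h ^ 2) by nra.
        assert (u ^ 2 + h ^ 2 <= 3 * (x ^ 2 + h ^ 2)).
        { assert (u ^ 2 <= 2 * x ^ 2 + 2 * (u - x) ^ 2) by (pose proof (pow2_ge_0 (2 * x - u)); nra).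
          assert ((u - x) ^ 2 <= 1) by nra. nra. }
        assert (/ (3 * (x ^ 2 + h ^ 2)) <= / (u ^ 2 + h ^ 2)) by (now apply Rinv_le_contravar).
        rewrite Rinv_mult in H0. lra. }
    lra.
  - intros k. apply Rmult_le_compat_l.
    + apply Rmult_le_pos; [lra|apply Rlt_le, Rinv_0_lt_compat; lra].
    + pose proof (atan_bound ((Re z + INR k) / h)). pose proof PI_lt_4. lra.
  - exists L. split; [apply (clim_S _ _ H)|]. eapply Rle_trans; [exact HB|].
    pose proof (atan_bound ((Re z + INR 0) / h)). pose proof PI_lt_4.
    assert (0 < / h) by (apply Rinv_0_lt_compat; lra). nra.
Qed.

(** * The saddle point eta *)

Lemma Ci_neq0 : Ci <> 0%C.
Proof. apply Cmod_gt_0. rewrite Cmod_Ci. lra. Qed.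

(** Here (s - 1) / (2 pi i) lies in the open first quadrant, so its principal root has argument
    between 0 and PI / 4 and is already the branch prescribed for eta; that its square has positive
    real part gives Im < Re. *)
Lemma eta_spec s : 0 < Im s -> Re s < 1 ->
  (s - 1 = 2 * RtoC PI * Ci * eta s * eta s)%C /\ 0 < Im (eta s) /\ Im (eta s) < Re (eta s).
Proof.
  intros Hi Hr. pose proof PI_RGT_0 as HPI.
  set (w0 := ((s - 1) / (2 * RtoC PI * Ci))%C).
  pose proof Ci_neq0 as NC.
  assert (NPI : RtoC PI <> 0%C) by (apply RtoC_neq; lra).
  assert (W : (s - 1 = 2 * RtoC PI * Ci * w0)%C) by (unfold w0; field; repeat split; assumption).
  assert (W1 : Im s = 2 * PI * Re w0).
  { apply (f_equal Im) in W. rewrite im_minus, im_RtoC in W.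
    replace (Im (2 * RtoC PI * Ci * w0)%C) with (2 * PI * Re w0) in W by (simpl; unfold Re, Im; ring). lra. }
  assert (W2 : Re s - 1 = - (2 * PI * Im w0)).
  { apply (f_equal Re) in W. rewrite re_minus, re_RtoC in W.
    replace (Re (2 * RtoC PI * Ci * w0)%C) with (- (2 * PI * Im w0)) in W by (simpl; unfold Re, Im; ring). lra. }
  assert (R0 : 0 < Re w0) by (apply Rmult_lt_reg_l with (2 * PI); lra).
  assert (I0 : 0 < Im w0) by (apply Rmult_lt_reg_l with (2 * PI); lra).
  pose proof (Arg_up_bound _ I0) as A1. pose proof (Arg_right_bound _ R0) as A2.
  set (w := Cpowc w0 (RtoC (1 / 2))).
  assert (IL : Im (RtoC (1 / 2) * CLog w0)%C = Arg w0 / 2) by (rewrite im_scal_l, Im_CLog; field).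
  assert (LW : CLog w = (RtoC (1 / 2) * CLog w0)%C).
  { unfold w, Cpowc. apply CLog_Cexp. rewrite IL. lra. }
  assert (AW : Arg w = Arg w0 / 2) by (rewrite <- Im_CLog, LW; exact IL).
  assert (E : eta s = w).
  { unfold eta. fold w0. fold w. rewrite AW.
    destruct (Rlt_dec _ _) as [h|h]; [|lra]. destruct (Rlt_dec _ _) as [h'|h']; [easy|lra]. }
  assert (WW : (w * w = w0)%C).
  { unfold w, Cpowc. rewrite <- Cexp_plus. rewrite <- (Cexp_CLog w0) at 3 by now left.
    f_equal. rewrite (RtoC_div 1 2); [field|lra]. }
  rewrite E. split; [|].
  - rewrite W, <- WW. ring.
  - assert (IW : 0 < Im w).
    { unfold w, Cpowc. rewrite Im_Cexp, IL. apply Rmult_lt_0_compat; [apply exp_pos|].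
      apply sin_gt_0; lra. }
    assert (RW : 0 < Re w).
    { unfold w, Cpowc. rewrite Re_Cexp, IL. apply Rmult_lt_0_compat; [apply exp_pos|].
      apply cos_gt_0; lra. }
    split; [easy|].
    assert (Re w0 = Re w * Re w - Im w * Im w) by (rewrite <- WW; apply re_mult). nra.
Qed.

(** * The factor chi *)

Section Chi.
Variables (s e : C).
Hypothesis Hs : (s - 1 = 2 * RtoC PI * Ci * e * e)%C.
Hypothesis Hb : 0 < Im e.
Hypothesis Hab : Im e < Re e.
Hypothesis Ht : 4 <= Im s.

Let Y := CLog e.

Lemma Arg_e_lt : 0 < Arg e < PI / 4.
Proof.
  pose proof (Arg_up_bound _ Hb). split; [easy|].
  rewrite Arg_right by lra. rewrite <- atan_1. apply atan_increasing.
  apply Rmult_lt_reg_r with (Re e); [lra|]. unfold Rdiv. rewrite Rmult_assoc, Rinv_l; lra.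
Qed.

Lemma Cexp_i_pi2 : Cexp (Ci * RtoC (PI / 2)) = Ci.
Proof.
  apply C_ext; rewrite ?Re_Cexp, ?Im_Cexp.
  - replace (Im (Ci * RtoC (PI / 2))%C) with (PI / 2) by (simpl; unfold Im; simpl; ring). rewrite cos_PI2. simpl. ring.
  - replace (Im (Ci * RtoC (PI / 2))%C) with (PI / 2) by (simpl; unfold Im; simpl; ring).
    replace (Re (Ci * RtoC (PI / 2))%C) with 0 by (simpl; unfold Re; simpl; ring). rewrite sin_PI2, exp_0. simpl. ring.
Qed.

Lemma Cexp_Y2 : Cexp (RtoC (ln PI) + 2 * Y)%C = (RtoC PI * (e * e))%C.
Proof.
  rewrite Cexp_plus, Cexp_RtoC, exp_ln by apply PI_RGT_0. f_equal.
  replace (2 * Y)%C with (Y + Y)%C by ring. unfold Y. rewrite Cexp_plus, Cexp_CLog; [easy|left; lra].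
Qed.

(** (s - 1) / 2 equals pi i e^2, and Arg e < PI / 4 keeps 2 Arg e + PI / 2 below PI, so no multiple
    of 2 pi i intervenes. *)
Lemma CLog_half_up : CLog ((s - 1) / 2)%C = (RtoC (ln PI) + 2 * Y + Ci * RtoC (PI / 2))%C.
Proof.
  replace ((s - 1) / 2)%C with (Cexp (RtoC (ln PI) + 2 * Y + Ci * RtoC (PI / 2))).
  - apply CLog_Cexp. pose proof Arg_e_lt.
    replace (Im (RtoC (ln PI) + 2 * Y + Ci * RtoC (PI / 2))%C) with (2 * Arg e + PI / 2); [lra|].
    rewrite !im_plus, im_scal_l. unfold Y. rewrite Im_CLog. simpl. unfold Im. simpl. ring.
  - rewrite Cexp_plus, Cexp_i_pi2, Cexp_Y2, Hs. field.
Qed.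

Lemma CLog_half_down : CLog ((1 - s) / 2)%C = (RtoC (ln PI) + 2 * Y - Ci * RtoC (PI / 2))%C.
Proof.
  replace ((1 - s) / 2)%C with (Cexp (RtoC (ln PI) + 2 * Y - Ci * RtoC (PI / 2))).
  - apply CLog_Cexp. pose proof Arg_e_lt.
    replace (Im (RtoC (ln PI) + 2 * Y - Ci * RtoC (PI / 2))%C) with (2 * Arg e - PI / 2); [lra|].
    rewrite im_minus, !im_plus, im_scal_l. unfold Y. rewrite Im_CLog. simpl. unfold Im. simpl. ring.
  - rewrite Cexp_minus, Cexp_i_pi2, Cexp_Y2.
    pose proof Ci_neq0 as N.
    assert (I2 : (Ci * Ci = - (1))%C) by (apply C_ext; simpl; ring).
    replace (1 - s)%C with (- (s - 1))%C by ring. rewrite Hs.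
    transitivity (- (Ci * Ci) * (RtoC PI * (e * e)) / Ci)%C; [rewrite I2; field; exact N|field; exact N].
Qed.

(** Writing s / 2 as (s - 1) / 2 + 1/2 expresses both logarithms through [CLog e]. The constants of
    [CGamma_stir] and the powers of pi cancel. The error consists of 1 / Im s from this shift and 48
    / Im s from each Gamma factor. *)
Lemma chi_stirling : exists dlt, Cmod dlt <= 100 * / Im s /\
  chi s = Cexp ((1 - 2 * s) * Y + Ci * RtoC (PI / 4) + (s - 1) + dlt)%C.
Proof.
  set (z1 := ((1 - s) / 2)%C). set (z2 := (s / 2)%C).
  assert (N2 : RtoC 2 <> 0%C) by (apply RtoC_neq; lra).
  assert (H1 : Im z1 = - (Im s / 2)).
  { unfold z1. replace ((1 - s) / 2)%C with (RtoC (/ 2) * (1 - s))%C by (rewrite RtoC_inv; field || lra).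
    rewrite im_scal_l, im_minus, im_RtoC. field. }
  assert (H2 : Im z2 = Im s / 2).
  { unfold z2. replace (s / 2)%C with (RtoC (/ 2) * s)%C by (rewrite RtoC_inv; field || lra).
    rewrite im_scal_l. field. }
  assert (A1 : Rabs (Im z1) = Im s / 2) by (rewrite H1, Rabs_Ropp, Rabs_pos_eq; lra).
  assert (A2 : Rabs (Im z2) = Im s / 2) by (rewrite H2, Rabs_pos_eq; lra).
  destruct (muS_lim z1) as [L1 [K1 B1]]; [lra|]. destruct (muS_lim z2) as [L2 [K2 B2]]; [lra|].
  destruct muS_2_lim as [L0 K0].
  assert (G1 : good z1) by (apply good_Im; lra). assert (G2 : good z2) by (apply good_Im; lra).
  pose proof (CGamma_stir z1 L1 L0 G1 K1 K0) as C1. pose proof (CGamma_stir z2 L2 L0 G2 K2 K0) as C3.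
  set (k := (RtoC (1 / 2) / ((s - 1) / 2))%C).
  assert (Ns : (s - 1)%C <> 0%C).
  { intros E. apply (f_equal Im) in E. rewrite im_minus, !im_RtoC in E. lra. }
  assert (Ms : Im s <= Cmod (s - 1)%C).
  { eapply Rle_trans; [|apply Im_le_Cmod]. rewrite im_minus, im_RtoC. lra. }
  assert (Mk : Cmod k = / Cmod (s - 1)%C).
  { replace k with (/ (s - 1))%C.
    - now apply Cmod_inv.
    - unfold k. rewrite (RtoC_div 1 2) by lra. field. exact Ns. }
  assert (Tinv : / Cmod (s - 1)%C <= / Im s) by (apply Rinv_le_contravar; lra).
  assert (T4 : / Im s <= / 4) by (apply Rinv_le_contravar; lra).
  assert (Hk : Cmod k <= 1 / 2) by lra.
  assert (LZ2 : CLog z2 = (CLog ((s - 1) / 2) + CLog (1 + k))%C).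
  { unfold k. rewrite <- CLog_shift.
    - f_equal. unfold z2. rewrite (RtoC_div 1 2) by lra. field.
    - right. replace ((s - 1) / 2)%C with (RtoC (/ 2) * (s - 1))%C by (rewrite RtoC_inv; field || lra).
      rewrite im_scal_l, im_minus, im_RtoC. lra.
    - lra.
    - exact Hk. }
  pose proof (CLog_1_plus k Hk) as BE. set (E := (CLog (1 + k) - (k - k * k / 2))%C) in *.
  set (ep := ((s - 1) / 2 * (k * k / 2 - E))%C).
  exists (ep + L1 - L2)%C. split.
  - assert (Bep : Cmod ep <= / Im s).
    { unfold ep. rewrite Cmod_mult, Cmod_div, Cmod_R, (Rabs_pos_eq 2) by (exact N2 || lra).
      assert (Q : Cmod (k * k / 2 - E)%C <= Cmod k ^ 2).
      { unfold Cminus. eapply Rle_trans; [apply Cmod_triangle|]. rewrite Cmod_opp, Cmod_div, Cmod_mult by exact N2.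
        rewrite Cmod_R, Rabs_pos_eq by lra. pose proof (Cmod_ge_0 k). nra. }
      rewrite Mk in Q. set (M := Cmod (s - 1)%C) in *.
      apply Rle_trans with (M / 2 * (/ M) ^ 2).
      - apply Rmult_le_compat_l; [lra|exact Q].
      - replace (M / 2 * (/ M) ^ 2) with (/ 2 * / M) by (field; lra).
        assert (0 < / M) by (apply Rinv_0_lt_compat; lra). lra. }
    rewrite A1 in B1. rewrite A2 in B2.
    replace (24 * / (Im s / 2)) with (48 * / Im s) in B1, B2 by (field; lra).
    unfold Cminus. eapply Rle_trans; [apply Cmod_triangle|].
    eapply Rle_trans; [apply Rplus_le_compat_r, Cmod_triangle|]. rewrite Cmod_opp.
    assert (0 < / Im s) by (apply Rinv_0_lt_compat; lra). lra.
  - unfold chi. fold z1. fold z2. rewrite C1, C3.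
    pose proof (stir_neq0 2). pose proof (Cexp_neq0 L0). pose proof (stir_neq0 z2). pose proof (Cexp_neq0 L2).
    transitivity (Cexp ((s - RtoC (1 / 2)) * RtoC (ln PI)) * (stir z1 / stir z2) * (Cexp L1 / Cexp L2))%C.
    { field. repeat split; assumption. }
    unfold stir. rewrite <- !Cexp_minus, <- !Cexp_plus. f_equal.
    rewrite LZ2. unfold z1 at 2. rewrite CLog_half_up, CLog_half_down.
    replace (CLog (1 + k)) with (E + (k - k * k / 2))%C by (unfold E; ring).
    unfold ep. generalize E. intros X. fold Y. generalize Y. intros YY. unfold z1, z2, k.
    rewrite (RtoC_div 1 2), (RtoC_div PI 2), (RtoC_div PI 4) by lra. field. exact Ns.
Qed.
End Chi.

Lemma exp_neg_cube x : 0 < x -> exp (- x) <= 27 / x ^ 3.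
Proof.
  intros H. replace (- x) with (- (x / 3) + (- (x / 3) + - (x / 3))) by field.
  rewrite !exp_plus. pose proof (exp_neg_le (x / 3) ltac:(lra)) as E. pose proof (exp_pos (- (x / 3))).
  replace (/ (x / 3)) with (3 / x) in E by (field; lra).
  replace (27 / x ^ 3) with ((3 / x) ^ 3) by (field; lra).
  replace (exp (- (x / 3)) * (exp (- (x / 3)) * exp (- (x / 3)))) with (exp (- (x / 3)) ^ 3) by ring.
  apply pow_incr. lra.
Qed.

Lemma PI_gt_3 : 3 < PI.
Proof. pose proof PI2_3_2. lra. Qed.

(** * Choice of the number of terms *)

(* Here [tau] stands for [t^(1/10)], so the hypothesis on the real part reads
   [10 tau^4 L <= n], and about [tau] terms of the expansion are kept. *)
Section Numerics.
Variables (a b L : R).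
Let tau := exp L.
Let n := 4 * PI * a * b.
Hypothesis HL : 10 ^ 15 <= L.
Hypothesis Hb : 0 < b < a.
Hypothesis Ht : tau ^ 10 = 2 * PI * (a ^ 2 - b ^ 2).
Hypothesis Hn : 10 * tau ^ 4 * L <= n.

Lemma tau_ge : L <= tau.
Proof. unfold tau. pose proof (exp_ineq1_le L). lra. Qed.

Lemma tau4_le_n : tau ^ 4 <= n.
Proof.
  pose proof tau_ge. assert (0 < tau ^ 4) by (apply pow_lt; lra).
  assert (tau ^ 4 * 1 <= tau ^ 4 * (10 * L)) by (apply Rmult_le_compat_l; lra). lra.
Qed.

Lemma a_ge : tau ^ 5 <= 3 * a.
Proof.
  pose proof tau_ge. pose proof PI_lt_4. pose proof PI_gt_3.
  apply le_of_sq; [lra|].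
  replace ((tau ^ 5) ^ 2) with (tau ^ 10) by ring. rewrite Ht.
  assert (0 < a ^ 2) by (apply pow_lt; lra). assert (0 < b ^ 2) by (apply pow_lt; lra). nra.
Qed.

(** Either s lies so far to the left that b is comparable with a, or t alone controls the size of a.
    The value 6/10 is chosen for [b_tau_ge], where 16 * 6/10 must stay below 10. *)
Lemma a_cases : a <= 3 * b \/ a <= 6 / 10 * tau ^ 5.
Proof.
  pose proof tau_ge. pose proof PI_gt_3. destruct (Rle_dec a (3 * b)); [now left|right].
  apply le_of_sq; [assert (0 <= tau ^ 5) by (apply pow_le; lra); lra|].
  replace ((6 / 10 * tau ^ 5) ^ 2) with (36 / 100 * tau ^ 10) by field. rewrite Ht.
  assert (b ^ 2 <= a ^ 2 / 9) by nra. assert (0 < a ^ 2) by (apply pow_lt; lra). nra.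
Qed.

Lemma pow_tau_ge k : 1 <= tau ^ k.
Proof. apply pow_R1_Rle. pose proof tau_ge. lra. Qed.

(** The key lower bound on Im eta, with the logarithm that makes about tau geometric terms
    sufficient. If a is O (tau^5), it follows from 10 tau^4 L <= 4 pi a b; if b is comparable with
    a, it holds with much to spare. *)
Lemma b_tau_ge : L <= b * tau.
Proof.
  pose proof tau_ge as HT. pose proof PI_lt_4. pose proof PI_gt_3. pose proof a_ge as HA.
  destruct a_cases as [H1|H1].
  - assert (tau ^ 5 <= 9 * b) by lra.
    assert (9 * tau <= tau ^ 5).
    { replace (tau ^ 5) with (tau * tau ^ 4) by ring. rewrite Rmult_comm. apply Rmult_le_compat_l; [lra|].
      replace (tau ^ 4) with (tau * tau ^ 3) by ring. pose proof (pow_tau_ge 3). nra. }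
    assert (tau <= b) by lra. nra.
  - unfold n in Hn.
    assert (4 * PI * a * b <= 16 * (6 / 10 * tau ^ 5) * b).
    { apply Rmult_le_compat_r; [lra|]. apply Rle_trans with (16 * a); [|lra]. nra. }
    assert (P4 : 0 < tau ^ 4) by (apply pow_lt; lra).
    apply Rmult_le_reg_l with (tau ^ 4); [easy|].
    replace (tau ^ 4 * (b * tau)) with (tau ^ 5 * b) by ring.
    assert (0 <= tau ^ 5 * b) by (apply Rmult_le_pos; [apply pow_le; lra|lra]). lra.
Qed.

Lemma a_le_n : 12 * a <= n * tau.
Proof.
  pose proof PI_gt_3. pose proof b_tau_ge. unfold n.
  replace (4 * PI * a * b * tau) with (4 * PI * (b * tau) * a) by ring.
  apply Rmult_le_compat_r; [lra|]. nra.
Qed.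

(** The left side is the factor |e| / b of the remainder, with |e| <= 2 a, divided by the factor b /
    (4 (1 + b)) in the lower bound of the main term. *)
Lemma weight_le : 4 * (2 * a) * ((1 + b) / b ^ 2) <= 16 * a * tau ^ 2.
Proof.
  pose proof tau_ge. pose proof b_tau_ge as B.
  assert (P : 0 < b ^ 2) by (apply pow_lt; lra).
  replace (16 * a * tau ^ 2) with (4 * (2 * a) * (2 * tau ^ 2)) by ring.
  apply Rmult_le_compat_l; [lra|].
  apply Rmult_le_reg_r with (b ^ 2); [easy|]. unfold Rdiv. rewrite Rmult_assoc, Rinv_l, Rmult_1_r by lra.
  replace (2 * tau ^ 2 * b ^ 2) with (2 * (b * tau) * (b * tau)) by ring.
  assert (1 <= b * tau) by lra.
  assert (b <= b * tau) by nra. nra.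
Qed.

Lemma choice_of_length : exists J : nat, tau <= INR J <= 2 * tau.
Proof.
  pose proof tau_ge.
  destruct (nfloor_ex tau) as [j Hj]; [lra|].
  exists (S j). rewrite S_INR. lra.
Qed.

(** The remainder near the origin. As n = 4 pi a b with a large, exp (pi b) uses up at most half of
    the exponent n / 10, and the weight, at most 2 n^2, is beaten by the cube of n. *)
Lemma cond_rem2 : 4 * (2 * a) * ((1 + b) / b ^ 2) * (exp (PI * b) * exp (- ((n - 2) / 10))) <= 1 / 200.
Proof.
  pose proof tau_ge as HT. pose proof b_tau_ge as HB. pose proof PI_gt_3. pose proof PI_lt_4.
  pose proof weight_le as HW. pose proof tau4_le_n as Hn4. pose proof a_le_n as HA. pose proof a_ge as HA5.
  assert (Hn1 : 10 ^ 15 <= n).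
  { replace (tau ^ 4) with (tau * tau ^ 3) in Hn4 by ring. pose proof (pow_tau_ge 3). nra. }
  assert (E : exp (PI * b) * exp (- ((n - 2) / 10)) <= 3 * exp (- (n / 20))).
  { rewrite <- exp_plus. apply Rle_trans with (exp (1 + - (n / 20))).
    - apply exp_le. unfold n in *.
      assert (20 <= 4 * a).
      { replace (tau ^ 5) with (tau * tau ^ 4) in HA5 by ring. pose proof (pow_tau_ge 4). nra. }
      assert (20 * (PI * b) <= 4 * a * (PI * b)) by (apply Rmult_le_compat_r; [nra|lra]). lra.
    - rewrite exp_plus. apply Rmult_le_compat_r; [apply Rlt_le, exp_pos|apply exp_le_3]. }
  eapply Rle_trans; [apply Rmult_le_compat; [| |exact HW|exact E]|].
  - apply Rmult_le_pos; [lra|]. apply Rmult_le_pos; [lra|]. apply Rlt_le, Rinv_0_lt_compat, pow_lt; lra.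
  - apply Rmult_le_pos; apply Rlt_le, exp_pos.
  - assert (P3 : 0 < tau ^ 3) by (apply pow_lt; lra).
    assert (T3 : tau ^ 3 <= n).
    { eapply Rle_trans; [|exact Hn4]. replace (tau ^ 4) with (tau * tau ^ 3) by ring. nra. }
    assert (16 * a * tau ^ 2 <= 2 * (n * n)).
    { apply Rle_trans with (2 * (n * tau) * tau ^ 2).
      - apply Rmult_le_compat_r; [apply pow2_ge_0|lra].
      - replace (2 * (n * tau) * tau ^ 2) with (2 * (n * tau ^ 3)) by ring.
        assert (n * tau ^ 3 <= n * n) by (apply Rmult_le_compat_l; lra). lra. }
    pose proof (exp_neg_cube (n / 20) ltac:(lra)) as EC.
    apply Rle_trans with (2 * (n * n) * (3 * (27 / (n / 20) ^ 3))).
    + apply Rmult_le_compat; try lra.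
      * assert (0 <= a * tau ^ 2) by (apply Rmult_le_pos; [lra|apply pow2_ge_0]). lra.
      * pose proof (exp_pos (- (n / 20))). lra.
    + replace (2 * (n * n) * (3 * (27 / (n / 20) ^ 3))) with (1296000 * / n) by (field; lra).
      assert (/ n <= / 10 ^ 15) by (apply Rinv_le_contravar; lra).
      assert (I15 : / 10 ^ 15 * 10 ^ 15 = 1) by (apply Rinv_l; lra). lra.
Qed.

Variable J : nat.
Hypothesis HJ : tau <= INR J <= 2 * tau.
Let K := 4 * INR J.

Lemma K4_le : K ^ 4 <= 4096 * tau ^ 4.
Proof.
  unfold K. replace (4096 * tau ^ 4) with ((8 * tau) ^ 4) by ring. apply pow_incr.
  pose proof tau_ge. lra.
Qed.

Lemma cond_a : 10 ^ 10 * K ^ 4 <= a.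
Proof.
  pose proof K4_le. pose proof tau_ge. pose proof a_ge as HA.
  replace (tau ^ 5) with (tau * tau ^ 4) in HA by ring.
  assert (0 < tau ^ 4) by (apply pow_lt; lra).
  assert (10 ^ 15 * tau ^ 4 <= tau * tau ^ 4) by (apply Rmult_le_compat_r; lra). lra.
Qed.

(** Here a b is n / (4 pi), at least (10 / 16) tau^4 L, while K^4 is at most 4096 tau^4; the size of
    L pays for 10^10 * 4096. *)
Lemma cond_ab : 10 ^ 10 * K ^ 4 <= a * b.
Proof.
  pose proof K4_le. pose proof tau_ge. pose proof PI_lt_4. unfold n in Hn.
  assert (0 < tau ^ 4) by (apply pow_lt; lra).
  assert (10 ^ 15 * tau ^ 4 <= L * tau ^ 4) by (apply Rmult_le_compat_r; lra).
  assert (0 < a * b) by nra.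
  assert (4 * PI * a * b <= 16 * (a * b)) by nra. lra.
Qed.

(** The geometric remainder. Of the four multiples of pi b J in the exponent, one absorbs exp (pi b)
    and three leave exp (- 9 b tau). If b is comparable with a, the weight is polynomial in b tau;
    otherwise b tau >= L turns the exponential into tau^(- 9), against a weight of at most 16
    tau^7. *)
Lemma cond_rem1 : 4 * (2 * a) * ((1 + b) / b ^ 2) * (exp (PI * b) * exp (- (PI * K * b))) <= 1 / 200.
Proof.
  pose proof tau_ge as HT. pose proof b_tau_ge as HB. pose proof PI_gt_3. pose proof weight_le as HW.
  assert (E : exp (PI * b) * exp (- (PI * K * b)) <= exp (- (9 * (b * tau)))).
  { rewrite <- exp_plus. apply exp_le. unfold K.
    assert (3 * (b * tau) <= PI * (b * INR J)).
    { apply Rmult_le_compat; [lra|nra|lra|]. apply Rmult_le_compat_l; lra. }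
    assert (PI * b <= PI * (b * INR J)).
    { apply Rmult_le_compat_l; [lra|]. assert (1 <= INR J) by lra. nra. }
    lra. }
  eapply Rle_trans; [apply Rmult_le_compat; [| |exact HW|exact E]|].
  - apply Rmult_le_pos; [lra|]. apply Rmult_le_pos; [lra|]. apply Rlt_le, Rinv_0_lt_compat, pow_lt; lra.
  - apply Rmult_le_pos; apply Rlt_le, exp_pos.
  - set (B := b * tau) in *. pose proof (exp_pos (- (9 * B))).
    destruct a_cases as [H1|H1].
    + assert (HA2 : a * tau <= 3 * B) by (unfold B; nra).
      assert (HB2 : tau <= B).
      { unfold B. pose proof a_ge as HA.
        assert (9 * 1 <= tau ^ 5).
        { replace (tau ^ 5) with (tau * tau ^ 4) by ring. pose proof (pow_tau_ge 4). nra. }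
        assert (1 <= b) by lra. nra. }
      assert (16 * a * tau ^ 2 <= 48 * (B * B)).
      { replace (16 * a * tau ^ 2) with (16 * (a * tau * tau)) by ring.
        assert (a * tau * tau <= 3 * B * B) by (apply Rmult_le_compat; nra). lra. }
      pose proof (exp_neg_cube (9 * B) ltac:(lra)) as EC.
      apply Rle_trans with (48 * (B * B) * (27 / (9 * B) ^ 3)).
      * apply Rmult_le_compat; try lra. assert (0 <= a * tau ^ 2) by (apply Rmult_le_pos; [lra|apply pow2_ge_0]). lra.
      * replace (48 * (B * B) * (27 / (9 * B) ^ 3)) with (16 / 9 * / B) by (field; lra).
        assert (/ B <= / 1000) by (apply Rinv_le_contravar; lra). lra.
    + assert (P5 : 0 < tau ^ 5) by (apply pow_lt; lra).
      assert (E9 : exp (- (9 * B)) <= / tau ^ 9).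
      { apply Rle_trans with (exp (- (9 * L))); [apply exp_le; lra|].
        rewrite exp_Ropp. right. f_equal. unfold tau.
        replace (9 * L) with (L + (L + (L + (L + (L + (L + (L + (L + L)))))))) by ring.
        rewrite !exp_plus. ring. }
      assert (16 * a * tau ^ 2 <= 16 * tau ^ 7).
      { replace (16 * tau ^ 7) with (16 * tau ^ 5 * tau ^ 2) by ring.
        apply Rmult_le_compat_r; [apply pow2_ge_0|lra]. }
      apply Rle_trans with (16 * tau ^ 7 * / tau ^ 9).
      * apply Rmult_le_compat; try lra. assert (0 <= a * tau ^ 2) by (apply Rmult_le_pos; [lra|apply pow2_ge_0]). lra.
      * replace (16 * tau ^ 7 * / tau ^ 9) with (16 * / tau * / tau) by (field; lra).
        assert (/ tau <= / 1000) by (apply Rinv_le_contravar; lra).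
        assert (0 < / tau) by (apply Rinv_0_lt_compat; lra). nra.
Qed.

Lemma cond_q : exp (- (8 * PI * INR J * b)) <= 1 / 100.
Proof.
  pose proof tau_ge as HT. pose proof b_tau_ge as HB. pose proof PI_gt_3.
  apply Rle_trans with (exp (- L)).
  - apply exp_le. assert (b * tau <= b * INR J) by (apply Rmult_le_compat_l; lra).
    assert (b * INR J <= PI * (b * INR J)) by nra. lra.
  - eapply Rle_trans; [apply exp_neg_le; lra|]. replace (1 / 100) with (/ 100) by field.
    apply Rinv_le_contravar; lra.
Qed.
End Numerics.

(** * The theta sum and the conclusion *)

Lemma Ci_sq : (Ci * Ci = - (1))%C.
Proof. apply C_ext; simpl; ring. Qed.

Lemma Cexp_Ci_RtoC x : Cexp (Ci * RtoC x) = (RtoC (cos x) + Ci * RtoC (sin x))%C.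
Proof.
  apply C_ext; rewrite ?Re_Cexp, ?Im_Cexp;
    replace (Re (Ci * RtoC x)%C) with 0 by (simpl; ring);
    replace (Im (Ci * RtoC x)%C) with x by (simpl; ring); rewrite exp_0; simpl; ring.
Qed.

Lemma Cexp_period N z : Cexp (z - RtoC (INR N) * (2 * RtoC PI * Ci))%C = Cexp z.
Proof.
  rewrite Cexp_minus, Cexp_mult_nat.
  replace (2 * RtoC PI * Ci)%C with (Ci * RtoC (2 * PI))%C by (rewrite RtoC_mult; ring).
  rewrite Cexp_Ci_RtoC, cos_2PI, sin_2PI.
  replace (1 + Ci * 0)%C with (RtoC 1) by ring.
  replace (RtoC 1 ^ N)%C with (RtoC 1).
  - field.
  - induction N as [|N IH]; simpl; [easy|]. rewrite <- IH. ring.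
Qed.

Lemma Cexp_Ci_PI : Cexp (Ci * RtoC PI) = (- (1))%C.
Proof. rewrite Cexp_Ci_RtoC, cos_PI, sin_PI. apply C_ext; simpl; ring. Qed.

(* Squares of odd numbers are 1 modulo 8, so the Gaussian phases of the saddle
   points have period four in k, with pattern +, -, -, +. *)
Section ThetaSum.
Variable e : C.
Let q := Cexp (RtoC PI * Ci * e)%C.
Let term (k : nat) : C :=
  (Cexp (RtoC PI * Ci * RtoC (INR (2 * k + 1)) * e)
   * Cexp (- (RtoC PI * Ci * RtoC (INR (2 * k + 1) ^ 2 / 8))))%C.

Lemma q_pow m : Cexp (RtoC PI * Ci * RtoC (INR m) * e) = (q ^ m)%C.
Proof. unfold q. rewrite <- Cexp_mult_nat. f_equal. ring. Qed.

(** (2 k + 1)^2 / 8 = 1/8 + k (k + 1) / 2, so only the parity of k (k + 1) / 2 matters. *)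
Lemma phase_even k N : (k * (k + 1) = 4 * N)%nat ->
  Cexp (- (RtoC PI * Ci * RtoC (INR (2 * k + 1) ^ 2 / 8))) = Cexp (- (Ci * RtoC (PI / 8))).
Proof.
  intros H. rewrite <- (Cexp_period N (- (Ci * RtoC (PI / 8)))%C). f_equal.
  apply (f_equal INR) in H. rewrite !mult_INR, plus_INR in H. simpl (INR 1) in H. simpl (INR 4) in H.
  rewrite plus_INR, mult_INR. simpl (INR 1). simpl (INR 2).
  replace (((1 + 1) * INR k + 1) ^ 2 / 8) with (1 / 8 + 2 * INR N) by lra.
  rewrite RtoC_plus, RtoC_mult, (RtoC_div 1 8), (RtoC_div PI 8) by lra. field.
Qed.

Lemma phase_odd k N : (k * (k + 1) = 4 * N + 2)%nat ->
  Cexp (- (RtoC PI * Ci * RtoC (INR (2 * k + 1) ^ 2 / 8))) = (- Cexp (- (Ci * RtoC (PI / 8))))%C.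
Proof.
  intros H.
  transitivity (Cexp (- (Ci * RtoC (PI / 8)) - Ci * RtoC PI)).
  - rewrite <- (Cexp_period N (- (Ci * RtoC (PI / 8)) - Ci * RtoC PI)%C). f_equal.
    apply (f_equal INR) in H. rewrite plus_INR, !mult_INR, plus_INR in H.
    simpl (INR 1) in H. simpl (INR 4) in H. simpl (INR 2) in H.
    rewrite plus_INR, mult_INR. simpl (INR 1). simpl (INR 2).
    replace (((1 + 1) * INR k + 1) ^ 2 / 8) with (1 / 8 + 1 + 2 * INR N) by lra.
    rewrite !RtoC_plus, RtoC_mult, (RtoC_div 1 8), (RtoC_div PI 8) by lra. field.
  - rewrite Cexp_minus, Cexp_Ci_PI. field.
Qed.

(** A block of four gives q - q^3 - q^5 + q^7 = (q - q^3) (1 - q^4), up to the common phase;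
    multiplied by 1 + q^4 it produces 1 - q^8, and the blocks telescope. *)
Lemma theta_sum J : ((1 + q ^ 4) * csum term (4 * J)
  = Cexp (- (Ci * RtoC (PI / 8))) * (q - q ^ 3) * (1 - q ^ (8 * J)))%C.
Proof.
  induction J as [|J IH].
  - simpl. ring.
  - replace (4 * S J)%nat with (S (S (S (S (4 * J))))) by lia. rewrite !csum_S.
    replace (8 * S J)%nat with (8 * J + 8)%nat by lia.
    assert (T0 : term (4 * J) = (q ^ (8 * J + 1) * Cexp (- (Ci * RtoC (PI / 8))))%C).
    { unfold term. rewrite q_pow, (phase_even _ (J * (4 * J + 1))) by lia. do 2 f_equal. lia. }
    assert (T1 : term (S (4 * J)) = (- (q ^ (8 * J + 3) * Cexp (- (Ci * RtoC (PI / 8)))))%C).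
    { unfold term. rewrite q_pow, (phase_odd _ (4 * J * J + 3 * J)) by lia.
      replace (2 * S (4 * J) + 1)%nat with (8 * J + 3)%nat by lia. ring. }
    assert (T2 : term (S (S (4 * J))) = (- (q ^ (8 * J + 5) * Cexp (- (Ci * RtoC (PI / 8)))))%C).
    { unfold term. rewrite q_pow, (phase_odd _ (4 * J * J + 5 * J + 1)) by lia.
      replace (2 * S (S (4 * J)) + 1)%nat with (8 * J + 5)%nat by lia. ring. }
    assert (T3 : term (S (S (S (4 * J)))) = (q ^ (8 * J + 7) * Cexp (- (Ci * RtoC (PI / 8))))%C).
    { unfold term. rewrite q_pow, (phase_even _ (4 * J * J + 7 * J + 3)) by lia. do 2 f_equal. lia. }
    rewrite T0, T1, T2, T3. rewrite !Cmult_plus_distr_l, IH, !Cpow_add_r. simpl Cpow. ring.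
Qed.

End ThetaSum.

Lemma csum_Cmod_le f B n : (forall k, (k < n)%nat -> Cmod (f k) <= B) -> Cmod (csum f n) <= INR n * B.
Proof.
  induction n as [|n IH]; intros H.
  - simpl. rewrite Cmod_0. lra.
  - rewrite csum_S, S_INR. eapply Rle_trans; [apply Cmod_triangle|].
    assert (Cmod (csum f n) <= INR n * B) by (apply IH; intros; apply H; lia).
    specialize (H n ltac:(lia)). lra.
Qed.

(** * Assembly of the main term and its errors *)

Section Assembly.
Variable s : C.
Let e := eta s.
Let q := Cexp (RtoC PI * Ci * e)%C.
Hypothesis Hs : (s - 1 = 2 * RtoC PI * Ci * e * e)%C.
Hypothesis Hb : 0 < Im e.
Hypothesis Hab : Im e < Re e.
Hypothesis Hre : Re s <= -1.

(** The saddle contributions summed over all odd m; it equals the main term except for Stirling's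
    error factor. *)
Let X : C := (kern s e * ((1 + Ci) / 2) * Cexp (- (Ci * RtoC (PI / 8))) * ((q - q ^ 3) / (1 + q ^ 4)))%C.

Lemma q_mod : Cmod q = exp (- (PI * Im e)).
Proof. unfold q. rewrite Cmod_Cexp. f_equal. simpl. unfold Re, Im. ring. Qed.

Lemma q_lt1 : 0 < Cmod q < 1.
Proof.
  rewrite q_mod. split; [apply exp_pos|]. pose proof PI_RGT_0. rewrite <- exp_0. apply exp_increasing. nra.
Qed.

Lemma q4_neq : (1 + q ^ 4)%C <> 0%C.
Proof.
  intros E. assert (F : (q ^ 4)%C = (- (1))%C) by (replace (q ^ 4)%C with ((1 + q ^ 4) - 1)%C by ring; rewrite E; ring).
  apply (f_equal Cmod) in F. rewrite Cmod_opp, Cmod_1, Cmod_pow in F. pose proof q_lt1.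
  assert (Cmod q * Cmod q < 1) by nra. assert (0 < Cmod q * Cmod q) by nra.
  replace (Cmod q ^ 4) with ((Cmod q * Cmod q) * (Cmod q * Cmod q)) in F by ring. nra.
Qed.

Lemma kern_neq0 : kern s e <> 0%C.
Proof. unfold kern, Cpowc. apply Cmult_neq_0; apply Cexp_neq0. Qed.

Lemma Cmod_1_Ci : 1 <= Cmod (1 + Ci)%C.
Proof. eapply Rle_trans; [|apply Re_le_Cmod]. simpl. lra. Qed.

(** The factor 1 - |q|^2, from |q - q^3| >= |q| (1 - |q|^2), tends to 0 with Im e: near the real
    axis sin (pi eta) may almost vanish, and every error has to be measured against this factor. *)
Lemma X_lower : Cmod (kern s e) * (Cmod q * (1 - Cmod q ^ 2)) / 4 <= Cmod X.
Proof.
  unfold X. rewrite !Cmod_mult, !Cmod_div by (apply q4_neq || (apply RtoC_neq; lra)).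
  rewrite (Cmod_Cexp (- _)), (Cmod_R 2), (Rabs_pos_eq 2) by lra.
  replace (Re (- (Ci * RtoC (PI / 8)))%C) with 0 by (simpl; ring). rewrite exp_0.
  pose proof q_lt1. pose proof Cmod_1_Ci.
  assert (A : Cmod q * (1 - Cmod q ^ 2) <= Cmod (q - q ^ 3)%C).
  { replace (q - q ^ 3)%C with (q * (1 - q ^ 2))%C by (simpl; ring). rewrite Cmod_mult.
    apply Rmult_le_compat_l; [lra|]. rewrite <- Cmod_pow.
    assert (T : Cmod 1 <= Cmod (1 - q ^ 2)%C + Cmod (q ^ 2)%C).
    { replace (RtoC 1) with ((1 - q ^ 2) + q ^ 2)%C at 1 by ring. apply Cmod_triangle. }
    rewrite Cmod_1 in T. lra. }
  assert (B : Cmod (1 + q ^ 4)%C <= 2).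
  { eapply Rle_trans; [apply Cmod_triangle|]. rewrite Cmod_1, Cmod_pow.
    assert (Cmod q ^ 4 <= 1 ^ 4) by (apply pow_incr; lra). lra. }
  assert (Bp : 0 < Cmod (1 + q ^ 4)%C) by (apply Cmod_gt_0, q4_neq).
  assert (D : Cmod q * (1 - Cmod q ^ 2) / 2 <= Cmod (q - q ^ 3)%C / Cmod (1 + q ^ 4)%C).
  { apply Rmult_le_compat; try easy.
    - apply Rmult_le_pos; [lra|]. assert (Cmod q ^ 2 <= 1 ^ 2) by (apply pow_incr; lra). lra.
    - lra.
    - now apply Rinv_le_contravar. }
  pose proof (Cmod_ge_0 (kern s e)).
  assert (0 <= Cmod q * (1 - Cmod q ^ 2) / 2).
  { assert (Cmod q ^ 2 <= 1 ^ 2) by (apply pow_incr; lra). assert (0 <= Cmod q * (1 - Cmod q ^ 2)) by (apply Rmult_le_pos; lra). lra. }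
  replace (Cmod (kern s e) * (Cmod q * (1 - Cmod q ^ 2)) / 4)
    with (Cmod (kern s e) * (1 / 2) * 1 * (Cmod q * (1 - Cmod q ^ 2) / 2)) by field.
  apply Rmult_le_compat; try easy; [|].
  - apply Rmult_le_pos; [apply Rmult_le_pos|]; lra.
  - apply Rmult_le_compat_r; [lra|]. apply Rmult_le_compat_l; [easy|]. lra.
Qed.

(** By Stirling and s - 1 = 2 pi i e^2, the product of chi, e^(s - 1) and exp (- i pi e^2) is
    [kern s e] times exp (i pi / 4) and the error factor. The quotient of sine and cosine is i / 2
    times (q - q^3) / (1 + q^4), and i exp (3 pi i / 8) = - exp (- i pi / 8) accounts for the
    sign. *)
Lemma main_term_eq dlt :
  chi s = Cexp ((1 - 2 * s) * CLog e + Ci * RtoC (PI / 4) + (s - 1) + dlt)%C ->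
  main_term s = (X * Cexp dlt)%C.
Proof.
  intros Hchi. unfold main_term. fold e. rewrite Hchi. unfold Cpowc at 1.
  pose proof q4_neq as N4.
  assert (N4' : (1 + q * (q * (q * q)))%C <> 0%C).
  { intros E. apply N4. rewrite <- E. simpl. ring. }
  assert (Nq : q <> 0%C) by apply Cexp_neq0.
  pose proof Ci_neq0 as NC. pose proof Ci_sq as C2i.
  assert (Sn : (Csin (RtoC PI * e) / (2 * Ccos (2 * RtoC PI * e)) = (q - q ^ 3) / (1 + q ^ 4) * (Ci / 2))%C).
  { unfold Csin, Ccos. rewrite !Cexp_opp.
    replace (Ci * (RtoC PI * e))%C with (RtoC PI * Ci * e)%C by ring. fold q.
    replace (Cexp (Ci * (2 * RtoC PI * e)))%C with (q * q)%C.
    2: { unfold q. rewrite <- Cexp_plus. f_equal. ring. }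
    transitivity ((q ^ 3 - q) / (1 + q ^ 4) / (2 * Ci))%C.
    - simpl. field. repeat split; assumption.
    - replace (/ (2 * Ci))%C with (- (Ci / 2))%C.
      + unfold Cdiv at 1 2. replace (/ (2 * Ci))%C with (- (Ci / 2))%C.
        * simpl. field. exact N4'.
        * transitivity (- (Ci * Ci) / (2 * Ci))%C; [field; exact NC|rewrite C2i; field; exact NC].
      + transitivity (- (Ci * Ci) / (2 * Ci))%C; [field; exact NC|rewrite C2i; field; exact NC]. }
  assert (Ph : (Cexp (Ci * RtoC (3 * PI / 8)) * Ci = - Cexp (- (Ci * RtoC (PI / 8))))%C).
  { rewrite <- Cexp_i_pi2 at 2. rewrite <- Cexp_plus.
    transitivity (Cexp (- (Ci * RtoC (PI / 8)) - - (Ci * RtoC PI)))%C.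
    - f_equal. rewrite (RtoC_div (3 * PI) 8), (RtoC_div PI 2), (RtoC_div PI 8), RtoC_mult by lra. field.
    - rewrite Cexp_minus, (Cexp_opp (Ci * RtoC PI)), Cexp_Ci_PI. field. }
  assert (S2 : (RtoC (sqrt 2) * Cexp (Ci * RtoC (PI / 4)) = 1 + Ci)%C).
  { rewrite Cexp_Ci_RtoC, cos_PI4, sin_PI4.
    assert (Q : sqrt 2 * (1 / sqrt 2) = 1) by (field; apply Rgt_not_eq, sqrt_lt_R0; lra).
    apply (f_equal RtoC) in Q. rewrite RtoC_mult in Q.
    transitivity (RtoC (sqrt 2) * RtoC (1 / sqrt 2) * (1 + Ci))%C; [ring|]. rewrite Q. ring. }
  transitivity (- (Cexp ((1 - 2 * s) * CLog e + Ci * RtoC (PI / 4) + (s - 1) + dlt)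
      * Cexp ((s - 1) * CLog e) * Cexp (- (RtoC PI * Ci * e * e)))
     * (RtoC (sqrt 2) * Cexp (Ci * RtoC (3 * PI / 8)) * (Csin (RtoC PI * e) / (2 * Ccos (2 * RtoC PI * e)))))%C.
  { unfold Cdiv. ring. }
  rewrite Sn. rewrite <- !Cexp_plus.
  replace ((1 - 2 * s) * CLog e + Ci * RtoC (PI / 4) + (s - 1) + dlt + (s - 1) * CLog e
     + - (RtoC PI * Ci * e * e))%C
    with (- s * CLog e + RtoC PI * Ci * e * e + Ci * RtoC (PI / 4) + dlt)%C.
  2: { transitivity (- s * CLog e + (2 * RtoC PI * Ci * e * e) + Ci * RtoC (PI / 4) + dlt - RtoC PI * Ci * e * e)%C; [ring|].
       rewrite <- Hs. ring. }
  rewrite !Cexp_plus.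
  transitivity (- (Cexp (- s * CLog e) * Cexp (RtoC PI * Ci * e * e) * Cexp dlt)
     * ((RtoC (sqrt 2) * Cexp (Ci * RtoC (PI / 4))) * (Cexp (Ci * RtoC (3 * PI / 8)) * Ci))
     * ((q - q ^ 3) / (1 + q ^ 4)) / 2)%C.
  { unfold Cdiv. ring. }
  rewrite S2, Ph. unfold X, kern, Cpowc, Cdiv. ring.
Qed.

Variable J : nat.
(** Whole periods of the phases, so that [theta_sum] applies. *)
Let K := (4 * J)%nat.
Hypothesis HJ : (1 <= J)%nat.
Hypothesis Ca : 10 ^ 10 * INR K ^ 4 <= Re e.
Hypothesis Cab : 10 ^ 10 * INR K ^ 4 <= Re e * Im e.
Hypothesis Cr1 : 4 * (2 * Re e) * ((1 + Im e) / Im e ^ 2) * (exp (PI * Im e) * exp (- (PI * INR K * Im e))) <= 1 / 200.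
Hypothesis Cr2 : 4 * (2 * Re e) * ((1 + Im e) / Im e ^ 2) * (exp (PI * Im e) * exp (- ((-1 - Re s) / 10))) <= 1 / 200.
Hypothesis Cq : exp (- (8 * PI * INR J * Im e)) <= 1 / 100.
Hypothesis Ctt : 10 ^ 6 <= Im s.

Lemma K_ge : 4 <= INR K.
Proof. unfold K. apply le_INR in HJ. rewrite mult_INR. simpl (INR 4). simpl (INR 1) in HJ. lra. Qed.

Lemma eta_bounds : Re e <= Cmod e <= 2 * Re e.
Proof.
  split; [apply Re_le_Cmod|]. eapply Rle_trans; [apply Cmod_le_abs|]. rewrite !Rabs_pos_eq by lra. lra.
Qed.

Lemma one_minus_q2 : Im e / (1 + Im e) <= 1 - Cmod q ^ 2.
Proof.
  pose proof PI_gt_3. rewrite q_mod.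
  replace (exp (- (PI * Im e)) ^ 2) with (exp (- (2 * PI * Im e))).
  2: { replace (- (2 * PI * Im e)) with (- (PI * Im e) + - (PI * Im e)) by ring. rewrite exp_plus. ring. }
  assert (E : exp (- (2 * PI * Im e)) <= / (1 + Im e)).
  { rewrite exp_Ropp. apply Rinv_le_contravar; [lra|]. pose proof (exp_ineq1_le (2 * PI * Im e)). nra. }
  replace (Im e / (1 + Im e)) with (1 - / (1 + Im e)) by (field; lra). lra.
Qed.

Lemma X_lower2 : Cmod (kern s e) * Cmod q * (Im e / (1 + Im e)) / 4 <= Cmod X.
Proof.
  eapply Rle_trans; [|apply X_lower]. pose proof one_minus_q2. pose proof q_lt1.
  assert (0 <= Cmod (kern s e) * Cmod q) by (apply Rmult_le_pos; [apply Cmod_ge_0|lra]).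
  rewrite <- (Rmult_assoc (Cmod (kern s e))). apply Rmult_le_compat_r; [lra|]. now apply Rmult_le_compat_l.
Qed.

Lemma X_pos : 0 < Cmod X.
Proof.
  eapply Rlt_le_trans; [|apply X_lower2]. pose proof q_lt1.
  assert (0 < Cmod (kern s e)) by apply Cmod_gt_0, kern_neq0.
  assert (0 < Im e / (1 + Im e)) by (apply Rdiv_lt_0_compat; lra).
  assert (0 < Cmod (kern s e) * Cmod q * (Im e / (1 + Im e))); [|lra].
  apply Rmult_lt_0_compat; [apply Rmult_lt_0_compat|]; lra.
Qed.

(** The K errors, with m <= 2 K, total at most 8 * 10^6 K^4 / |e| relative to |kern s e| |q|, and
    must stay below a hundredth of Im e / (4 (1 + Im e)). [Cab] serves for small Im e, [Ca] for
    large Im e, and their sum gives the factor 1 + Im e. *)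
Lemma saddle_sum (T : nat -> C) :
  (forall k, (k < K)%nat -> exists Ginf G0, T k = (Ginf - G0)%C /\
    (forall d, 0 < Re d -> 0 < Im d -> tinf d (gprim s (INR (2 * k + 1))) Ginf) /\
    (forall d, 0 < Re d -> tzero d (gprim s (INR (2 * k + 1))) G0)) ->
  Cmod (csum T K - X * (1 - q ^ (8 * J)))%C <= 1 / 100 * Cmod X.
Proof.
  intros HT. pose proof K_ge as HK. pose proof q_lt1 as Hq. pose proof eta_bounds as [E1 E2].
  set (ap := fun k : nat => (kern s e * ((1 + Ci) / 2) * (Cexp (RtoC PI * Ci * RtoC (INR (2 * k + 1)) * e)
   * Cexp (- (RtoC PI * Ci * RtoC (INR (2 * k + 1) ^ 2 / 8)))))%C).
  assert (Sap : csum ap K = (X * (1 - q ^ (8 * J)))%C).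
  { pose proof (theta_sum e J) as TS. fold K in TS. fold q in TS.
    assert (F : forall n, csum ap n = (kern s e * ((1 + Ci) / 2) * csum (fun k => (Cexp (RtoC PI * Ci * RtoC (INR (2 * k + 1)) * e)
       * Cexp (- (RtoC PI * Ci * RtoC (INR (2 * k + 1) ^ 2 / 8))))%C) n)%C).
    { induction n as [|n IH]; [simpl; ring|]. rewrite !csum_S, IH. unfold ap. ring. }
    rewrite F. pose proof q4_neq as N4.
    set (th := csum _ K) in *.
    replace th with ((1 + q ^ 4) * th / (1 + q ^ 4))%C by (field; exact N4).
    rewrite TS. unfold X, Cdiv. ring. }
  rewrite <- Sap.
  assert (Sub : forall n, (csum T n - csum ap n = csum (fun k => T k - ap k) n)%C).
  { induction n as [|n IH]; [simpl; ring|]. rewrite !csum_S, <- IH. ring. }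
  rewrite Sub.
  set (M := Cmod (kern s e)).
  assert (HM : 0 < M) by (apply Cmod_gt_0, kern_neq0).
  assert (HK4 : 1 <= INR K ^ 3) by (apply pow_R1_Rle; lra).
  assert (K34 : INR K ^ 4 = INR K * INR K ^ 3) by ring.
  eapply Rle_trans.
  - apply (csum_Cmod_le _ (10 ^ 6 * (M * Cmod q * (8 * INR K ^ 3 * / Cmod e)))).
    intros k Hk. destruct (HT k Hk) as [Ginf [G0 [ET [HI HZ]]]].
    set (m := INR (2 * k + 1)).
    assert (Hm1 : 1 <= m).
    { unfold m. change 1 with (INR 1). apply le_INR. lia. }
    assert (Hm2 : m <= 2 * INR K).
    { unfold m. change 2 with (INR 2). rewrite <- mult_INR. apply le_INR. lia. }
    assert (Hm3 : m ^ 3 <= 8 * INR K ^ 3).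
    { replace (8 * INR K ^ 3) with ((2 * INR K) ^ 3) by ring. apply pow_incr. lra. }
    pose proof (saddle_asymptotics s e m Hs Hb Hab Hre Hm1) as SA.
    assert (Hm4 : m ^ 3 <= Re e) by nra.
    assert (Ha6 : 10 ^ 6 <= Re e) by nra.
    specialize (SA Hm4 Ha6 Ginf G0 HI HZ).
    rewrite ET.
    match type of SA with Cmod ?A <= _ => replace A with (Ginf - G0 - ap k)%C in SA by (unfold ap, m; ring) end.
    eapply Rle_trans; [exact SA|].
    apply Rmult_le_compat_l; [lra|].
    assert (Hinv : 0 < / Cmod e) by (apply Rinv_0_lt_compat; lra).
    assert (HB : Cmod (kern s e * Cexp (RtoC PI * Ci * RtoC m * e) * Cexp (- (RtoC PI * Ci * RtoC (m ^ 2 / 8))))%C <= M * Cmod q).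
    { rewrite !Cmod_mult. fold M. rewrite (Cmod_Cexp (- _)).
      replace (Re (- (RtoC PI * Ci * RtoC (m ^ 2 / 8)))%C) with 0 by (simpl; ring). rewrite exp_0, Rmult_1_r.
      apply Rmult_le_compat_l; [lra|]. unfold m. rewrite q_pow, Cmod_pow. fold q.
      replace (2 * k + 1)%nat with (S (2 * k)) by lia. simpl pow.
      assert (Cmod q ^ (k + (k + 0)) <= 1).
      { rewrite <- (pow1 (k + (k + 0))). apply pow_incr. lra. }
      nra. }
    apply Rmult_le_compat; [apply Cmod_ge_0| |exact HB|].
    + apply Rmult_le_pos; [apply pow_le; lra|lra].
    + apply Rmult_le_compat_r; lra.
  - pose proof X_lower2 as XL. fold M in XL.
    assert (Hp : 0 < M * Cmod q) by (apply Rmult_lt_0_compat; lra).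
    assert (Main : INR K * (10 ^ 6 * (8 * INR K ^ 3 * / Cmod e)) <= 1 / 100 * (Im e / (1 + Im e) / 4)).
    { replace (INR K * (10 ^ 6 * (8 * INR K ^ 3 * / Cmod e))) with (8 * 10 ^ 6 * INR K ^ 4 * / Cmod e) by ring.
      apply Rmult_le_reg_r with (Cmod e); [lra|]. rewrite Rmult_assoc, Rinv_l, Rmult_1_r by lra.
      apply Rmult_le_reg_r with (400 * (1 + Im e)); [lra|].
      replace (1 / 100 * (Im e / (1 + Im e) / 4) * Cmod e * (400 * (1 + Im e))) with (Im e * Cmod e) by (field; lra).
      assert (Re e * Im e <= Im e * Cmod e) by (rewrite Rmult_comm; apply Rmult_le_compat_l; lra).
      assert (10 ^ 10 * INR K ^ 4 * Im e <= Re e * Im e) by (apply Rmult_le_compat_r; lra).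
      nra. }
    replace (INR K * (10 ^ 6 * (M * Cmod q * (8 * INR K ^ 3 * / Cmod e))))
      with (M * Cmod q * (INR K * (10 ^ 6 * (8 * INR K ^ 3 * / Cmod e)))) by ring.
    apply Rle_trans with (M * Cmod q * (1 / 100 * (Im e / (1 + Im e) / 4))).
    + now apply Rmult_le_compat_l; [lra|].
    + lra.
Qed.

(** Dividing the remainder by the lower bound of X produces exactly the left sides of [Cr1] and
    [Cr2]; exp (pi Im e) there is 1 / |q|. *)
Lemma remainder_le Rv : Cmod Rv <= Cmod (kern s e) * Cmod e / Im e *
    (exp (- (PI * INR K * Im e)) + exp (- ((- 1 - Re s) / 10))) -> Cmod Rv <= 1 / 100 * Cmod X.
Proof.
  intros H. eapply Rle_trans; [exact H|]. pose proof q_lt1 as Hq. pose proof eta_bounds as [E1 E2].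
  pose proof X_lower2 as XL. set (M := Cmod (kern s e)) in *.
  assert (HM : 0 < M) by (apply Cmod_gt_0, kern_neq0).
  set (A := exp (- (PI * INR K * Im e))) in *. set (B := exp (- ((- 1 - Re s) / 10))) in *.
  assert (PA : 0 < A) by apply exp_pos. assert (PB : 0 < B) by apply exp_pos.
  assert (Q1 : exp (PI * Im e) * Cmod q = 1) by (rewrite q_mod, <- exp_plus, Rplus_opp_r; apply exp_0).
  set (P := exp (PI * Im e)) in *. assert (PP : 0 < P) by apply exp_pos.
  set (b := Im e) in *.
  assert (Sum : 4 * (2 * Re e) * ((1 + b) / b ^ 2) * (P * (A + B)) <= 1 / 100) by lra.
  assert (W : 0 < Cmod q * (b / (1 + b))).
  { apply Rmult_lt_0_compat; [lra|]. apply Rdiv_lt_0_compat; lra. }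
  assert (F : 2 * Re e / b * (A + B) <= 1 / 100 * (Cmod q * (b / (1 + b)) / 4)).
  { replace (2 * Re e / b * (A + B))
      with ((4 * (2 * Re e) * ((1 + b) / b ^ 2) * (P * (A + B))) * (Cmod q * (b / (1 + b)) / 4)).
    - apply Rmult_le_compat_r; lra.
    - replace (4 * (2 * Re e) * ((1 + b) / b ^ 2) * (P * (A + B)) * (Cmod q * (b / (1 + b)) / 4))
        with ((P * Cmod q) * (2 * Re e / b * (A + B))) by (field; lra).
      rewrite Q1. ring. }
  apply Rle_trans with (M * (2 * Re e / b * (A + B))).
  - replace (M * Cmod e / b * (A + B)) with (M * (Cmod e / b * (A + B))) by (field; lra).
    apply Rmult_le_compat_l; [lra|]. apply Rmult_le_compat_r; [lra|].
    apply Rmult_le_compat_r; [apply Rlt_le, Rinv_0_lt_compat; lra|easy].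
  - apply Rle_trans with (M * (1 / 100 * (Cmod q * (b / (1 + b)) / 4))); [apply Rmult_le_compat_l; lra|].
    replace (M * (1 / 100 * (Cmod q * (b / (1 + b)) / 4))) with (1 / 100 * (M * Cmod q * (b / (1 + b)) / 4)) by (field; lra).
    apply Rmult_le_compat_l; [lra|exact XL].
Qed.

Lemma q8J_le : Cmod (q ^ (8 * J))%C <= 1 / 100.
Proof.
  rewrite Cmod_pow, q_mod. eapply Rle_trans; [|exact Cq]. right.
  assert (E : forall N x, exp x ^ N = exp (INR N * x)).
  { induction N as [|N IH]; intros x; [simpl; now rewrite Rmult_0_l, exp_0|].
    rewrite S_INR, Rmult_plus_distr_r, exp_plus, <- IH, Rmult_1_l. simpl. ring. }
  rewrite E, mult_INR. f_equal. simpl (INR 8). ring.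
Qed.

(** The four small quantities are exp (i pi s) from the lower half of the contour, the tail q^(8 J),
    the saddle and remainder errors relative to X, and Stirling's error. Their combined effect stays
    far below 1. *)
Lemma near_one (x y z w : C) : Cmod x <= 1 / 100 -> Cmod y <= 1 / 100 -> Cmod z <= 1 / 50 -> Cmod w <= 1 / 50 ->
  Cmod ((1 - x) * (1 - y + z) * (1 + w) - 1)%C < 1.
Proof.
  intros Hx Hy Hz Hw.
  assert (P1 : Cmod (1 - x)%C <= 101 / 100).
  { unfold Cminus. eapply Rle_trans; [apply Cmod_triangle|]. rewrite Cmod_opp, Cmod_1. lra. }
  assert (P2 : Cmod (- y + z)%C <= 3 / 100).
  { eapply Rle_trans; [apply Cmod_triangle|]. rewrite Cmod_opp. lra. }
  assert (P3 : Cmod (1 + w)%C <= 102 / 100).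
  { eapply Rle_trans; [apply Cmod_triangle|]. rewrite Cmod_1. lra. }
  replace ((1 - x) * (1 - y + z) * (1 + w) - 1)%C
    with ((1 - x) * (- y + z) * (1 + w) + ((1 - x) * w + - x))%C by ring.
  eapply Rle_lt_trans; [apply Cmod_triangle|].
  eapply Rle_lt_trans; [apply Rplus_le_compat_l, Cmod_triangle|].
  rewrite !Cmod_mult, Cmod_opp.
  pose proof (Cmod_ge_0 (1 - x)%C). pose proof (Cmod_ge_0 (- y + z)%C). pose proof (Cmod_ge_0 (1 + w)%C).
  pose proof (Cmod_ge_0 w).
  assert (Cmod (1 - x)%C * Cmod (- y + z)%C <= 101 / 100 * (3 / 100)) by (apply Rmult_le_compat; lra).
  assert (0 <= Cmod (1 - x)%C * Cmod (- y + z)%C) by (apply Rmult_le_pos; lra).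
  assert (Cmod (1 - x)%C * Cmod (- y + z)%C * Cmod (1 + w)%C <= 101 / 100 * (3 / 100) * (102 / 100))
    by (apply Rmult_le_compat; lra).
  assert (Cmod (1 - x)%C * Cmod w <= 101 / 100 * (1 / 50)) by (apply Rmult_le_compat; lra).
  lra.
Qed.

Lemma assembled : exists U : C, Cmod U < 1 /\
  forall c : R, 0 < c < 1 -> RiemannAux_is s c (main_term s * (1 + U))%C.
Proof.
  assert (Him : 0 < Im s) by lra.
  destruct (fprim_limits s Hre Him) as [Pinf [P0 [HI HZ]]].
  pose proof (RiemannAux_value s Hre Him Pinf P0 HI HZ) as RV.
  assert (Lim : forall k : nat, exists p : C * C,
    (forall d, 0 < Re d -> 0 < Im d -> tinf d (gprim s (INR (2 * k + 1))) (fst p)) /\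
    (forall d, 0 < Re d -> tzero d (gprim s (INR (2 * k + 1))) (snd p))).
  { intros k. destruct (gprim_limits s e Hs Hb Hab Hre (INR (2 * k + 1)) (pos_INR _)) as [Ginf [G0 [A B]]].
    now exists (Ginf, G0). }
  (* Finitely many limits suffice; they are collected by induction on the number of terms, without
     any choice principle. *)
  assert (Lim' : exists g : nat -> C * C, forall k, (k < K)%nat ->
    (forall d, 0 < Re d -> 0 < Im d -> tinf d (gprim s (INR (2 * k + 1))) (fst (g k))) /\
    (forall d, 0 < Re d -> tzero d (gprim s (INR (2 * k + 1))) (snd (g k)))).
  { generalize K. intros N. induction N as [|N [g IH]].
    - exists (fun _ => (RtoC 0, RtoC 0)). intros k Hk. lia.
    - destruct (Lim N) as [p Hp]. exists (fun k => if Nat.eqb k N then p else g k).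
      intros k Hk. destruct (Nat.eqb_spec k N) as [->|Ne]; [exact Hp|]. apply IH. lia. }
  destruct Lim' as [g Hg].
  set (T := fun k => (fst (g k) - snd (g k))%C).
  (* The value of the upper half contour after K terms are removed: the total increment of [remprim]
     from 0 to infinity, since the expansion enters with a minus sign. *)
  set (Rv := ((Pinf - P0) + csum T K)%C).
  assert (HRv : Cmod Rv <= Cmod (kern s e) * Cmod e / Im e *
    (exp (- (PI * INR K * Im e)) + exp (- ((- 1 - Re s) / 10)))).
  { assert (TI : tinf e (remprim s K) (Pinf + csum (fun k => fst (g k)) K)%C).
    { apply (tinf_plus e (fprim s)).
      - destruct (HI 0%C e) as [C0 [v0 [Q Hv]]]; [lra|lra|]. exists C0, v0. split; [easy|].
        intros v Hv'. replace (RtoC v * e)%C with (0 + RtoC v * e)%C by ring. now apply Hv.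
      - apply (tinf_csum e (fun k => gprim s (INR (2 * k + 1)))). intros k Hk.
        destruct (Hg k Hk) as [A _]. apply A; lra. }
    assert (TZ : tzero e (remprim s K) (P0 + csum (fun k => snd (g k)) K)%C).
    { apply (tzero_plus e (fprim s)).
      - destruct (HZ e) as [C1 H1]; [lra|]. pose proof (Cmod_ge_0 e).
        exists (Rabs C1), (exp (- (2)) / (1 + Cmod e)). split; [apply Rabs_pos|].
        split; [apply Rdiv_lt_0_compat; [apply exp_pos|lra]|].
        intros u Hu. eapply Rle_trans; [apply H1; [easy|]|].
        { apply Rmult_le_reg_r with (/ (1 + Cmod e)); [apply Rinv_0_lt_compat; lra|].
          rewrite Rmult_assoc, Rinv_r, Rmult_1_r by lra. apply Hu. }
        apply Rmult_le_compat_r; [lra|apply Rle_abs].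
      - apply (tzero_csum e (fun k => gprim s (INR (2 * k + 1)))). intros k Hk.
        destruct (Hg k Hk) as [_ A]. apply A; lra. }
    replace Rv with ((Pinf + csum (fun k => fst (g k)) K) - (P0 + csum (fun k => snd (g k)) K))%C.
    2: { unfold Rv. assert (Sb : forall n, (csum T n = csum (fun k => fst (g k)) n - csum (fun k => snd (g k)) n)%C).
         { induction n as [|n IH]; [simpl; ring|]. rewrite !csum_S, IH. unfold T. ring. }
         rewrite Sb. ring. }
    apply (tzero_bound e (remprim s K) _ _ (1 / 2)); [lra|exact TZ|]. intros u Hu.
    apply (tinf_bound e (remprim s K)); [exact TI|]. intros v Hv.
    now apply remprim_bound. }
  pose proof (remainder_le Rv HRv) as HR.
  assert (HT : Cmod (csum T K - X * (1 - q ^ (8 * J)))%C <= 1 / 100 * Cmod X).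
  { apply saddle_sum. intros k Hk. destruct (Hg k Hk) as [A B].
    exists (fst (g k)), (snd (g k)). now split. }
  destruct (chi_stirling s e Hs Hb Hab) as [dlt [Hd Hchi]]; [lra|].
  pose proof (main_term_eq dlt Hchi) as HMT.
  pose proof X_pos as XP. assert (XN : X <> 0%C) by (now apply Cmod_gt_0).
  set (k := Cexp (Ci * RtoC PI * s)).
  set (Err := (csum T K - X * (1 - q ^ (8 * J)))%C) in *.
  set (z := ((Err - Rv) / X)%C).
  set (w := (Cexp (- dlt) - 1)%C).
  (* R(s) = (k - 1) (Rv - csum T K) = (1 - k) X (1 - q^(8 J) + z), and dividing by [main_term s] = X
     exp (dlt) leaves the factor 1 + w = exp (- dlt). *)
  exists ((1 - k) * (1 - q ^ (8 * J) + z) * (1 + w) - 1)%C. split.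
  - apply near_one.
    + unfold k. rewrite Cmod_Cexp. replace (Re (Ci * RtoC PI * s)%C) with (- (PI * Im s)) by (simpl; unfold Re, Im; ring).
      pose proof PI_gt_3.
      eapply Rle_trans; [apply exp_neg_le; nra|]. replace (1 / 100) with (/ 100) by field.
      apply Rinv_le_contravar; nra.
    + apply q8J_le.
    + unfold z. rewrite Cmod_div by exact XN. apply Rmult_le_reg_r with (Cmod X); [easy|].
      unfold Rdiv. rewrite Rmult_assoc, Rinv_l, Rmult_1_r by lra.
      unfold Cminus. eapply Rle_trans; [apply Cmod_triangle|]. rewrite Cmod_opp. lra.
    + unfold w. eapply Rle_trans; [apply Cexp_sub_1|]. rewrite Cmod_opp.
      assert (D : Cmod dlt <= / 1000).
      { eapply Rle_trans; [exact Hd|]. apply Rle_trans with (100 * / 10 ^ 6); [|lra].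
        apply Rmult_le_compat_l; [lra|]. apply Rinv_le_contravar; lra. }
      assert (exp (Cmod dlt) <= 3) by (eapply Rle_trans; [apply exp_le|apply exp_le_3]; lra).
      pose proof (Cmod_ge_0 dlt). pose proof (exp_pos (Cmod dlt)). nra.
  - intros c Hc. specialize (RV c Hc). fold k in RV.
    replace (main_term s * (1 + ((1 - k) * (1 - q ^ (8 * J) + z) * (1 + w) - 1)))%C
      with ((k - 1) * (Pinf - P0))%C; [exact RV|].
    rewrite HMT.
    replace (Pinf - P0)%C with (Rv - csum T K)%C by (unfold Rv; ring).
    replace (csum T K) with (Err + X * (1 - q ^ (8 * J)))%C by (unfold Err; ring).
    unfold w, z. rewrite Cexp_opp. generalize (q ^ (8 * J))%C. intros Q.
    pose proof (Cexp_neq0 dlt) as ND. field. split; assumption.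
Qed.
End Assembly.

(** * The choice of the constants *)

Theorem mainTheorem9 :
  exists A t0 : R, 0 < A /\ 0 < t0 /\
    forall s : C,
      t0 < Im s ->
      A * Rpower (Im s) (2 / 5) * ln (Im s) <= 1 - Re s ->
      exists U : C, Cmod U < 1 /\
        forall c : R, 0 < c < 1 ->
          RiemannAux_is s c (main_term s * (1 + U))%C.
Proof.
  (* With L = ln t / 10 and tau = exp L = t^(1/10), the choice A = 1 is the hypothesis 10 tau^4 L <=
     n, and t > exp (10^16) yields L >= 10^15, which absorbs all numerical constants. *)
  exists 1, (exp (10 ^ 16)). split; [lra|]. split; [apply exp_pos|].
  intros s Ht Hn.
  assert (Tp : 0 < Im s) by (pose proof (exp_pos (10 ^ 16)); lra).
  set (L := ln (Im s) / 10).
  assert (HL : 10 ^ 15 <= L).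
  { unfold L. assert (10 ^ 16 <= ln (Im s)) by (rewrite <- (ln_exp (10 ^ 16)); apply ln_le; [apply exp_pos|lra]). lra. }
  assert (E10 : exp L ^ 10 = Im s).
  { rewrite <- (exp_ln (Im s)) by easy. replace (ln (Im s)) with (10 * L) by (unfold L; field).
    replace (10 * L) with (L + (L + (L + (L + (L + (L + (L + (L + (L + L))))))))) by ring.
    rewrite !exp_plus. ring. }
  assert (E4 : Rpower (Im s) (2 / 5) = exp L ^ 4).
  { unfold Rpower. replace (2 / 5 * ln (Im s)) with (L + (L + (L + L))) by (unfold L; field).
    rewrite !exp_plus. ring. }
  assert (HnL : 10 * exp L ^ 4 * L <= 1 - Re s).
  { rewrite E4 in Hn. replace (10 * exp L ^ 4 * L) with (1 * exp L ^ 4 * ln (Im s)) by (unfold L; field). exact Hn. }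
  assert (T1 : 1 <= exp L) by (pose proof (exp_ineq1_le L); lra).
  assert (T4 : 1 <= exp L ^ 4) by (now apply pow_R1_Rle).
  assert (Hre : Re s <= -1) by nra.
  destruct (eta_spec s Tp ltac:(lra)) as [Hs [Hb Hab]].
  set (e := eta s) in *.
  assert (Hre2 : 1 - Re s = 4 * PI * Re e * Im e) by (rewrite (Re_s s e Hs); ring).
  assert (Him2 : exp L ^ 10 = 2 * PI * (Re e ^ 2 - Im e ^ 2)) by (rewrite E10; apply (Im_s s e Hs)).
  assert (Hbb : 0 < Im e < Re e) by lra.
  rewrite Hre2 in HnL.
  destruct (choice_of_length L HL) as [J HJ].
  assert (J1 : (1 <= J)%nat).
  { apply INR_le. simpl (INR 1). lra. }
  assert (EK : INR (4 * J) = 4 * INR J) by (rewrite mult_INR; simpl (INR 4); ring).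
  apply (assembled s Hs Hb Hab Hre J J1); fold e.
  - rewrite EK. now apply (cond_a (Re e) (Im e) L).
  - rewrite EK. now apply (cond_ab (Re e) (Im e) L).
  - rewrite EK. now apply (cond_rem1 (Re e) (Im e) L).
  - replace (-1 - Re s) with (4 * PI * Re e * Im e - 2) by lra. now apply (cond_rem2 (Re e) (Im e) L).
  - now apply (cond_q (Re e) (Im e) L).
  - rewrite <- E10. replace (exp L ^ 10) with (exp L * exp L ^ 9) by ring.
    assert (1 <= exp L ^ 9) by (now apply pow_R1_Rle). pose proof (exp_ineq1_le L). nra.
Qed.
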